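(* Let $G$ be an $xy$-sum of connected graphs $G_1$ and $G_2$. The graph $G_1$ is minor-tight in $G$ if and only if all of the following statements hold. (i) If $xy\in E(G)$, then $G_1\in\mathcal{C}^\circ(g^+)$ if $\epsilon^+(G_2)=0$, and $G_1\in\mathcal{C}^\circ(g_a^+)$ otherwise. (ii) If $xy\notin E(G)$ and $\eta(G_1,G_2)=-1$, then $G_1\in\mathcal{C}^\circ(g_a^+)$. (iii) If $xy\notin E(G)$ and $\eta(G_1,G_2)=0$, then $G_1\in\mathcal{C}^\circ(g^+)$ if $\epsilon^+(G_2)=0$, and $G_1\in\mathcal{C}^\circ(g_a^+)\cup\mathcal{H}^1$ otherwise. (iv) If $xy\notin E(G)$ and $\eta(G_1,G_2)=1$, then $G_1\in\mathcal{C}^\circ(g)\cup\mathcal{C}^\circ(g^+)$ if $\epsilon^+(G_2)=0$, and $G_1\in\mathcal{C}^\circ(g)\cup\mathcal{C}^\circ(g_a)\cup\mathcal{C}^\circ(g_a^+)\cup\mathcal{D}$ otherwise. (v) If $xy\notin E(G)$ and $\eta(G_1,G_2)=2$, then $G_1\in\mathcal{C}^\circ(g)$ if $\epsilon^+(G_2)=0$, and $G_1\in\mathcal{C}^\circ(g)\cup\mathcal{H}^0$ otherwise.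
   Context: Graphs are finite and simple. $g(G)$ is the orientable genus of $G$ (minimum genus of an orientable embedding, i.e. of a rotation system, computed by Euler's formula); for disconnected graphs an embedding is an embedding of each component and genera of components are added. $\mathcal{G}_{xy}$ is the class of graphs with two distinct distinguished vertices $x,y$ (terminals), and $\mathcal{G}^\circ_{xy}$ is the subclass of those graphs in which $xy$ is not an edge. $G^+$ is $G$ with the edge $xy$ added if absent. An embedding of $G\in\mathcal{G}_{xy}$ is $xy$-alternating if some facial walk contains $(x,y,x,y)$ as a cyclic subsequence. $\epsilon(G)=1$ if $G$ has a minimum genus embedding that is $xy$-alternating, and $\epsilon(G)=0$ otherwise. Parameters: $g^+(G)=g(G^+)$, $\epsilon^+(G)=\epsilon(G^+)$, $\theta(G)=g^+(G)-g(G)\in\{0,1\}$, $g_a(G)=g(G)-\epsilon(G)$ (alternating genus), $g_a^+(G)=g_a(G^+)=g^+(G)-\epsilon^+(G)$. For $G\in\mathcal{G}_{xy}$, the set $\mathcal{M}(G)$ of minor-operations consists of the deletions $(e,-)$ of edges $e\in E(G)$ and the contractions $(e,/)$ of edges $e\in E(G)$, $e\neq xy$; when contracting an edge incident with a terminal the new vertex becomes that terminal, and multiple edges are replaced by single edges. $\mu G$ is the result of applying $\mu$ to $G$. For a parameter $\mathcal{P}$, $\Delta_k(\mathcal{P})=\{\mu\in\mathcal{M}(G):\mathcal{P}(\mu G)\le\mathcal{P}(G)-k\}$. $\mathcal{C}^\circ(\mathcal{P})$ is the class of $G\in\mathcal{G}^\circ_{xy}$ with $\mathcal{M}(G)=\Delta_1(\mathcal{P})$.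 $\mathcal{H}^1$ (hoppers of level 1) is the class of $G\in\mathcal{G}^\circ_{xy}$ with $\mathcal{M}(G)=\Delta_1(g_a^+)\cup\Delta_2(g)$ and $G\notin\mathcal{C}^\circ(g_a^+)$. $\mathcal{H}^0$ (hoppers of level 0) is the class of $G\in\mathcal{G}^\circ_{xy}$ with $\mathcal{M}(G)=\Delta_1(g)\cup\Delta_2(g_a^+)$ and $G\notin\mathcal{C}^\circ(g)$. A dumbbell with bar $b$ is a graph $H\in\mathcal{G}^\circ_{xy}$ with a cut-edge $b$ whose deletion separates $x$ from $y$. $\mathcal{D}$ is the class of dumbbells $H$ with bar $b$ such that $\theta(H)=0$, $\mu\in\Delta_1(g)$ for each $\mu\in\mathcal{M}(H)\setminus\{(b,-),(b,/)\}$, and $\epsilon^+(H/b)=1$. Given $G_1,G_2\in\mathcal{G}^\circ_{xy}$ with $V(G_1)\cap V(G_2)=\{x,y\}$, each of the graphs $(V(G_1)\cup V(G_2),E(G_1)\cup E(G_2))$ and this graph plus the edge $xy$ is an $xy$-sum of $G_1$ and $G_2$ (with parts $G_1,G_2$). $\eta(G_1,G_2)=\theta(G_1)+\theta(G_2)-\epsilon^+(G_1)\epsilon^+(G_2)$. A subgraph $H$ of $G$ is minor-tight in $G$ if $g(G-e)<g(G)$ and $g(G/e)<g(G)$ for every $e\in E(H)$. *)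

(* Defs.v *)
From mathcomp Require Import all_boot all_order all_algebra all_fingroup.
Set Implicit Arguments.
Unset Strict Implicit.
Unset Printing Implicit Defensive.

(* A finite simple graph is carried by a set of vertices of an ambient finite
   type, so that contractions stay in the same type and two graphs can overlap
   in prescribed vertices.  Edges are 2-element sets of vertices. *)
Record graph (T : finType) := Graph {
  verts : {set T};
  edges : {set {set T}};
  _ : [forall e in edges, (e \subset verts) && (#|e| == 2)]
}.

Lemma mkgraph_proof (T : finType) (V : {set T}) (E : {set {set T}}) :
  [forall e in [set e in E | (e \subset V) && (#|e| == 2)],
     (e \subset V) && (#|e| == 2)].
Proof. by apply/forall_inP => e; rewrite inE => /andP[]. Qed.

(* Members of E that are not 2-element subsets of V are dropped. *)
Definition mkgraph (T : finType) (V : {set T}) (E : {set {set T}}) : graph T :=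
  Graph (mkgraph_proof V E).

Definition adj (T : finType) (G : graph T) : rel T :=
  fun u v => [set u; v] \in edges G.

Definition components (T : finType) (G : graph T) : {set {set T}} :=
  [set [set v in verts G | connect (adj G) u v] | u in verts G].

Definition connected_graph (T : finType) (G : graph T) : bool :=
  #|components G| == 1.

(* The dart (u, v) is the edge uv directed from u to v. *)
Definition darts (T : finType) (G : graph T) : {set T * T} :=
  [set d | adj G d.1 d.2].

(* s permutes cyclically the darts leaving each vertex (and, so that rotation
   systems are counted once, fixes all pairs that are not darts). *)
Definition rotation (T : finType) (G : graph T) (s : {perm T * T}) : bool :=
  [&& perm_on (darts G) s,
      [forall d in darts G, (s d).1 == d.1] &
      [forall d in darts G, forall d' in darts G,
         (d.1 == d'.1) ==> (d' \in porbit s d)]].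

Definition rev_dart (T : finType) (d : T * T) : T * T := (d.2, d.1).

Lemma rev_dart_inj (T : finType) : injective (@rev_dart T).
Proof. by move=> [a b] [c d] [-> ->]. Qed.

(* Face tracing: the walk arriving at v along (u, v) leaves along the
   s-successor of (v, u). *)
Definition face_perm (T : finType) (s : {perm T * T}) : {perm T * T} :=
  (perm (@rev_dart_inj T) * s)%g.

Definition facial_walk (T : finType) (s : {perm T * T}) (d : T * T) : seq T :=
  [seq d'.1 | d' <- traject (face_perm s) d #|porbit (face_perm s) d|].

Definition comp_edges (T : finType) (G : graph T) (C : {set T}) :
  {set {set T}} := [set e in edges G | e \subset C].

(* An isolated vertex has no dart, but its embedding in the sphere has one
   face. *)
Definition comp_faces (T : finType) (G : graph T) (s : {perm T * T})
    (C : {set T}) : nat :=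
  if comp_edges G C == set0 then 1
  else #|[set porbit (face_perm s) d | d in darts G & d.1 \in C]|.

(* |V| - |E| + |F| = 2 - 2g in each component; for a rotation system the
   subtraction does not truncate and the halving is exact. *)
Definition embedding_genus (T : finType) (G : graph T) (s : {perm T * T}) :
  nat :=
  \sum_(C in components G)
    (2 + #|comp_edges G C| - (#|C| + comp_faces G s C))./2.

Definition nbrs (T : finType) (G : graph T) (u : T) : seq T :=
  enum [pred v | adj G u v].

Definition next_dart (T : finType) (G : graph T) (d : T * T) : T * T :=
  (d.1, next (nbrs G d.1) d.2).

Lemma next_dart_inj (T : finType) (G : graph T) : injective (next_dart G).
Proof.
move=> [a b] [c d] [<-] /(congr1 (prev (nbrs G a))).
by rewrite !prev_next ?enum_uniq // => ->.
Qed.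

Lemma rotation_exists (T : finType) (G : graph T) :
  exists s : {perm T * T}, rotation G s.
Proof.
have memN u v : (v \in nbrs G u) = adj G u v by rewrite mem_enum.
exists (perm (@next_dart_inj T G)); apply/and3P; split.
- apply/subsetP => -[u v]; rewrite inE permE /next_dart /= => neq.
  rewrite inE /= -memN; apply: contraNT neq => vN.
  by rewrite next_nth (negPf vN).
- by apply/forall_inP => d _; rewrite permE.
apply/forall_inP => -[u v] dv; apply/forall_inP => -[u' w] dw /=.
apply/implyP => /eqP eu; move: dv dw; rewrite -{}eu !inE /= -!memN => vN wN.
have := fconnect_cycle (cycle_next (enum_uniq _ : uniq (nbrs G u))) vN w.
rewrite wN => /iter_findex <-; set k := findex _ _ _.
apply/porbitP; exists k; rewrite permX; elim: k => //= k <-.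
by rewrite permE.
Qed.

Lemma embedding_genus_exists (T : finType) (G : graph T) :
  exists n, [exists s, rotation G s && (embedding_genus G s == n)].
Proof.
have [s rs] := rotation_exists G; exists (embedding_genus G s).
by apply/existsP; exists s; rewrite rs eqxx.
Qed.

Definition genus (T : finType) (G : graph T) : nat :=
  ex_minn (embedding_genus_exists G).

(* The starting dart is arbitrary, so this is a cyclic subsequence. *)
Definition alternating (T : finType) (x y : T) (G : graph T)
    (s : {perm T * T}) : bool :=
  [exists d in darts G, subseq [:: x; y; x; y] (facial_walk s d)].

Definition alternating_min (T : finType) (x y : T) (G : graph T) : bool :=
  [exists s, [&& rotation G s, embedding_genus G s == genus G &
                 alternating x y G s]].

Definition in_Gxy (T : finType) (x y : T) (G : graph T) : bool :=
  [&& x != y, x \in verts G & y \in verts G].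

Definition in_Gxyo (T : finType) (x y : T) (G : graph T) : bool :=
  in_Gxy x y G && ([set x; y] \notin edges G).

Definition add_xy (T : finType) (x y : T) (G : graph T) : graph T :=
  mkgraph (verts G) ([set x; y] |: edges G).

Definition delete (T : finType) (e : {set T}) (G : graph T) : graph T :=
  mkgraph (verts G) (edges G :\ e).

(* The vertex produced by contracting e is named by a terminal in e, if any,
   and otherwise by some end of e. *)
Definition contract_vertex (T : finType) (x y : T) (e : {set T}) : T :=
  if x \in e then x else if y \in e then y else odflt x [pick z in e].

Definition contract_map (T : finType) (x y : T) (e : {set T}) (z : T) : T :=
  if z \in e then contract_vertex x y e else z.

Definition contract (T : finType) (x y : T) (e : {set T}) (G : graph T) :
  graph T :=
  mkgraph (contract_map x y e @: verts G)
          [set contract_map x y e @: f | f : {set T} in edges G].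

(* The operation (e, false) is the deletion of e, (e, true) its contraction. *)
Definition minor_op (T : finType) : finType := ({set T} * bool)%type.
Definition del_op (T : finType) (e : {set T}) : minor_op T := (e, false).
Definition con_op (T : finType) (e : {set T}) : minor_op T := (e, true).

Definition apply_op (T : finType) (x y : T) (mu : minor_op T) (G : graph T) :
  graph T :=
  if mu.2 then contract x y mu.1 G else delete mu.1 G.

Definition minor_ops (T : finType) (x y : T) (G : graph T) :
  {set minor_op T} :=
  [set mu : minor_op T | (mu.1 \in edges G) &&
                         (mu.2 ==> (mu.1 != [set x; y]))].

Import Order.TTheory GRing.Theory Num.Theory.
Local Open Scope ring_scope.

Definition parameter (T : finType) := T -> T -> graph T -> int.

Definition g (T : finType) : parameter T := fun x y G => (genus G)%:Z.
Definition eps (T : finType) : parameter T :=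
  fun x y G => (alternating_min x y G : nat)%:Z.
Definition g_plus (T : finType) : parameter T :=
  fun x y G => g x y (add_xy x y G).
Definition eps_plus (T : finType) : parameter T :=
  fun x y G => eps x y (add_xy x y G).
Definition theta (T : finType) : parameter T :=
  fun x y G => g_plus x y G - g x y G.
Definition g_a (T : finType) : parameter T :=
  fun x y G => g x y G - eps x y G.
Definition g_a_plus (T : finType) : parameter T :=
  fun x y G => g_a x y (add_xy x y G).

Definition Delta (T : finType) (k : nat) (P : parameter T) (x y : T)
    (G : graph T) : {set minor_op T} :=
  [set mu in minor_ops x y G | P x y (apply_op x y mu G) <= P x y G - k%:Z].

Definition Co (T : finType) (P : parameter T) (x y : T) (G : graph T) : bool :=
  in_Gxyo x y G && (minor_ops x y G == Delta 1 P x y G).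

Definition hopper1 (T : finType) (x y : T) (G : graph T) : bool :=
  [&& in_Gxyo x y G,
      minor_ops x y G == Delta 1 (@g_a_plus T) x y G
                           :|: Delta 2 (@g T) x y G
    & ~~ Co (@g_a_plus T) x y G].

Definition hopper0 (T : finType) (x y : T) (G : graph T) : bool :=
  [&& in_Gxyo x y G,
      minor_ops x y G == Delta 1 (@g T) x y G
                           :|: Delta 2 (@g_a_plus T) x y G
    & ~~ Co (@g T) x y G].

Definition cut_edge (T : finType) (b : {set T}) (H : graph T) : bool :=
  (b \in edges H) && (#|components H| < #|components (delete b H)|)%N.

Definition dumbbell (T : finType) (x y : T) (b : {set T}) (H : graph T) :
  bool :=
  [&& in_Gxyo x y H, cut_edge b H,
      connect (adj H) x y & ~~ connect (adj (delete b H)) x y].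

Definition classD (T : finType) (x y : T) (H : graph T) : bool :=
  [exists b : {set T},
     [&& dumbbell x y b H,
         theta x y H == 0,
         minor_ops x y H :\: [set del_op b; con_op b]
           \subset Delta 1 (@g T) x y H
       & eps_plus x y (contract x y b H) == 1]].

Definition xy_sum (T : finType) (x y : T) (G G1 G2 : graph T) : Prop :=
  [/\ in_Gxyo x y G1, in_Gxyo x y G2,
      verts G1 :&: verts G2 = [set x; y],
      verts G = verts G1 :|: verts G2
    & edges G = edges G1 :|: edges G2 \/
      edges G = [set x; y] |: (edges G1 :|: edges G2)].

Definition eta (T : finType) (x y : T) (G1 G2 : graph T) : int :=
  theta x y G1 + theta x y G2 - eps_plus x y G1 * eps_plus x y G2.

Definition minor_tight (T : finType) (x y : T) (H G : graph T) : Prop :=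
  forall e : {set T}, e \in edges H ->
    (genus (delete e G) < genus G)%N /\ (genus (contract x y e G) < genus G)%N.

(* Main.v *)
Require Import Defs.
From mathcomp Require Import all_boot all_order all_algebra all_fingroup zify.

Set Implicit Arguments.
Unset Strict Implicit.
Unset Printing Implicit Defensive.

(* Add a fixed half-edge for every non-edge of a graph on T: all rotation
   systems then live on the darts T * T, and by Euler's formula the genus is
   governed by the maximal number of orbits of alpha * s, where alpha reverses
   the edges and s is a cyclic permutation on each fibre of darts.  For a sum at
   x and y, choosing s away from the terminals leaves two permutations psi1 and
   psi2 with disjoint supports, and one maximises the number of orbits of
   psi1 * psi2 * c over the rotations c at x and y.  Removing points one by one
   reduces psi to a permutation exchanging the darts at x with darts at y, for
   which the maximum is determined by absorbing 3-cycles into c; its defect from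
   the obvious upper bound is exactly the alternating property.  This yields
   g+(G) = g+(G1) + g+(G2) - eps+(G1) eps+(G2) and
   g(G) = min(g(G1) + g(G2) + 1, g+(G)) when both parts connect x to y.

   Tightness thus compares (g, g+, eps+) of mu G1 with that of G1.  The only
   operation that disconnects x from y is the deletion of a bridge b; then g and
   g+ are unchanged by the contraction of b, and eps vanishes as long as b is
   present, which singles out the dumbbells when eta = 1 and excludes bridges
   when eta = 2. *)

(** The defect is a parity. Once psi exchanges darts at x with darts at y, let [half psi] be the
    darts at x that it moves. If psi is not 1, every cycle of psi * c at the terminals meets
    [half psi], which bounds their number. The parity of the number of cycles does not depend on c,
    and some c comes within one of the bound. So a parity ([altpar]) decides whether the bound is
    attained, and parities of disjoint factors add: two defects cancel, and the two faces gained are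
    the handle saved by eps+(G1) eps+(G2).

    The exception is psi = 1, where [half psi] is empty although the rotations at x and at y still
    form two cycles. This is the unlinked case, and it is the source of all corrections by two.

    The edge xy is treated as one more disjoint factor, the transposition of its two darts, so that
    the same formula covers a part, a part with xy, and the sum with or without xy. A single part is
    in turn the sum with an empty second part. *)

Local Open Scope group_scope.

(** * Cycles of permutations *)

Section Cycles.
Variable D : finType.
Implicit Types (s t : {perm D}) (p q a b : D) (A : {set D}).

Definition cyc s := #|porbits s|.
Definition coorb s p q := q \in porbit s p.

Lemma coorb_refl s p : coorb s p p. Proof. exact: porbit_id. Qed.
Lemma coorbE s p q : coorb s p q = (porbit s p == porbit s q).
Proof. by rewrite /coorb -eq_porbit_mem eq_sym. Qed.
Lemma coorb_sym s p q : coorb s p q = coorb s q p.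
Proof. by rewrite !coorbE eq_sym. Qed.
Lemma coorb_trans s : transitive (coorb s).
Proof. by move=> q p r; rewrite !coorbE => /eqP->. Qed.
Lemma coorb_step s p : coorb s p (s p).
Proof. by have := mem_porbit s 1 p; rewrite expg1. Qed.
Lemma coorb_stepr s p q : coorb s p (s q) = coorb s p q.
Proof.
apply/idP/idP => h; apply: coorb_trans h _; last exact: coorb_step.
by rewrite coorb_sym coorb_step.
Qed.
Lemma coorb_stepl s p q : coorb s (s p) q = coorb s p q.
Proof. by rewrite coorb_sym coorb_stepr coorb_sym. Qed.
Lemma coorb_fix s p q : s p = p -> coorb s p q = (p == q).
Proof.
move=> sp; apply/porbitP/eqP => [[i ->]|->]; first by rewrite permX_fix.
by exists 0; rewrite expg0 perm1.
Qed.
Lemma coorb_ind s (P : D -> Prop) p q :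
  coorb s p q -> P p -> (forall r, P r -> P (s r)) -> P q.
Proof.
by move=> /porbitP[i ->] Pp step; rewrite permX; elim: i => //= i /step.
Qed.

Lemma cycV s : cyc s^-1 = cyc s.
Proof. by rewrite /cyc porbitsV. Qed.

Lemma cyc_tpermM s p q :
  cyc (tperm p q * s) + (~~ coorb s p q).*2 = cyc s + (p != q).
Proof. by rewrite coorb_sym; exact: porbits_mul_tperm. Qed.

Lemma cyc_Mtperm s p q :
  cyc (s * tperm p q) + (~~ coorb s p q).*2 = cyc s + (p != q).
Proof.
rewrite -cycV invMg tpermV -(cycV s) -cyc_tpermM.
by rewrite /coorb porbitV.
Qed.

Lemma cyc_split s p q : p != q -> coorb s p q ->
  cyc (s * tperm p q) = (cyc s).+1.
Proof. by move=> npq spq; have := cyc_Mtperm s p q; rewrite npq spq /=; lia. Qed.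

Lemma cyc_merge s p q : ~~ coorb s p q -> cyc s = (cyc (s * tperm p q)).+1.
Proof.
move=> npq; have := cyc_Mtperm s p q; rewrite npq /=.
have -> : p != q by apply: contraNN npq => /eqP->; apply: coorb_refl.
by lia.
Qed.

Lemma cyc_Mtperm_ge s p q : cyc s <= (cyc (s * tperm p q)).+1.
Proof.
have := cyc_Mtperm s p q; case: (p =P q) => [->|_]; rewrite ?coorb_refl /=.
  by lia.
by case: (coorb _ _ _) => /=; lia.
Qed.

Lemma mulg_tpermK s p q : s * tperm p q * tperm p q = s.
Proof. by rewrite -mulgA tperm2 mulg1. Qed.

Lemma cyc_Mtperm_le s p q : cyc (s * tperm p q) <= (cyc s).+1.
Proof. by rewrite -{2}(mulg_tpermK s p q) cyc_Mtperm_ge. Qed.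

Lemma coorb_split s p q : p != q -> coorb s p q -> ~~ coorb (s * tperm p q) p q.
Proof.
move=> npq spq; have := cyc_Mtperm (s * tperm p q) p q.
by rewrite mulg_tpermK cyc_split // npq; case: (coorb _ _ _) => /=; lia.
Qed.

Lemma coorb_merged s p q : coorb s p q || coorb (s * tperm p q) p q.
Proof.
case spq: (coorb s p q) => //=; have := cyc_Mtperm (s * tperm p q) p q.
rewrite mulg_tpermK (cyc_merge (negbT spq)); case: (coorb _ _ _) => //=.
by case: (p != q) => /=; lia.
Qed.

Lemma coorb_Mtperm_sub s p q a b : coorb (s * tperm p q) a b ->
  [|| coorb s a b, coorb s a p && coorb s q b | coorb s a q && coorb s p b].
Proof.
move=> h; pattern b; apply: (coorb_ind h); first by rewrite coorb_refl.
move=> r IH; rewrite permM.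
have: [|| coorb s a (s r), coorb s a p && coorb s q (s r)
       | coorb s a q && coorb s p (s r)] by rewrite !coorb_stepr.
case: tpermP => [->|->|//].
  case/or3P => [->|/andP[-> _]|/andP[-> _]]; rewrite ?coorb_refl ?orbT //.
case/or3P => [->|/andP[-> _]|/andP[-> _]]; rewrite ?coorb_refl ?orbT //.
Qed.

Lemma coorb_merge s p q a b : ~~ coorb s p q ->
  coorb (s * tperm p q) a b =
  [|| coorb s a b, coorb s a p && coorb s q b | coorb s a q && coorb s p b].
Proof.
move=> npq; apply/idP/idP; first exact: coorb_Mtperm_sub.
have := coorb_merged s p q; rewrite (negPf npq) /= => pq.
have sub c d : coorb s c d -> coorb (s * tperm p q) c d.
  rewrite -{1}(mulg_tpermK s p q) => /coorb_Mtperm_sub.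
  case/or3P => // /andP[h1 h2]; apply: coorb_trans h1 _.
    exact: coorb_trans pq h2.
  by move: pq; rewrite coorb_sym => pq; apply: coorb_trans pq h2.
case/or3P => [/sub//|/andP[/sub h1 /sub h2]|/andP[/sub h1 /sub h2]].
  exact: coorb_trans h1 (coorb_trans pq h2).
by apply: coorb_trans h1 _; apply: coorb_trans h2; rewrite coorb_sym.
Qed.

Lemma coorb_merge_sub s p q a b : ~~ coorb s p q -> coorb s a b ->
  coorb (s * tperm p q) a b.
Proof. by move=> npq sab; rewrite coorb_merge // sab. Qed.

(* Removes p from its cycle. *)
Definition bypass s p := s * tperm p (s p).

Lemma bypass_fix s p : bypass s p p = p.
Proof. by rewrite permM tpermR. Qed.

Lemma bypassK s p : bypass s p * tperm p (s p) = s.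
Proof. exact: mulg_tpermK. Qed.

Lemma bypassE s p a : bypass s p a = if a == p then p else
  if s a == p then s p else s a.
Proof.
rewrite permM; case: eqP => [->|/eqP ap]; first by rewrite tpermR.
case: tpermP => [->|/perm_inj/eqP|]; rewrite ?eqxx ?(negPf ap) //.
by move/eqP/negPf->.
Qed.

Lemma cyc_bypass s p : cyc (bypass s p) = cyc s + (s p != p).
Proof.
rewrite /bypass; case: (s p =P p) => [->|/eqP sp].
  by rewrite tperm1 mulg1 addn0.
by rewrite addn1 cyc_split ?coorb_step // eq_sym.
Qed.

Lemma coorb_bypass s p a b : a != p -> b != p ->
  coorb (bypass s p) a b = coorb s a b.
Proof.
move=> ap bp; case: (s p =P p) => [sp|/eqP sp].
  by rewrite /bypass sp tperm1 mulg1.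
have fx := bypass_fix s p.
have np : ~~ coorb (bypass s p) p (s p) by rewrite coorb_fix // eq_sym.
rewrite -{2}(bypassK s p) coorb_merge //.
rewrite (coorb_sym _ a p) !(coorb_fix _ fx).
by rewrite eq_sym (negPf ap) (eq_sym p) (negPf bp) /= andbF !orbF.
Qed.

(** Transfers orbits between permutations that agree only locally: an orbit of [s] starting in [P]
    never leaves [P], so [t] follows it. *)
Lemma coorb_agree s t (P : pred D) a b :
  (forall c, P c -> P (s c)) -> {in P, s =1 t} -> P a ->
  coorb s a b -> P b && coorb t a b.
Proof.
move=> stab st Pa h; pattern b; apply: (coorb_ind h); first by rewrite Pa coorb_refl.
move=> r /andP[Pr tr]; rewrite stab //=.
by rewrite (st r Pr) coorb_stepr.
Qed.

Lemma cycC s t : cyc (s * t) = cyc (t * s).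
Proof.
have -> : t * s = (s * t) ^ s by rewrite conjgE -!mulgA mulKg.
have inj : injective (fun S : {set D} => s @: S).
  exact/imset_inj/perm_inj.
rewrite /cyc -(card_imset _ inj); apply: eq_card => O.
have imJ u a : s @: porbit u a = porbit (u ^ s) (s a).
  apply/setP=> b; apply/imsetP/porbitP => [[c /porbitP[i ->] ->]|[i ->]].
    by exists i; rewrite -conjXg permJ.
  by exists ((u ^+ i) a); rewrite ?mem_porbit // -conjXg permJ.
apply/imsetP/imsetP => [[S /imsetP[a _ ->] ->]|[a _ ->]].
  by exists (s a); rewrite ?imJ.
exists (porbit (s * t) (s^-1 a)); first exact: imset_f.
by rewrite imJ permKV.
Qed.

Lemma cycJ s t : cyc (s ^ t) = cyc s.
Proof. by rewrite conjgE cycC -mulgA mulgV mulg1. Qed.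

Lemma odd_cyc s : odd (cyc s) = odd #|D| (+) odd_perm s.
Proof. by rewrite /odd_perm addbA addbb. Qed.

Lemma cyc1 : cyc (1 : {perm D}) = #|D|.
Proof.
rewrite /cyc /porbits card_imset // => a b /eqP.
by rewrite -coorbE coorb_fix ?perm1 // => /eqP.
Qed.

(** Points outside [A] are fixed, and each remaining cycle has a representative in [B]. *)
Lemma cyc_le_on s A (B : {set D}) : perm_on A s ->
  (forall p, p \in A -> exists2 q, q \in B & coorb s p q) ->
  cyc s + #|A| <= #|D| + #|B|.
Proof.
move=> sA AB; have : porbits s \subset (porbit s @: B) :|: (porbit s @: ~: A).
  apply/subsetP=> O /imsetP[p _ ->]; rewrite inE.
  case: (boolP (p \in A)) => [/AB[q qB]|pA].
    by rewrite coorbE => /eqP->; rewrite imset_f.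
  by apply/orP; right; apply: imset_f; rewrite inE.
move/subset_leq_card => /leq_trans/(_ (leq_card_setU _ _)).
have := leq_imset_card (porbit s) B.
have := leq_imset_card (porbit s) (~: A).
have := cardsC A; rewrite /cyc; lia.
Qed.

Lemma cyc_ge_off s A p : perm_on A s -> p \in A -> #|D| < cyc s + #|A|.
Proof.
move=> sA pA; have : porbit s p |: (porbit s @: ~: A) \subset porbits s.
  apply/subsetP=> O; rewrite !inE => /orP[/eqP->|/imsetP[q _ ->]];
  exact: imset_f.
move/subset_leq_card; rewrite cardsU1 card_in_imset; last first.
  move=> a b; rewrite !inE => aA bA /eqP; rewrite -coorbE coorb_fix.
    by move/eqP.
  exact: out_perm sA aA.
have -> : porbit s p \notin porbit s @: ~: A.
  apply/imsetP=> -[q]; rewrite inE => qA /eqP; rewrite -coorbE coorb_sym.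
  rewrite coorb_fix; last exact: out_perm sA qA.
  by move=> /eqP qp; rewrite qp pA in qA.
have := cardsC A; rewrite /cyc; lia.
Qed.

Definition support s := [set p | s p != p].

Lemma support_on s : perm_on (support s) s.
Proof. by apply/subsetP=> p; rewrite !inE. Qed.

Lemma disjoint_commute s t : [disjoint support s & support t] -> s * t = t * s.
Proof.
exact: (perm_onC (support_on s) (support_on t)).
Qed.

Lemma supportP s p : reflect (s p = p) (p \notin support s).
Proof. by rewrite inE negbK; exact: eqP. Qed.

Lemma support_stable s p : (s p \in support s) = (p \in support s).
Proof. by rewrite !inE (inj_eq perm_inj). Qed.

Lemma support_disjoint s t p : [disjoint support s & support t] ->
  p \in support s -> t p = p.
Proof. by move=> st sp; apply/supportP; rewrite (disjointFr st sp). Qed.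

End Cycles.

Section Tperm.
Variable D : finType.
Implicit Types (s : {perm D}) (a b c : D).

Lemma tpermMl s a b : tperm a b * s = s * tperm (s a) (s b).
Proof. by rewrite -tpermJ conjgE mulKVg. Qed.

Lemma tperm_cycle3 a b c : a != c -> b != c ->
  tperm a b * tperm a c = tperm b c * tperm a b.
Proof. by move=> ac bc; rewrite [RHS]tpermMl tpermR tpermD. Qed.
End Tperm.

(** * Alternation under merging of cycles and removal of points *)

Section Alt.
Variables (D : finType) (X Y : {set D}).
Hypothesis disj : [disjoint X & Y].
Implicit Types s : {perm D}.

(* Multiplying by tperm v1 v2 cuts the orbit of v1 and v2 in two arcs; it
   alternates between X and Y if this cut separates two points of Y. *)
Definition alt s := [exists v1 in X, exists v2 in X, exists y1 in Y,
  exists y2 in Y, [&& coorb s v1 v2, coorb s y1 y2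
                    & ~~ coorb (s * tperm v1 v2) y1 y2]].

Lemma altP s : reflect (exists v1 v2 y1 y2,
  [/\ v1 \in X, v2 \in X, y1 \in Y, y2 \in Y &
   [/\ coorb s v1 v2, coorb s y1 y2 & ~~ coorb (s * tperm v1 v2) y1 y2]])
  (alt s).
Proof.
apply: (iffP idP) => [|[v1 [v2 [y1 [y2 [X1 X2 Y1 Y2 [a b c]]]]]]].
  case/exists_inP=> v1 X1 /exists_inP[v2 X2] /exists_inP[y1 Y1].
  by case/exists_inP=> y2 Y2 /and3P[a b c]; exists v1, v2, y1, y2.
apply/exists_inP; exists v1 => //; apply/exists_inP; exists v2 => //.
apply/exists_inP; exists y1 => //; apply/exists_inP; exists y2 => //.
by rewrite a b c.
Qed.

(** The cut [tperm v1 v2] only moves points inside a cycle of [s], so after commuting the two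
    transpositions the second one still joins pieces of two different cycles of [s]. The points [y1]
    and [y2] come from one cycle of [s], hence they stay separated. *)
Lemma alt_merge s p q : ~~ coorb s p q -> alt s -> alt (s * tperm p q).
Proof.
move=> npq /altP[v1 [v2 [y1 [y2 [X1 X2 Y1 Y2 [sv sy ny]]]]]].
apply/altP; exists v1, v2, y1, y2; split=> //.
split; try exact: coorb_merge_sub.
set tv := tperm v1 v2.
have -> : s * tperm p q * tv = s * tv * tperm (tv p) (tv q).
  by rewrite -!mulgA -tpermMl.
have sub a b : coorb (s * tv) a b -> coorb s a b.
  case/coorb_Mtperm_sub/or3P=> // /andP[h1 h2]; apply: coorb_trans h1 _.
    exact: coorb_trans sv h2.
  by apply: coorb_trans h2; rewrite coorb_sym.
have tvE a : coorb s a (tv a).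
  by rewrite /tv; case: tpermP => [->|->|]; rewrite ?coorb_refl // coorb_sym.
rewrite coorb_merge; last first.
  apply: contra npq => /sub h; apply: coorb_trans (tvE p) _.
  by apply: coorb_trans h _; rewrite coorb_sym.
rewrite (negPf ny) /=; apply/norP; split; apply: contra npq.
- case/andP=> /sub h1 /sub h2; apply: coorb_trans (tvE p) _.
  rewrite coorb_sym; apply: coorb_trans (tvE q) _; apply: coorb_trans h2 _.
  by apply: coorb_trans h1; rewrite coorb_sym.
case/andP=> /sub h1 /sub h2; apply: coorb_trans (tvE p) _.
apply: coorb_trans h2 _; rewrite coorb_sym; apply: coorb_trans (tvE q) _.
by rewrite coorb_sym; apply: coorb_trans h1; rewrite coorb_sym.
Qed.

(** Removing such a point does not change the cyclic pattern of X and Y: it is neutral, or it is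
    followed by a point of its own class. *)
Definition removable s p := [|| p \notin X :|: Y,
  (p \in X) && (s p \in X) | (p \in Y) && (s p \in Y)].

(** Restoring [p] merges a fixed point into a cycle, so [alt_merge] gives one direction. For the
    other, a witness equal to [p] is replaced by its successor [s p], which has the same class. *)
Lemma alt_bypass s p : removable s p -> alt (bypass s p) = alt s.
Proof.
case: (s p =P p) => [sp _|/eqP sp rm].
  by rewrite /bypass sp tperm1 mulg1.
apply/idP/idP => [h|].
  rewrite -(bypassK s p); apply: alt_merge h.
  by rewrite coorb_fix ?bypass_fix // eq_sym.
case/altP=> v1 [v2 [y1 [y2 [X1 X2 Y1 Y2 [sv sy ny]]]]].
have XY a : a \in X -> a \in Y -> false by move=> /(disjointFr disj)->.
have neq a b : a \in X -> b \in Y -> a != b.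
  by move=> aX bY; apply: contraTneq aX => ->; rewrite (disjointFl disj).
(* For witnesses different from [p], the cut commutes with the removal of [p]; it remains to find
   such witnesses. *)
wlog {v1 v2 y1 y2 X1 X2 Y1 Y2 sv sy ny}: / exists v1 v2 y1 y2,
    [/\ v1 \in X, v2 \in X, y1 \in Y, y2 \in Y &
    [/\ coorb s v1 v2, coorb s y1 y2 & ~~ coorb (s * tperm v1 v2) y1 y2]] /\
    [/\ v1 != p, v2 != p, y1 != p & y2 != p].
  apply; case/or3P: rm => [pXY|/andP[pX nX]|/andP[pY nY]].
  - exists v1, v2, y1, y2; split=> //.
    by move: pXY; rewrite inE => /norP[pX pY]; split;
      [move: X1|move: X2|move: Y1|move: Y2]; apply: contraTneq => ->.
  (* Cutting at [s p] instead of [p] only changes the side on which [p] lies: once [p] is removed,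
     the two cut permutations coincide. *)
  - have sn a b : a \in X -> b \in X -> coorb s a b ->
        ~~ coorb (s * tperm a b) y1 y2 -> a = p -> b != p /\
        ~~ coorb (s * tperm (s p) b) y1 y2.
      move=> _ bX ab nab ap; rewrite {a}ap in ab nab.
      case: (b =P p) nab => [->|/eqP bp nab].
        by rewrite tperm1 mulg1 sy.
      split=> //.
      case: (b =P s p) (nab) => [->|/eqP bn _].
        by rewrite tperm1 mulg1 -/(bypass s p) coorb_bypass ?sy // eq_sym neq.
      rewrite -(@coorb_bypass _ _ p) 1?eq_sym ?neq //.
      suff -> : bypass (s * tperm (s p) b) p = bypass (s * tperm p b) p.
        by rewrite coorb_bypass 1?eq_sym ?neq.
      rewrite /bypass !permM tpermL tpermD 1?eq_sym //; last by rewrite eq_sym.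
      rewrite -!mulgA; congr (_ * _).
      by rewrite (tperm_cycle3 _ bn) 1?eq_sym // (tpermC b).
    case: (v1 =P p) => [e|/eqP v1p].
      have [v2p nn] := sn _ _ X1 X2 sv ny e.
      exists (s p), v2, y1, y2; split; split=> //; rewrite ?(eq_sym _ p) ?neq //.
      by split=> //; rewrite coorb_stepl -e.
    case: (v2 =P p) => [e|/eqP v2p].
      have sv' : coorb s v2 v1 by rewrite coorb_sym.
      have ny' : ~~ coorb (s * tperm v2 v1) y1 y2 by rewrite tpermC.
      have [_ nn] := sn _ _ X2 X1 sv' ny' e.
      exists (s p), v1, y1, y2.
      split; split=> //; rewrite ?(eq_sym _ p) ?neq //.
      by split=> //; rewrite coorb_stepl -e coorb_sym.
    by exists v1, v2, y1, y2; split=> //; split=> //; rewrite eq_sym neq.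
  pose f a := if a == p then s p else a.
  have fp a : f a != p by rewrite /f; case: ifP => // /negbT.
  have fY a : a \in Y -> f a \in Y by rewrite /f; case: ifP.
  have fs a : coorb s a (f a).
    by rewrite /f; case: eqP => [->|]; rewrite ?coorb_step ?coorb_refl.
  have fsv a : coorb (s * tperm v1 v2) a (f a).
    rewrite /f; case: eqP => [->|]; rewrite ?coorb_refl //.
    have := coorb_step (s * tperm v1 v2) p.
    by rewrite permM tpermD ?neq.
  exists v1, v2, (f y1), (f y2); split; split=> //; rewrite ?neq ?fY //.
  split=> //.
    apply: (@coorb_trans _ _ y1); first by rewrite coorb_sym.
    exact: coorb_trans (fs y2).
  apply: contra ny => h; apply: coorb_trans (fsv y1) _.
  by apply: coorb_trans h _; rewrite coorb_sym.
case=> v1 [v2 [y1 [y2 [[X1 X2 Y1 Y2 [sv sy ny]] [v1p v2p y1p y2p]]]]].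
apply/altP; exists v1, v2, y1, y2; split=> //.
rewrite !coorb_bypass //; split=> //.
suff -> : bypass s p * tperm v1 v2 = bypass (s * tperm v1 v2) p.
  by rewrite coorb_bypass.
by rewrite /bypass permM -!mulgA; congr (_ * _); rewrite tpermMl tpermD.
Qed.

End Alt.

(** * Permutations that are cyclic on every colour class *)

Section Rotn.
Variables (D : finType) (C : eqType) (col : D -> C).
Implicit Types (A : {set D}) (s c : {perm D}).

Definition kperm A s := perm_on A s && [forall p, col (s p) == col p].
Definition rotn A s := kperm A s &&
  [forall p in A, forall q in A, (col p == col q) ==> coorb s p q].

Lemma kperm_col A s p : kperm A s -> col (s p) = col p.
Proof. by case/andP=> _ /forallP/(_ p)/eqP. Qed.
Lemma kperm_on A s : kperm A s -> perm_on A s.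
Proof. by case/andP. Qed.
Lemma kperm1 A : kperm A 1.
Proof. by rewrite /kperm perm_on1; apply/forallP=> p; rewrite perm1. Qed.
Lemma kpermM A s t : kperm A s -> kperm A t -> kperm A (s * t).
Proof.
move=> sA tA; rewrite /kperm perm_onM ?(kperm_on sA) ?(kperm_on tA) //=.
by apply/forallP=> p; rewrite permM (kperm_col _ tA) (kperm_col _ sA).
Qed.
Lemma kpermV A s : kperm A s -> kperm A s^-1.
Proof.
move=> sA; rewrite /kperm perm_onV ?(kperm_on sA) //=.
by apply/forallP=> p; rewrite -(kperm_col _ sA) permKV.
Qed.
Lemma kperm_tperm A p q : p \in A -> q \in A -> col p = col q ->
  kperm A (tperm p q).
Proof.
move=> pA qA cpq; apply/andP; split.
  apply/subsetP=> r; rewrite inE; apply: contraNT => rA.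
  by rewrite tpermD //; apply: contraNneq rA => <-.
by apply/forallP=> r; case: tpermP => [->|->|] //; rewrite cpq.
Qed.
Lemma rotn_kperm A s : rotn A s -> kperm A s.
Proof. by case/andP. Qed.
Lemma rotn_coorb A s p q : rotn A s -> p \in A -> q \in A -> col p = col q ->
  coorb s p q.
Proof.
by case/andP=> _ /forall_inP h pA qA /eqP; apply/implyP/(forall_inP (h p pA)).
Qed.
Lemma rotnP A s : kperm A s ->
  (forall p q, p \in A -> q \in A -> col p = col q -> coorb s p q) -> rotn A s.
Proof.
move=> sA h; rewrite /rotn sA; apply/forall_inP=> p pA; apply/forall_inP=> q qA.
by apply/implyP=> /eqP; apply: h.
Qed.

Lemma kperm_coorb_col A s p q : kperm A s -> coorb s p q -> col p = col q.
Proof.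
move=> sA h; pattern q; apply: (coorb_ind h) => // r ->.
by rewrite (kperm_col _ sA).
Qed.

(** A colour-preserving permutation with the fewest cycles works: two cycles of the same colour
    could be merged by a transposition. *)
Lemma rotn_exists A : exists s, rotn A s.
Proof.
case: (@arg_minnP _ 1 (kperm A) (@cyc D) (kperm1 A)) => s sA smin.
exists s; apply: rotnP => // p q pA qA cpq; apply: contraT => npq.
have := smin _ (kpermM sA (kperm_tperm pA qA cpq)).
by rewrite (cyc_merge npq) ltnn.
Qed.

Lemma rotn_coorbE A s a b : rotn A s ->
  coorb s a b = (a == b) || [&& a \in A, b \in A & col a == col b].
Proof.
move=> sA; have kA := rotn_kperm sA; have oA := kperm_on kA.
case: (boolP (a \in A)) => [aA|naA]; last first.
  by rewrite coorb_fix ?(out_perm oA) //= orbF.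
apply/idP/idP => [h|/orP[/eqP->|/and3P[_ bA /eqP cab]]].
- rewrite (kperm_coorb_col kA h) eqxx andbT /=; apply/orP; right.
  by pattern b; apply: (coorb_ind h) => // r; rewrite (perm_closed _ oA).
- exact: coorb_refl.
exact: rotn_coorb sA aA bA cab.
Qed.

Lemma rotn_cyc A s c : rotn A c -> rotn A s -> cyc s = cyc c.
Proof.
move=> cA sA; rewrite /cyc /porbits; congr #|pred_of_set _|; apply: eq_imset.
move=> a; apply/setP=> b; have := rotn_coorbE a b cA.
by rewrite -(rotn_coorbE a b sA).
Qed.

Lemma kperm_cyc_ge A s c : rotn A c -> kperm A s -> cyc c <= cyc s.
Proof.
move=> cA sA; case: (@arg_minnP _ s (kperm A) (@cyc D) sA) => r rA rmin.
apply: leq_trans (rmin _ sA); suff rr : rotn A r by rewrite (rotn_cyc cA rr).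
apply: (rotnP rA) => p q pA qA cpq; apply: contraT => npq.
have := rmin _ (kpermM rA (kperm_tperm pA qA cpq)).
by rewrite (cyc_merge npq) ltnn.
Qed.

(** The test by which modified rotations are recognised below: it suffices to count cycles. *)
Lemma kperm_rotn A s c : rotn A c -> kperm A s -> cyc s <= cyc c -> rotn A s.
Proof.
move=> cA sA le; apply: rotnP => // p q pA qA cpq; apply: contraT => npq.
have := kperm_cyc_ge cA (kpermM sA (kperm_tperm pA qA cpq)).
by rewrite leqNgt (leq_trans _ le) // (cyc_merge npq).
Qed.

End Rotn.

(** * Two fibres: the maximal number of cycles *)

Section Core.
Variables (D : finType) (C : eqType) (col : D -> C) (x y : C).
Hypothesis xy : x != y.
Implicit Types (psi c s t : {perm D}) (p q r : D).

Definition colset z := [set d | col d == z].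
Local Notation X := (colset x).
Local Notation Y := (colset y).
Definition termset := X :|: Y.
Local Notation A := termset.
Local Notation rot := (rotn col A).

Lemma colset_disj : [disjoint X & Y].
Proof.
rewrite -setI_eq0; apply/eqP/setP=> d; rewrite !inE; apply/negP.
by case/andP=> /eqP dx /eqP dy; move: xy; rewrite -dx -dy eqxx.
Qed.

Lemma in_X d : (d \in X) = (col d == x). Proof. by rewrite inE. Qed.
Lemma in_Y d : (d \in Y) = (col d == y). Proof. by rewrite inE. Qed.
Lemma in_A d : (d \in A) = (col d == x) || (col d == y).
Proof. by rewrite !inE. Qed.

(* psi is the product of an edge involution and of rotations at the vertices
   other than x and y, so that its orbits are the faces cut open at x and y;
   c ranges over the rotations at x and y. *)
Definition maxcyc psi := \max_(c | rot c) cyc (psi * c).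
Definition altopt psi := [exists c, [&& rot c, cyc (psi * c) == maxcyc psi
                                     & alt X Y (psi * c)]].
(** Some face, cut open at the terminals, passes from x to y. This fails for every rotation when the
    edges do not connect x to y, see [unlinked_conn]. *)
Definition linked psi := [exists p in X, exists q in Y, coorb psi p q].

Lemma linkedP psi : reflect (exists p q,
  [/\ p \in X, q \in Y & coorb psi p q]) (linked psi).
Proof.
apply: (iffP exists_inP) => [[p pX /exists_inP[q qY pq]]|[p [q [pX qY pq]]]].
  by exists p, q.
by exists p => //; apply/exists_inP; exists q.
Qed.

Lemma maxcyc_ge psi c : rot c -> cyc (psi * c) <= maxcyc psi.
Proof. exact: (leq_bigmax_cond (F := fun c => cyc (psi * c))). Qed.

Lemma maxcyc_ex psi : exists2 c, rot c & maxcyc psi = cyc (psi * c).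
Proof.
have [c0 r0] := rotn_exists col A.
have [|c rc e] := @eq_bigmax_cond _ rot (fun c => cyc (psi * c)).
  by apply/card_gt0P; exists c0.
by exists c.
Qed.

Lemma altoptP psi : reflect (exists c, [/\ rot c, cyc (psi * c) = maxcyc psi
                                     & alt X Y (psi * c)]) (altopt psi).
Proof.
apply: (iffP existsP) => [[c /and3P[a /eqP b d]]|[c [a b d]]]; exists c => //.
by rewrite a b eqxx d.
Qed.

Lemma bypass_Mr psi c p : c p = p -> bypass psi p * c = bypass (psi * c) p.
Proof. by move=> cp; rewrite /bypass permM -!mulgA tpermMl cp. Qed.

(** The rotations at x and y fix [p], so removing [p] commutes with multiplication by any of them
    and always creates one fixed point. *)
Lemma maxcyc_bypass_out psi p : p \notin A -> psi p != p ->
  maxcyc (bypass psi p) = (maxcyc psi).+1 /\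
  altopt (bypass psi p) = altopt psi.
Proof.
move=> pA mp.
have cp c : rot c -> c p = p by move=> /rotn_kperm/kperm_on/out_perm->.
have cE c : rot c -> cyc (bypass psi p * c) = (cyc (psi * c)).+1.
  move=> rc; rewrite bypass_Mr ?cp // cyc_bypass permM.
  by rewrite -{2}(cp c rc) (inj_eq perm_inj) mp addn1.
have altE c : rot c -> alt X Y (bypass psi p * c) = alt X Y (psi * c).
  move=> rc; rewrite bypass_Mr ?cp //; apply: alt_bypass colset_disj _ _ _.
  by rewrite /removable pA.
have ME : maxcyc (bypass psi p) = (maxcyc psi).+1.
  have [c rc ec] := maxcyc_ex psi; have [c' rc' ec'] := maxcyc_ex (bypass psi p).
  have := maxcyc_ge psi rc'; have := maxcyc_ge (bypass psi p) rc.
  by rewrite !cE // -ec ec' cE //; lia.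
split; first exact: ME.
apply/altoptP/altoptP => -[c [rc e al]]; exists c; split=> //.
- by move: e; rewrite ME cE // => -[].
- by rewrite -altE.
- by rewrite ME cE // e.
by rewrite altE.
Qed.

(* Moves p right after p' in its cycle of c. *)
Definition slide c p p' := c * tperm (c p) (c p') * tperm (c p) p.

Lemma rot_neq_fix c p q : rot c -> p \in A -> q \in A -> col p = col q ->
  p != q -> c p != p.
Proof.
move=> rc pA qA e pq; apply: contraNneq pq => cp.
by rewrite -(coorb_fix q cp) (rotn_coorb rc).
Qed.

Lemma rot_closed c p : rot c -> (c p \in A) = (p \in A).
Proof. by move=> /rotn_kperm/kperm_on; apply: perm_closed. Qed.

Lemma rot_col c p : rot c -> col (c p) = col p.
Proof. by move=> /rotn_kperm/kperm_col->. Qed.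

Lemma slide_rot c p p' : rot c -> p \in A -> p' \in A -> col p = col p' ->
  p != p' -> rot (slide c p p').
Proof.
move=> rc pA pA' e pp'; have cp := rot_neq_fix rc pA pA' e pp'.
have kr := rotn_kperm rc.
have kt a b : a \in A -> b \in A -> col a = col p -> col b = col p ->
    kperm col A (tperm a b).
  by move=> aA bA ea eb; apply: kperm_tperm => //; rewrite ea.
have cA a : (c a \in A) = (a \in A) by apply: rot_closed.
apply: (kperm_rotn rc).
  apply: kpermM; first apply: kpermM => //; apply: kt;
    by rewrite ?cA ?rot_col.
rewrite /slide; set n := c p; set r := c p'.
have rn : r != n by rewrite (inj_eq perm_inj) eq_sym.
case: (r =P p) => [->|/eqP rp]; first by rewrite mulg_tpermK.
(* In this order the product first isolates [p] and then merges it into a cycle again, so the number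
   of cycles is that of [c]. *)
have -> : c * tperm n r * tperm n p = c * tperm n p * tperm p r.
  rewrite -!mulgA; congr (_ * _); rewrite (tpermC p r).
  by rewrite (tperm_cycle3 _ rp) // [RHS]tpermMl tpermR tpermD // eq_sym.
rewrite [X in _ <= X](_ : _ = (cyc (bypass c p)).-1); last first.
  by rewrite cyc_bypass cp addn1.
have np : ~~ coorb (bypass c p) p r.
  by rewrite coorb_fix ?bypass_fix // eq_sym.
by rewrite (cyc_merge np) /bypass (tpermC p (c p)).
Qed.

(** This identity and the next one compare [psi] with [bypass psi p] while the rotation is modified
    by [slide]: one passage costs a single transposition, the other creates the fixed point [p]. *)
Lemma bypass_slide psi c p :
  bypass psi p * slide c p (psi p) = psi * c * tperm (c p) p.
Proof.
rewrite /bypass /slide -!mulgA; congr (_ * _).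
by rewrite !mulgA tpermMl mulg_tpermK.
Qed.

Lemma slide_bypass psi c p :
  psi * slide c p (psi p) = bypass (bypass psi p * c) p.
Proof.
have -> : bypass (bypass psi p * c) p = bypass psi p * c * tperm p (c p).
  by rewrite {1}/bypass permM bypass_fix.
rewrite /bypass /slide -!mulgA; congr (_ * _).
by rewrite [RHS]mulgA (tpermMl c) -!mulgA (tpermC p (c p)).
Qed.

(** By [slide_bypass] the passage from [bypass psi p] back to [psi] gains exactly one cycle, and by
    [bypass_slide] the opposite passage loses at most one; together they fix the difference of the
    maxima. *)
Lemma maxcyc_bypass_in psi p : p \in A -> psi p \in A -> col (psi p) = col p ->
  psi p != p -> maxcyc psi = (maxcyc (bypass psi p)).+1 /\
  altopt (bypass psi p) = altopt psi.
Proof.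
move=> pA qA e mp; pose psi' := bypass psi p; pose sl c := slide c p (psi p).
have slr c : rot c -> rot (sl c).
  by move=> rc; apply: slide_rot => //; rewrite eq_sym.
have fx c : rot c -> (psi' * c) p != p.
  move=> rc; rewrite permM bypass_fix; apply: (rot_neq_fix rc pA qA) => //.
  by rewrite eq_sym.
have ME : maxcyc psi = (maxcyc psi').+1.
  have [c rc ec] := maxcyc_ex psi; have [c' rc' ec'] := maxcyc_ex psi'.
  have := maxcyc_ge psi (slr _ rc'); have := maxcyc_ge psi' (slr _ rc).
  rewrite /sl /psi' slide_bypass cyc_bypass fx // bypass_slide.
  have := cyc_Mtperm_ge (psi * c) (c p) p; rewrite -ec -/psi' -ec'; lia.
split; first exact: ME.
apply/altoptP/altoptP => -[c [rc ec al]]; exists (sl c).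
  split; [exact: slr| |].
    by rewrite ME -ec /sl slide_bypass cyc_bypass fx // addn1.
  rewrite /sl slide_bypass alt_bypass //; first exact: colset_disj.
  rewrite /removable permM bypass_fix !inE !rot_col //.
  by move: pA; rewrite in_A => /orP[]->; rewrite ?orbT.
have := maxcyc_ge psi' (slr _ rc); rewrite /sl /psi' bypass_slide => le.
(* Otherwise the transposition would not lose a cycle and the maximum for [psi'] would be exceeded.
   So it merges two cycles, and merging keeps alternation. *)
have npq : ~~ coorb (psi * c) (c p) p.
  apply/negP => co; have := cyc_Mtperm (psi * c) (c p) p.
  by rewrite co; move: le; rewrite -ltnS -ME -ec; lia.
have ecyc := cyc_merge npq.
split; [exact: slr| |]; rewrite /sl /psi'.
  by move: ecyc; rewrite ec ME => -[].
exact: alt_merge npq al.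
Qed.

Lemma linked_bypass psi p : psi p != p ->
  (p \notin A) || (psi p \in A) && (col (psi p) == col p) ->
  linked (bypass psi p) = linked psi.
Proof.
move=> mp h; apply/exists_inP/exists_inP => -[u uX /exists_inP[v vY uv]].
  exists u => //; apply/exists_inP; exists v => //; rewrite -(bypassK psi p).
  by apply: coorb_merge_sub uv; rewrite coorb_fix ?bypass_fix // eq_sym.
pose f a := if a == p then psi p else a.
have fp a : f a != p by rewrite /f; case: ifP => // /negbT.
have fs a : coorb psi a (f a).
  by rewrite /f; case: eqP => [->|]; rewrite ?coorb_step ?coorb_refl.
have fc a : a \in A -> col (f a) = col a.
  rewrite /f; case: eqP => [->|//] pA; move: h; rewrite pA /=.
  by case/andP=> _ /eqP.
exists (f u); first by rewrite inE fc -?in_X //; rewrite inE uX.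
apply/exists_inP; exists (f v).
  by rewrite inE fc -?in_Y //; rewrite inE vY orbT.
rewrite coorb_bypass //; apply: coorb_trans (fs v).
by apply: coorb_trans uv; rewrite coorb_sym.
Qed.

(* Strictly alternating: a moved point of class x is sent to class y and
   conversely. *)
Definition salt psi := forall p, psi p != p -> p \in A /\ col (psi p) != col p.

Lemma salt_move psi p : salt psi -> psi p != p ->
  [/\ p \in A, psi p \in A & col (psi p) != col p].
Proof.
move=> sp mp; have [pA cp] := sp p mp; split=> //.
by have [] := sp (psi p); rewrite ?(inj_eq perm_inj).
Qed.

Lemma salt_linked psi : salt psi -> linked psi = (psi != 1).
Proof.
move=> sp; apply/exists_inP/idP => [[p pX /exists_inP[q qY]]|].
  apply: contraTneq => ->; rewrite coorb_fix ?perm1 //.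
  by apply: contraTneq pX => ->; rewrite (disjointFl colset_disj).
move=> n1; case: (pickP [pred p | psi p != p]) => [p /= mp|h]; last first.
  case/negP: n1; apply/eqP/permP=> p; rewrite perm1; apply/eqP.
  by have := h p; move/negbFE.
have [pA qA cpq] := salt_move sp mp; move: pA qA; rewrite !in_A.
case/orP=> /eqP cp; rewrite cp in cpq.
  rewrite (negPf cpq) /= => cq; exists p; first by rewrite inE cp.
  by apply/exists_inP; exists (psi p); rewrite ?coorb_step // inE.
rewrite (negPf cpq) orbF => cq; exists (psi p); first by rewrite inE.
apply/exists_inP; exists p; rewrite ?inE ?cp //.
by rewrite coorb_sym coorb_step.
Qed.

Lemma bypass_support psi p : support (bypass psi p) \subset support psi :\ p.
Proof.
apply/subsetP=> a; rewrite !inE bypassE.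
case: (a =P p) => [->|/eqP ap]; first by rewrite eqxx.
by rewrite /=; case: (psi a =P p) => [-> _|_ //]; rewrite eq_sym ap.
Qed.

Lemma bypass_Mdisj psi rho p : [disjoint support psi & support rho] ->
  psi p != p -> bypass psi p * rho = bypass (psi * rho) p.
Proof.
move=> dj mp; apply: bypass_Mr; apply: support_disjoint dj _.
by rewrite inE.
Qed.

(** The bystander [rho] stands for the other part of a sum, so that the two factors can be
    normalised independently. The offsets [k1] and [k2] count the points removed outside and inside
    the terminal darts. *)
Lemma normalize psi : exists psi' k1 k2,
  [/\ salt psi', support psi' \subset support psi, linked psi' = linked psi &
   forall rho, [disjoint support psi & support rho] ->
     maxcyc (psi * rho) + k1 = maxcyc (psi' * rho) + k2 /\
     altopt (psi * rho) = altopt (psi' * rho)].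
Proof.
have [n] := ubnP #|support psi|; elim: n psi => // n IH psi lt.
pose bad p := (psi p != p) && ((p \notin A) || (col (psi p) == col p)).
case: (pickP bad) => [p|nobad]; last first.
  exists psi, 0, 0; split=> // p mp; have := nobad p; rewrite /bad mp /=.
  by move/negbT/norP => [/negPn].
case/andP=> mp hp.
have sub := subset_trans (bypass_support psi p) (subD1set _ _).
have [|psi' [k1 [k2 [sp ss lp h]]]] := IH (bypass psi p).
  have := subset_leq_card (bypass_support psi p).
  by have := cardsD1 p (support psi); rewrite inE mp; lia.
have step rho : [disjoint support psi & support rho] ->
  (psi * rho) p = psi p.
  move=> dj; rewrite permM; apply: support_disjoint dj _.
  by rewrite inE (inj_eq perm_inj).
have dsub rho : [disjoint support psi & support rho] ->
  [disjoint support (bypass psi p) & support rho].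
  by apply: disjointWl.
have ls : linked psi' = linked psi.
  rewrite lp linked_bypass //; case: (boolP (p \in A)) hp => //= pA /eqP e.
  by rewrite e eqxx in_A e -in_A pA.
case: (boolP (p \in A)) hp => [pA /= /eqP e|pA _].
  exists psi', k1, k2.+1.
  split; [exact: sp|exact: subset_trans ss sub|exact: ls|].
  move=> rho dj; have [h1 h2] := h rho (dsub _ dj).
  have := @maxcyc_bypass_in (psi * rho) p pA.
  rewrite (step _ dj) -(bypass_Mdisj dj mp) in_A e -in_A => /(_ pA erefl mp)[-> <-].
  by split; [rewrite addSn h1 addnS|].
exists psi', k1.+1, k2.
split; [exact: sp|exact: subset_trans ss sub|exact: ls|].
move=> rho dj; have [h1 h2] := h rho (dsub _ dj).
have := @maxcyc_bypass_out (psi * rho) p pA.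
rewrite (step _ dj) -(bypass_Mdisj dj mp) => /(_ mp)[e1 <-].
by split; [rewrite addnS -addSn -e1|].
Qed.

(* When salt psi holds, these are half of the points moved by psi. *)
Definition half psi := [set p in X | psi p != p].

(** Up to the first point moved by [psi], the permutations [k] and [psi * k] follow the same path
    from [p]. *)
Lemma reach psi k p q : coorb k p q -> psi q != q ->
  exists r, [/\ psi r != r, coorb k p r & coorb (psi * k) p r].
Proof.
move=> pq mq.
case: (pickP [pred r | [&& psi r != r, coorb k p r & coorb (psi * k) p r]]).
  by move=> r /and3P[]; exists r.
move=> none; suff h : coorb k p q && coorb (psi * k) p q.
  by have := none q; rewrite /= mq h.
pattern q; apply: (coorb_ind pq); first by rewrite !coorb_refl.
move=> r /andP[a b]; rewrite coorb_stepr a /=.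
have := none r; rewrite /= a b !andbT => /negbFE/eqP e.
by rewrite -{1}e -permM coorb_stepr.
Qed.

Lemma perm_on_termset psi k : salt psi -> kperm col A k ->
  perm_on A (psi * k).
Proof.
move=> sp /kperm_on; apply: perm_onM; apply/subsetP => p; rewrite inE.
by case/sp.
Qed.

(* If p is not of class x, the moved point it reaches is sent to class x. *)
Lemma reach_half psi k : salt psi -> kperm col A k ->
  (forall p, p \in A -> exists2 q, coorb k p q & psi q != q) ->
  cyc (psi * k) + #|A| <= #|D| + #|half psi|.
Proof.
move=> sp kk h; apply: cyc_le_on (perm_on_termset sp kk) _ => p pA.
have hX q : q \in X -> exists2 r, r \in half psi & coorb (psi * k) q r.
  move=> qX; have [|r' r1 r2] := h q; first by rewrite inE qX.
  have [r [mr kr cr]] := reach r1 r2.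
  exists r => //; rewrite !inE mr -(kperm_coorb_col kk kr) andbT.
  by rewrite -in_X.
have [r' r1 r2] := h p pA; have [r [mr kr cr]] := reach r1 r2.
have [rA qA nc] := salt_move sp mr.
case: (boolP (r \in X)) => rX.
  by exists r => //; rewrite !inE -in_X rX.
have [|u uh cu] := hX ((psi * k) r).
  rewrite inE permM (kperm_col _ kk); move: qA nc rA rX; rewrite !in_A in_X.
  case/orP=> /eqP-> //; rewrite eq_sym => ny /orP[->//|e].
  by rewrite e in ny.
exists u => //; apply: coorb_trans cr _.
by rewrite coorb_stepl in cu.
Qed.
End Core.

Lemma cyc_ge_on (D : finType) (s : {perm D}) (A B : {set D}) :
  perm_on A s -> B \subset A ->
  {in B &, forall a b, coorb s a b -> a = b} -> #|B| + #|~: A| <= cyc s.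
Proof.
move=> sA BA inj.
have : (porbit s @: B) :|: (porbit s @: ~: A) \subset porbits s.
  by apply/subsetP=> O; rewrite inE => /orP[] /imsetP[p _ ->]; apply: imset_f.
have i1 : {in B &, injective (porbit s)}.
  by move=> a b aB bB /eqP; rewrite -coorbE => /inj->.
have i2 : {in ~: A &, injective (porbit s)}.
  move=> a b; rewrite !inE => aA bA /eqP; rewrite -coorbE coorb_fix.
    by move/eqP.
  exact: out_perm sA aA.
move/subset_leq_card; rewrite cardsU (card_in_imset i1) (card_in_imset i2).
rewrite (_ : _ :&: _ = set0) ?cards0 ?subn0 //; apply/setP=> O; rewrite !inE.
apply/andP=> -[/imsetP[a aB ->] /imsetP[b]]; rewrite inE => bA /eqP.
rewrite -coorbE coorb_sym coorb_fix; last exact: out_perm sA bA.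
by move=> /eqP ba; rewrite ba (subsetP BA) in bA.
Qed.

(** * Multiplying a rotation by a 3-cycle *)

Definition cycle3 (D : finType) (i j k : D) := tperm i j * tperm j k.

Section Cycle3.
Variables (D : finType) (C : eqType) (col : D -> C) (A : {set D}).
Variables (i j k : D).
Hypotheses (ij : i != j) (jk : j != k) (ik : i != k).
Let tau := cycle3 i j k.

Lemma cycle3V : tau^-1 = tperm j k * tperm i j.
Proof. by rewrite /tau invMg !tpermV. Qed.

Lemma cycle3VV : tau^-1 * tau^-1 = tau.
Proof.
rewrite {1}cycle3V -(tperm_cycle3 ik jk) cycle3V -!mulgA; congr (_ * _).
rewrite (mulgA (tperm i k)) (tpermMl (tperm j k)) tpermD 1?eq_sym // tpermR.
by rewrite -!mulgA (tpermC i j) tperm2 mulg1.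
Qed.

Hypotheses (iA : i \in A) (jA : j \in A) (kA : k \in A).
Hypotheses (cij : col i = col j) (cjk : col j = col k).

Lemma kperm_cycle3 : kperm col A tau.
Proof. by apply: kpermM; apply: kperm_tperm. Qed.

(** The first transposition [tperm i j] splits the cycle and separates [i] from [j]. If [k] is not
    with [j], then [tperm j k] merges the pieces again and [tau] works; otherwise [k] is not with
    [i], and the inverse works. *)
Lemma rotn_cycle3 c : rotn col A c ->
  rotn col A (c * tau) \/ rotn col A (c * tau^-1).
Proof.
move=> rc; have kc := rotn_kperm rc.
have sp : cyc (c * tperm i j) = (cyc c).+1.
  by apply: cyc_split ij _; apply: rotn_coorb rc _ _ _.
have := coorb_split ij (rotn_coorb rc iA jA cij).
move e : (c * tperm i j) => c1 in sp *; move=> nij.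
have [njk|jk1] := boolP (coorb c1 j k); last first.
  left; apply: (kperm_rotn rc); first exact: kpermM kc kperm_cycle3.
  by rewrite /tau /cycle3 mulgA e -ltnS -sp (cyc_merge jk1).
right; apply: (kperm_rotn rc).
  exact: kpermM kc (kpermV kperm_cycle3).
rewrite cycle3V -(tperm_cycle3 ik jk) mulgA e -ltnS -sp.
rewrite [X in _ < X](@cyc_merge _ c1 i k) //; apply: contra nij => ik1.
by apply: coorb_trans ik1 _; rewrite coorb_sym.
Qed.
End Cycle3.

Lemma cycle3J (D : finType) (i j k : D) s :
  cycle3 i j k ^ s = cycle3 (s i) (s j) (s k).
Proof. by rewrite /cycle3 conjMg !tpermJ. Qed.

(** * Permutations exchanging the two terminals: the upper bound and its defect *)

Section Kernel.
Variables (D : finType) (C : eqType) (col : D -> C) (x y : C).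
Hypothesis xy : x != y.
Implicit Types (psi c s t : {perm D}) (p q r : D).
Local Notation X := (colset col x).
Local Notation Y := (colset col y).
Local Notation A := (termset col x y).
Local Notation rot := (rotn col A).
Local Notation salt := (salt col x y).
Local Notation half := (half col x).
Local Notation maxcyc := (maxcyc col x y).
Local Notation altopt := (altopt col x y).
(** The darts away from the terminals are fixed by a strictly alternating [psi] and by the rotations
    at x and y, so they contribute [K0] trivial cycles. *)
Let K0 := #|~: A|.

Let XY p : p \in X -> p \notin Y.
Proof. by move=> pX; rewrite (disjointFr (colset_disj col xy)). Qed.

Lemma rot_cyc c x0 y0 : x0 \in X -> y0 \in Y -> rot c -> cyc c = K0 + 2.
Proof.
move=> x0X y0Y rc; have oc := kperm_on (rotn_kperm rc).
have n00 : x0 != y0 by apply: contraTneq x0X => ->; rewrite (disjointFl (colset_disj col xy)).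
have c2 : #|[set x0; y0]| = 2 by rewrite cards2 n00.
have x0A : x0 \in A by rewrite inE x0X.
have y0A : y0 \in A by rewrite inE y0Y orbT.
have [cx cy] : col x0 = x /\ col y0 = y.
  by move: x0X y0Y; rewrite !inE => /eqP-> /eqP->.
have le : cyc c + #|A| <= #|D| + #|[set x0; y0]|.
  apply: cyc_le_on oc _ => p pA; move: (pA); rewrite in_A => /orP[]/eqP cp.
    by exists x0; [exact: set21 | apply: (rotn_coorb rc) => //; rewrite cp cx].
  by exists y0; [exact: set22 | apply: (rotn_coorb rc) => //; rewrite cp cy].
have ge : #|[set x0; y0]| + #|~: A| <= cyc c.
  apply: cyc_ge_on oc _ _.
    by apply/subsetP=> p; rewrite in_set2 => /orP[]/eqP->.
  move=> a b; rewrite !in_set2 => /orP[]/eqP-> /orP[]/eqP-> //;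
  by move=> /(kperm_coorb_col (rotn_kperm rc)) e; move: xy; rewrite -cx -cy e eqxx.
have := cardsC A; rewrite c2 in le ge; rewrite /K0; lia.
Qed.

Lemma half_nonempty psi : salt psi -> psi != 1 -> 0 < #|half psi|.
Proof.
move=> sp n1; have : linked col x y psi by rewrite (salt_linked xy sp).
case/exists_inP=> p pX /exists_inP[q qY pq].
case: (boolP [exists r, psi r != r]) => [/existsP[r mr]|]; last first.
  rewrite negb_exists => /forallP h; case/negP: n1; apply/eqP/permP=> r.
  by rewrite perm1; apply/eqP/negPn/h.
have [rA qA nc] := salt_move sp mr.
case: (boolP (r \in X)) => rX.
  by apply/card_gt0P; exists r; rewrite !inE -in_X rX.
apply/card_gt0P; exists (psi r); rewrite !inE (inj_eq perm_inj) mr andbT.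
move: rA qA nc rX; rewrite !in_A in_X => /orP[->//|/eqP->].
by case/orP=> // /eqP->; rewrite eqxx.
Qed.

Lemma half_move psi p : salt psi -> p \in half psi ->
  [/\ psi p != p, p \in X, psi p \in Y & psi (psi p) \in half psi].
Proof.
move=> sp ph; have [/eqP cp mp] : col p == x /\ psi p != p.
  by move: ph; rewrite !inE => /andP.
have [pA qA nc] := salt_move sp mp.
have m2 : psi (psi p) != psi p by rewrite (inj_eq perm_inj).
have [_ rA nc2] := salt_move sp m2.
have cq : col (psi p) = y.
  by move: qA nc; rewrite in_A cp => /orP[->//|/eqP].
have cr : col (psi (psi p)) = x.
  by move: rA nc2; rewrite in_A cq => /orP[/eqP|->].
by split; rewrite ?inE ?cp ?cq ?cr ?eqxx ?(inj_eq perm_inj) ?mp.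
Qed.

Lemma cyc_upper psi c : salt psi -> psi != 1 -> rot c ->
  cyc (psi * c) <= K0 + #|half psi|.
Proof.
move=> sp n1 rc; have kc := rotn_kperm rc.
have /card_gt0P[h hh] := half_nonempty sp n1.
have [mh hX qY _] := half_move sp hh.
have := @reach_half _ _ col x y psi c sp kc.
have H : forall p, p \in A -> exists2 q, coorb c p q & psi q != q.
  move=> p pA; move: (pA); rewrite in_A => /orP[]/eqP cp.
    exists h => //; apply: (rotn_coorb rc) => //; first by rewrite inE hX.
    by move: hX; rewrite inE cp => /eqP->.
  exists (psi h); rewrite ?(inj_eq perm_inj) //.
  apply: (rotn_coorb rc) => //; first by rewrite inE qY orbT.
  by move: qY; rewrite inE cp => /eqP->.
by move=> /(_ H); have := cardsC A; rewrite /K0; lia.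
Qed.

(** With too few cycles, two points of [half psi] share one. Their successors are darts at y, and
    the cut that separates the two points separates these successors as well. *)
Lemma alt_of_lt psi c : salt psi -> rot c -> cyc (psi * c) < K0 + #|half psi| ->
  alt X Y (psi * c).
Proof.
move=> sp rc; apply: contraTT => nalt; rewrite -leqNgt addnC.
apply: cyc_ge_on.
- exact: (perm_on_termset sp (rotn_kperm rc)).
- by apply/subsetP=> p; rewrite !inE => /andP[->].
move=> p1 p2 h1 h2 co; apply/eqP; apply: contraNT nalt => n12.
have [_ X1 Y1 _] := half_move sp h1; have [_ X2 Y2 _] := half_move sp h2.
have YE p : psi p \in Y -> (psi * c) p \in Y.
  by rewrite permM !inE (rot_col _ rc).
have nXY a b : a \in X -> b \in Y -> a != b.
  by move=> aX bY; apply: contraTneq bY => <-; apply: XY.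
apply/altP; exists p1, p2, ((psi * c) p1), ((psi * c) p2).
split; rewrite ?YE //; split=> //.
  by rewrite coorb_stepl coorb_stepr.
have st p : p \in half psi -> coorb (psi * c * tperm p1 p2) p ((psi * c) p).
  move=> ph; have [_ _ Yp _] := half_move sp ph.
  have := coorb_step (psi * c * tperm p1 p2) p.
  by rewrite permM tpermD // nXY // YE.
apply: contra (coorb_split n12 co) => h.
apply: coorb_trans (st _ h1) _; apply: coorb_trans h _.
by rewrite coorb_sym st.
Qed.

(** An alternating cut would give one cycle more than the bound, while breaking the rotation at x in
    two. One of the two pieces must then avoid all points moved by [psi]; it is split off as a cycle
    of darts at x alone, and so it cannot separate two darts at y. *)
Lemma nalt_of_eq psi c : salt psi -> psi != 1 -> rot c ->
  cyc (psi * c) = K0 + #|half psi| -> ~~ alt X Y (psi * c).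
Proof.
move=> sp n1 rc e; have kc := rotn_kperm rc.
have /card_gt0P[h hh] := half_nonempty sp n1.
have [mh hX qY _] := half_move sp hh.
apply/altP => -[v1 [v2 [y1 [y2 [X1 X2 Y1 Y2 [sv sy ny]]]]]].
have n12 : v1 != v2.
  by apply: contraNneq ny => ->; rewrite tperm1 mulg1.
pose k := c * tperm v1 v2; pose th := psi * k.
have XA v : v \in X -> v \in A by move=> vX; rewrite inE vX.
have cX a b : a \in X -> b \in X -> col a = col b.
  by rewrite !inE => /eqP-> /eqP->.
have cY a b : a \in Y -> b \in Y -> col a = col b.
  by rewrite !inE => /eqP-> /eqP->.
have kk : kperm col A k.
  by apply: kpermM kc _; apply: kperm_tperm; rewrite ?XA //; apply: cX.
have thE : th = psi * c * tperm v1 v2 by rewrite /th /k mulgA.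
have cth : cyc th = (K0 + #|half psi|).+1 by rewrite thE cyc_split // e.
have ck : coorb c v1 v2 by apply: (rotn_coorb rc); rewrite ?XA //; apply: cX.
have nk := coorb_split n12 ck; have nth := coorb_split n12 sv.
have kP a b : coorb c a b =
  [|| coorb k a b, coorb k a v1 && coorb k v2 b
    | coorb k a v2 && coorb k v1 b].
  by rewrite -(coorb_merge _ _ nk) mulg_tpermK.
have thP a b : coorb (psi * c) a b =
  [|| coorb th a b, coorb th a v1 && coorb th v2 b
    | coorb th a v2 && coorb th v1 b].
  by rewrite thE -(coorb_merge _ _ nth) mulg_tpermK.
(* If [psi] moved a point in both cycles of [k] at x, then [reach_half] would apply to [k] and
   contradict [cth]. *)
have [v [vv hv]] : exists v, (v = v1 \/ v = v2) /\ forall q, coorb k v q -> psi q = q.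
  case: (boolP [exists q, coorb k v1 q && (psi q != q)]) => [/existsP[q1 /andP[c1 m1]]|]; last first.
    rewrite negb_exists => /forallP H; exists v1; split; first by left.
    by move=> q co; have := H q; rewrite co /= negbK => /eqP.
  case: (boolP [exists q, coorb k v2 q && (psi q != q)]) => [/existsP[q2 /andP[c2 m2]]|]; last first.
    rewrite negb_exists => /forallP H; exists v2; split; first by right.
    by move=> q co; have := H q; rewrite co /= negbK => /eqP.
  have := @reach_half _ _ col x y psi k sp kk.
  have H : forall p, p \in A -> exists2 q, coorb k p q & psi q != q.
    move=> p; rewrite in_setU => /orP[] pz.
      have : coorb c p v1 by apply: (rotn_coorb rc); rewrite ?XA //; apply: cX.
      rewrite kP => /or3P[h1|/andP[h1 _]|/andP[h1 _]].
      - by exists q1 => //; apply: coorb_trans h1 c1.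
      - by exists q1 => //; apply: coorb_trans h1 c1.
      by exists q2 => //; apply: coorb_trans h1 c2.
    exists (psi h); rewrite ?(inj_eq perm_inj) //.
    have : coorb c p (psi h).
      by apply: (rotn_coorb rc); rewrite ?in_setU ?pz ?qY ?orbT //; apply: cY.
    rewrite kP => /or3P[//|/andP[h1 _]|/andP[h1 _]];
      [have := XY X1 | have := XY X2];
      by rewrite in_Y -(kperm_coorb_col kk h1) -(in_Y col) pz.
  move=> /(_ H); rewrite -/th cth; have := cardsC A; rewrite /K0; clear; lia.
have orbv q : coorb th v q -> q \in X.
  move=> co; suff /andP[/(kperm_coorb_col kk) cq _] : coorb k v q && coorb th v q.
    by rewrite inE -cq -in_X; case: vv => ->.
  pattern q; apply: (coorb_ind co); first by rewrite !coorb_refl.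
  move=> r /andP[a b]; rewrite coorb_stepr b andbT.
  by rewrite /th permM (hv r a) coorb_stepr.
have out a b : a \in Y -> b \in Y -> ~~ (coorb th a v && coorb th b v).
  move=> aY _; apply/negP => /andP[h1 _]; rewrite coorb_sym in h1.
  by have := XY (orbv _ h1); rewrite aY.
have nv a : a \in Y -> ~~ coorb th v a.
  by move=> aY; apply: contraTN aY => /orbv/XY.
have nv' a : a \in Y -> ~~ coorb th a v by rewrite coorb_sym; exact: nv.
move: sy ny; rewrite thP -thE.
by case: vv => ev; rewrite -ev (negPf (nv _ Y2)) (negPf (nv' _ Y1)) ?andbF /=
  ?orbF => ->.
Qed.
End Kernel.

(** * Reaching the bound up to one, and the formula for disjoint factors *)

Section Kernel2.
Variables (D : finType) (C : eqType) (col : D -> C) (x y : C).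
Hypothesis xy : x != y.
Variables (x0 y0 : D).
Hypotheses (cx0 : col x0 = x) (cy0 : col y0 = y).
Implicit Types (psi c s t : {perm D}) (p q r : D).
Local Notation X := (colset col x).
Local Notation Y := (colset col y).
Local Notation A := (termset col x y).
Local Notation rot := (rotn col A).
Local Notation salt := (salt col x y).
Local Notation half := (half col x).
Local Notation maxcyc := (maxcyc col x y).
Local Notation altopt := (altopt col x y).
Local Notation linked := (linked col x y).
Definition ncyc0 := #|~: A|.
Local Notation K0 := ncyc0.

Let x0X : x0 \in X. Proof. by rewrite inE cx0. Qed.
Let y0Y : y0 \in Y. Proof. by rewrite inE cy0. Qed.
Let XY p : p \in X -> p \notin Y.
Proof. by move=> pX; rewrite (disjointFr (colset_disj col xy)). Qed.
Let colX a : a \in X -> col a = x. Proof. by rewrite inE => /eqP. Qed.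
Let colY a : a \in Y -> col a = y. Proof. by rewrite inE => /eqP. Qed.
Let XA a : a \in X -> a \in A. Proof. by move=> h; rewrite inE h. Qed.
Let YA a : a \in Y -> a \in A. Proof. by move=> h; rewrite inE h orbT. Qed.
Let nXY a b : a \in X -> b \in Y -> a != b.
Proof. by move=> aX bY; apply: contraTneq bY => <-; apply: XY. Qed.

Lemma rot_glue k a b : kperm col A k -> rot a -> rot b ->
  {in X, a =1 k} -> {in Y, b =1 k} -> rot k.
Proof.
move=> kk ra rb ak bk; apply: rotnP => // p q pA qA e.
move: (pA); rewrite inE => /orP[] pz.
  have co := rotn_coorb ra pA qA e.
  have st (d : D) : d \in X -> a d \in X by rewrite !inE (rot_col _ ra).
  by have /andP[] := coorb_agree st ak pz co.
have co := rotn_coorb rb pA qA e.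
have st (d : D) : d \in Y -> b d \in Y by rewrite !inE (rot_col _ rb).
by have /andP[] := coorb_agree st bk pz co.
Qed.

(* The rotation can absorb a 3-cycle of moved points of class x, possibly by
   conjugating it to the class y. *)
Lemma absorb_cycle3 psi i j k c : salt psi ->
  i \in half psi -> j \in half psi -> k \in half psi ->
  i != j -> j != k -> i != k -> rot c ->
  exists2 c', rot c' & cyc (psi * (cycle3 i j k)^-1 * c') = cyc (psi * c).
Proof.
move=> sp ih jh kh ij jk ik rc; set tau := cycle3 i j k.
(* The 3-cycle pulled back through [psi] permutes darts at y, so the rotation at y can absorb it
   when the rotation at x cannot. *)
pose sg := tau ^ psi^-1.
have sgE : sg * psi = psi * tau.
  by rewrite /sg conjgE invgK -!mulgA mulVg mulg1.
have inY p : p \in half psi -> psi^-1 p \in Y.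
  move=> ph; have [mp pX _ _] := half_move sp ph.
  have m : psi (psi^-1 p) != psi^-1 p.
    by rewrite permKV; apply: contraNneq mp => e; rewrite {1}e permKV.
  have [] := salt_move sp m; rewrite permKV => aA _ nc.
  by move: aA nc; rewrite in_A (colX pX) in_Y eq_sym => /orP[->|->].
have [_ iX _ _] := half_move sp ih; have [_ jX _ _] := half_move sp jh.
have [_ kX _ _] := half_move sp kh.
have kt : kperm col A tau.
  by apply: kperm_cycle3; rewrite ?XA // ?colX.
have T c1 : rot c1 -> rot (tau * c1) \/ rot (tau^-1 * c1).
  move=> r1; have E u : u * c1 = c1 * u ^ c1 by rewrite conjgE mulKVg.
  rewrite !E conjVg cycle3J; have inX a : a \in X -> c1 a \in X.
    by rewrite !inE (rot_col _ r1).
  by apply: rotn_cycle3; rewrite ?(inj_eq perm_inj) ?XA ?inX //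
    !colX ?inX.
have sE : sg = cycle3 (psi^-1 i) (psi^-1 j) (psi^-1 k) by rewrite /sg cycle3J.
have ks : kperm col A sg.
  by rewrite sE; apply: kperm_cycle3; rewrite ?YA ?inY // !colY ?inY.
have S c1 : rot c1 -> rot (c1 * sg) \/ rot (c1 * sg^-1).
  move=> r1; rewrite sE.
  by apply: rotn_cycle3; rewrite ?(inj_eq perm_inj) ?YA ?inY // !colY ?inY.
(* If neither [tau * c] nor [c * sg] is a rotation, both inverses are used: one inverse of [tau] at
   x and the inverse of [sg] at y. With the inverse already present this makes the cube of [tau],
   which is 1. *)
have [rt|rt] := T c rc.
  by exists (tau * c) => //; rewrite mulgA mulgKV.
have [rs|rs] := S c rc.
  exists (c * sg) => //; rewrite [X in cyc X]mulgA [LHS](cycC _ sg) !mulgA sgE.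
  by rewrite mulgK.
exists (tau^-1 * c * sg^-1).
  apply: (rot_glue _ rt rs).
  - apply: kpermM (kpermV ks); apply: kpermM (rotn_kperm rc).
    exact: kpermV.
  - move=> a aX; rewrite [RHS]permM; apply/esym/(canLR (permK _)); symmetry.
    have rX : (tau^-1 * c) a \in X by rewrite inE (rot_col _ rt) -in_X.
    by rewrite sE /cycle3 permM !tpermD // eq_sym nXY ?inY.
  move=> a aY; rewrite -mulgA [RHS]permM; congr (fun_of_perm _ _).
  apply/esym/(canLR (permK _)); symmetry.
  by rewrite /tau /cycle3 permM !tpermD // nXY.
have e : sg^-1 * psi = psi * tau^-1.
  by apply: (canRL (mulgK _)); rewrite -mulgA -sgE mulKg.
rewrite mulgA [LHS]cycC !mulgA e; congr (cyc (_ * _)).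
by rewrite -!mulgA (cycle3VV ij jk ik) mulVg mulg1.
Qed.

(** Restoring the 2-cycle gains a cycle as soon as [p] and [q] share a cycle of [psi2 * c']. This is
    arranged by moving [p], which [psi2] fixes, within the rotation at x, without changing the
    number of cycles. *)
Lemma cyc_lower_2cycle psi p c : salt psi -> p \in half psi ->
  psi (psi p) = p -> let psi2 := psi * tperm p (psi p) in
  psi2 != 1 -> rot c -> exists2 c', rot c' &
  cyc (psi * c') = (cyc (psi2 * c)).+1.
Proof.
move=> sp ph inv psi2 n1 rc; set q := psi p in inv psi2 n1 *.
have [mp pX qY _] := half_move sp ph.
have psi2p : psi2 p = p by rewrite /psi2 permM tpermR.
have psi2q : psi2 q = q by rewrite /psi2 permM inv tpermL.
have psi2E a : a != p -> a != q -> psi2 a = psi a.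
  move=> ap aq; rewrite /psi2 permM tpermD //; last by rewrite (inj_eq perm_inj) eq_sym.
  by rewrite -inv (inj_eq perm_inj) eq_sym.
have s2 : salt psi2.
  move=> a; case: (a =P p) => [->|/eqP ap]; first by rewrite psi2p eqxx.
  case: (a =P q) => [->|/eqP aq]; first by rewrite psi2q eqxx.
  by rewrite psi2E // => /sp.
have pq : p != q by apply: nXY.
suff [c' rc' [e co]] : exists2 c', rot c' &
    cyc (psi2 * c') = cyc (psi2 * c) /\ coorb (psi2 * c') p q.
  exists c' => //; rewrite -e.
  have -> : psi * c' = psi2 * c' * tperm (c' p) (c' q).
    by rewrite -!mulgA -tpermMl /psi2 mulgA mulgA mulg_tpermK.
  rewrite cyc_split // ?(inj_eq perm_inj) //.
  rewrite -{1}psi2p -{1}psi2q -(permM psi2 c') -(permM psi2 c').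
  by rewrite coorb_stepl coorb_stepr.
case: (boolP (coorb (psi2 * c) p q)) => [co|nco]; first by exists c.
(* As [psi2] still moves a dart at y, the cycle of [q] reaches such a dart and continues at x; next
   to the dart [v] found there, [p] is inserted. *)
have [v vX qv] : exists2 v, v \in X & coorb (psi2 * c) q v.
  have /card_gt0P[h hh] := half_nonempty xy s2 n1.
  have [mh hX hY _] := half_move s2 hh.
  have co : coorb c q (psi2 h).
    by apply: (rotn_coorb rc); rewrite ?YA // !colY.
  have [|r [mr cr fr]] := reach co (_ : psi2 (psi2 h) != psi2 h).
    by rewrite (inj_eq perm_inj).
  have [rA sA nc] := salt_move s2 mr.
  exists ((psi2 * c) r); last by rewrite coorb_stepr.
  rewrite inE (permM psi2) (rot_col _ rc).
  move: sA nc; rewrite in_A -(kperm_coorb_col (rotn_kperm rc) cr) (colY qY).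
  by case/orP=> [->|->].
have vp : v != p by apply: contraNneq nco => <-; rewrite coorb_sym.
have vq : v != q by apply: nXY.
have cp : c p != p.
  by apply: (rot_neq_fix rc (XA pX) (XA vX)); rewrite ?colX // eq_sym.
have phip : (psi2 * c) p = c p by rewrite (permM psi2) psi2p.
have E : psi2 * (bypass c p * tperm p v) = bypass (psi2 * c) p * tperm p v.
  by rewrite /bypass phip !mulgA.
have fresh (u : {perm D}) : u p = p -> ~~ coorb u p v by move=> up; rewrite coorb_fix // eq_sym.
exists (bypass c p * tperm p v).
  apply: (kperm_rotn rc).
    apply: kpermM; last by apply: kperm_tperm; rewrite ?XA // !colX.
    apply: kpermM (rotn_kperm rc) _; apply: kperm_tperm; rewrite ?XA //.
      by rewrite inE (rot_col _ rc) -in_X.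
    by rewrite (rot_col _ rc).
  by have := cyc_merge (fresh _ (bypass_fix c p)); rewrite cyc_bypass cp; clear; lia.
rewrite E; have np := fresh _ (bypass_fix (psi2 * c) p); split.
  by have := cyc_merge np; rewrite cyc_bypass phip cp; clear; lia.
rewrite coorb_merge //; apply/orP; right; apply/orP; left.
by rewrite coorb_refl coorb_bypass ?(eq_sym q) // coorb_sym.
Qed.

(** Induction by removing 2-cycles of [psi]. When there is none, multiplication by a 3-cycle creates
    one, and [absorb_cycle3] transfers the resulting rotation back to [psi]. *)
Lemma cyc_lower n psi : salt psi -> psi != 1 -> #|half psi| = n ->
  exists2 c, rot c & K0 + n <= (cyc (psi * c)).+1.
Proof.
elim: n {-2}n (leqnn n) psi => [|m IH] n len psi sp n1 hn.
  by have := half_nonempty xy sp n1; rewrite hn; move: len; clear; lia.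
(* There is always at least one cycle at the terminals, which is enough up to [n = 2]. *)
case: (leqP n 2) => n2.
  have [c rc] := rotn_exists col A; exists c => //.
  have := cyc_ge_off (perm_on_termset sp (rotn_kperm rc)) (XA x0X).
  have := cardsC A; rewrite /K0; clear -n2; lia.
have twoc psi1 p : salt psi1 -> #|half psi1| = n -> p \in half psi1 ->
    psi1 (psi1 p) = p ->
    exists2 c, rot c & K0 + n <= (cyc (psi1 * c)).+1.
  move=> s1 h1 ph inv; set psi2 := psi1 * tperm p (psi1 p).
  have [mp pX qY _] := half_move s1 ph.
  have psi2p : psi2 p = p by rewrite /psi2 permM tpermR.
  have psi2q : psi2 (psi1 p) = psi1 p by rewrite /psi2 permM inv tpermL.
  have psi2E a : a != p -> a != psi1 p -> psi2 a = psi1 a.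
    move=> ap aq; rewrite /psi2 permM tpermD //; last by rewrite (inj_eq perm_inj) eq_sym.
    by rewrite -[X in X != _]inv (inj_eq perm_inj) eq_sym.
  have s2 : salt psi2.
    move=> a; case: (a =P p) => [->|/eqP ap]; first by rewrite psi2p eqxx.
    case: (a =P psi1 p) => [->|/eqP aq]; first by rewrite psi2q eqxx.
    by rewrite psi2E // => /s1.
  have h2 : half psi2 = half psi1 :\ p.
    apply/setP=> a; rewrite !inE; case: (a =P p) => [->|/eqP ap].
      by rewrite psi2p eqxx andbF.
    case: (a =P psi1 p) => [->|/eqP aq]; last by rewrite psi2E.
    by rewrite psi2q eqxx (colY qY) eq_sym (negPf xy).
  have n2' : #|half psi2| = n.-1.
    by have := cardsD1 p (half psi1); rewrite ph h1 h2; clear; lia.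
  have n12 : psi2 != 1.
    have /card_gt0P[a] : 0 < #|half psi2| by rewrite n2'; move: n2; clear; lia.
    by rewrite !inE => /andP[_]; apply: contraNneq => ->; rewrite perm1.
  have [|c rc le] := IH n.-1 _ psi2 s2 n12 n2'; first by move: len; clear; lia.
  have [c' rc' e] := cyc_lower_2cycle s1 ph inv n12 rc.
  by exists c' => //; rewrite e -/psi2; move: le n2; clear; lia.
case: (boolP [exists p in half psi, psi (psi p) == p]) => [/exists_inP[p ph /eqP]|no2].
  exact: twoc.
have /card_gt0P[h hh] : 0 < #|half psi| by rewrite hn; move: n2; clear; lia.
have [mh hX yY uh] := half_move sp hh; set u := psi (psi h) in uh.
have uh' : u != h.
  by apply: contra no2 => e; apply/exists_inP; exists h.
have /card_gt0P[k] : 0 < #|half psi :\ h :\ u|.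
  have := cardsD1 h (half psi); rewrite hh.
  have := cardsD1 u (half psi :\ h); rewrite in_setD1 uh' uh /=; move: hn n2; clear; lia.
rewrite in_setD1 in_setD1 => /and3P[ku kh kk].
have [_ uX _ _] := half_move sp uh; have [_ kX _ _] := half_move sp kk.
(* Since [tau] sends [u = psi (psi h)] back to [h], the points [h] and [psi h] form a 2-cycle of
   [psi1]. The point [k] is any third element of [half psi], and [half] does not change. *)
set tau := cycle3 u k h; pose psi1 := psi * tau.
have tauY a : a \in Y -> tau a = a.
  by move=> aY; rewrite /tau /cycle3 permM !tpermD // nXY.
have tauu : tau u = h by rewrite /tau /cycle3 permM tpermL tpermL.
have tauH a : (tau a \in half psi) = (a \in half psi).
  rewrite /tau /cycle3 permM; case: (tpermP u k a) => [->|->|_ _].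
  - by rewrite tpermL uh hh.
  - by rewrite tpermD ?uh ?kk // eq_sym.
  by case: (tpermP k h a) => [->|->|] //; rewrite hh kk.
have tau_out a : a \notin half psi -> tau a = a.
  move=> ah; rewrite /tau /cycle3 permM !tpermD //;
  by apply: contraNneq ah => <-.
have hYm a : a \in Y -> psi a != a -> psi a \in half psi.
  move=> aY ma; have [_ bA nc] := salt_move sp ma.
  rewrite !inE (inj_eq perm_inj) ma andbT; move: bA nc.
  by rewrite in_A (colY aY) => /orP[->//|->].
have p1X a : a \in X -> psi1 a = psi a.
  move=> aX; rewrite /psi1 permM; case: (psi a =P a) => [e|/eqP ma].
    by rewrite e tau_out // !inE e eqxx andbF.
  by rewrite tauY //; have [] : [/\ psi a != a, a \in X, psi a \in Y
    & psi (psi a) \in half psi] by apply: half_move => //; rewrite !inE -in_X aX.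
have p1Y a : a \in Y -> psi1 a = tau (psi a) by rewrite /psi1 permM.
have p1m a : (psi1 a == a) = (psi a == a).
  apply/eqP/eqP => [|e]; last first.
    rewrite /psi1 permM e tau_out // !inE e eqxx andbF //.
  case: (boolP (a \in X)) => aX; first by rewrite p1X.
  move=> e; apply/eqP; apply: contraTT isT => ma.
  have [aA _ _] := salt_move sp ma.
  have aY : a \in Y by move: aA; rewrite inE (negPf aX).
  have := hYm a aY ma; rewrite -tauH -p1Y // e => ah.
  by have [_ aX2 _ _] := half_move sp ah; rewrite aX2 in aX.
have h1 : half psi1 = half psi.
  by apply/setP=> a; rewrite !inE p1m.
have s1 : salt psi1.
  move=> a; rewrite p1m => ma; have [aA bA nc] := salt_move sp ma; split=> //.
  move: (aA); rewrite inE => /orP[] az; first by rewrite p1X.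
  have := hYm a az ma; rewrite -tauH -p1Y // => ph.
  have [_ pX _ _] := half_move sp ph.
  by rewrite (colX pX) (colY az).
have inv1 : psi1 (psi1 h) = h by rewrite (p1X h hX) p1Y.
have hh1 : h \in half psi1 by rewrite h1.
have [|c rc le] := twoc psi1 h s1 _ hh1 inv1; first by rewrite h1.
have uk : u != k by rewrite eq_sym.
have uh1 : u \in half psi1 by rewrite h1.
have kh1 : k \in half psi1 by rewrite h1.
have [c' rc' e] := absorb_cycle3 s1 uh1 kh1 hh1 uk kh uh' rc.
exists c'; rewrite ?rc' //; move: e; rewrite /psi1 mulgK => ->.
exact: le.
Qed.

(** The parity of the gap between [K0 + #|half psi|] and [cyc (psi * c)], the same for every
    rotation [c]. *)
Definition altpar psi := odd #|half psi| (+) odd_perm psi.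

Lemma odd_cyc_rot psi c : rot c -> odd (cyc (psi * c)) = odd_perm psi (+) odd K0.
Proof.
move=> rc; rewrite odd_cyc odd_permM.
have := odd_cyc c; rewrite (rot_cyc xy x0X y0Y rc) oddD addbF -/K0 => ->.
exact: addbCA.
Qed.

(** By [cyc_upper] and [cyc_lower] the maximum is the bound or one less, and parity decides which;
    [alt_of_lt] and [nalt_of_eq] then identify the gap with alternation. *)
Lemma maxcyc_salt psi : salt psi -> psi != 1 ->
  maxcyc psi + altpar psi = K0 + #|half psi| /\ altopt psi = altpar psi.
Proof.
move=> sp n1; have [c rc e] := maxcyc_ex col x y psi.
have [c1 rc1 le1] := cyc_lower sp n1 erefl.
have le2 := maxcyc_ge psi rc1.
have le3 : maxcyc psi <= K0 + #|half psi| by rewrite e cyc_upper.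
have : odd (maxcyc psi) = odd_perm psi (+) odd K0 by rewrite e odd_cyc_rot.
move=> od; have H : maxcyc psi + altpar psi = K0 + #|half psi|.
  have d : K0 + #|half psi| = maxcyc psi \/ K0 + #|half psi| = (maxcyc psi).+1.
    by move: le1 le2 le3; clear; lia.
  rewrite /altpar; case: d => d; have := congr1 odd d; rewrite oddD /= od d;
    case: (odd K0); case: (odd_perm psi); case: (odd _) => //= _;
    by rewrite ?addn0 ?addn1.
split=> //; move: H; case p: (altpar psi) => /= H.
  apply/altoptP; exists c; split=> //; apply: alt_of_lt => //.
  by rewrite -e -/K0 -H addn1.
apply/altoptP => -[c2 [rc2 e2]]; apply/negP/nalt_of_eq => //.
by rewrite e2 -/K0 -H addn0.
Qed.

(** The exceptional case: [half 1] is empty, yet the rotations at x and at y are two cycles. *)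
Lemma maxcyc1 : maxcyc 1 = K0 + 2 /\ altopt 1 = false.
Proof.
have [c rc ->] := maxcyc_ex col x y 1; rewrite mul1g (rot_cyc xy x0X y0Y rc).
split=> //; apply/altoptP => -[c1 [rc1 _]]; rewrite mul1g.
case/altP=> v1 [v2 [y1 [y2 [X1 X2 Y1 Y2 [sv sy /negP[]]]]]].
have st b : b \in Y -> c1 b \in Y by rewrite !inE (rot_col _ rc1).
have ag : {in Y, c1 =1 c1 * tperm v1 v2}.
  by move=> b bY; rewrite permM tpermD // nXY // st.
by have /andP[] := coorb_agree st ag Y1 sy.
Qed.

Lemma disjoint_permM s t p : [disjoint support s & support t] ->
  (s * t) p = if p \in support s then s p else t p.
Proof.
move=> dj; rewrite permM; case: ifPn => [ps|/supportP->//].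
by apply: support_disjoint dj _; rewrite support_stable.
Qed.

Lemma salt_disjoint psi1 psi2 : [disjoint support psi1 & support psi2] ->
  salt psi1 -> salt psi2 ->
  salt (psi1 * psi2) /\ #|half (psi1 * psi2)| = #|half psi1| + #|half psi2|.
Proof.
move=> dj s1 s2; split.
  by move=> p; rewrite disjoint_permM //; case: ifP => _; [exact: s1|exact: s2].
have -> : half (psi1 * psi2) = half psi1 :|: half psi2.
  apply/setP=> p; rewrite !inE disjoint_permM //.
  case: ifPn => [ps|/supportP->]; last by rewrite eqxx andbF.
  by rewrite (support_disjoint dj ps) eqxx andbF orbF.
rewrite cardsU (_ : _ :&: _ = set0) ?cards0 ?subn0 //; apply/setP=> p.
rewrite !inE; apply/andP => -[/andP[_ m1] /andP[_ m2]].
have ps : p \in support psi1 by rewrite inE.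
by rewrite (support_disjoint dj ps) eqxx in m2.
Qed.

Lemma support1 : support (1 : {perm D}) = set0.
Proof. by apply/setP=> p; rewrite !inE perm1 eqxx. Qed.

(** Alternation is a gap of one below the bound, and at least one cycle meets the terminals; so the
    normalised [half] has at least two elements. *)
Lemma altopt_linked psi : altopt psi ->
  linked psi /\ 1 < #|support psi :&: X|.
Proof.
have [psi' [k1 [k2 [sp ss <- h]]]] := normalize col xy psi.
have dj : [disjoint support psi & support 1].
  by rewrite support1 -setI_eq0 setI0.
have [_] := h 1 dj; rewrite !mulg1 => ->; rewrite salt_linked //.
have [->|n1] := eqVneq psi' 1; first by case: maxcyc1 => _ ->.
have [e ->] := maxcyc_salt sp n1 => p; split=> //.
have : half psi' \subset support psi :&: X.
  apply/subsetP=> q; rewrite inE => /andP[qX m]; rewrite inE qX andbT.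
  by apply: (subsetP ss); rewrite inE.
move/subset_leq_card; apply: leq_trans.
have [c rc ec] := maxcyc_ex col x y psi'.
have := cyc_ge_off (perm_on_termset sp (rotn_kperm rc)) (XA x0X).
have := cardsC A; rewrite -ec; move: e; rewrite p /= /K0; clear; lia.
Qed.

(** After normalisation the sizes of [half] add, and the gaps [altpar] add modulo 2, so two gaps
    cancel: this is the doubled term on the right. An unlinked factor normalises to 1, whose maximum
    exceeds the general formula by two: this is the doubled term on the left. *)
Theorem maxcyc_disjoint psi1 psi2 : [disjoint support psi1 & support psi2] ->
  maxcyc (psi1 * psi2) + K0 + (~~ (linked psi1 && linked psi2)).*2 =
    maxcyc psi1 + maxcyc psi2 + (altopt psi1 && altopt psi2).*2
  /\ altopt (psi1 * psi2) = altopt psi1 (+) altopt psi2.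
Proof.
move=> dj.
have [phi1 [k1 [k2 [s1 ss1 l1 h1]]]] := normalize col xy psi1.
have [phi2 [j1 [j2 [s2 ss2 l2 h2]]]] := normalize col xy psi2.
have d1 psi : [disjoint support psi & support 1].
  by rewrite support1 -setI_eq0 setI0.
have [] := h1 1 (d1 _); have [] := h2 1 (d1 _); rewrite !mulg1 => e2 -> e1 ->.
have [] := h1 psi2 dj.
have dj1 : [disjoint support psi2 & support phi1].
  by rewrite disjoint_sym; apply: disjointWl dj.
have [] := h2 phi1 dj1; rewrite -(disjoint_commute dj1) => e21 -> e12 ->.
rewrite -l1 -l2 !salt_linked //.
have dj2 : [disjoint support phi2 & support phi1] by apply: disjointWl dj1.
have [sM hM] := salt_disjoint dj2 s2 s1.
have [e|n1] := eqVneq phi1 1.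
  have [m1 a1] := maxcyc1; rewrite e mulg1 in e21 e12 *; rewrite a1 andFb /=.
  rewrite mulg1; split=> //; move: e12 e21 e1 e2.
  by rewrite e m1 -!addnn /=; clear; lia.
have [e|n2] := eqVneq phi2 1.
  have [m1 a1] := maxcyc1; rewrite e mul1g in e21 e12 *; rewrite a1 andbF /=.
  rewrite ?mul1g addbF; split=> //; move: e12 e21 e1 e2.
  by rewrite e m1 -!addnn /=; clear; lia.
have nM : phi2 * phi1 != 1.
  have /card_gt0P[p] := half_nonempty xy s1 n1; rewrite !inE => /andP[_ m].
  apply: contraNneq m => /permP/(_ p); rewrite disjoint_permM // perm1.
  by case: ifPn => [ps|_ ->//]; rewrite (support_disjoint dj2 ps).
have [E1 ->] := maxcyc_salt s1 n1; have [E2 ->] := maxcyc_salt s2 n2.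
have [EM ->] := maxcyc_salt sM nM.
have pE : altpar (phi2 * phi1) = altpar phi1 (+) altpar phi2.
  rewrite /altpar hM oddD odd_permM.
  by case: (odd _) (odd _) (odd_perm phi1) (odd_perm phi2) => [] [] [] [].
split=> //; move: EM; rewrite pE hM; move: e12 e21 e1 e2 E1 E2.
by case: (altpar phi1); case: (altpar phi2); rewrite -!addnn /=; clear; lia.
Qed.
End Kernel2.

(** * Edge sets as involutions on darts *)

Section RotnUnion.
Variables (D : finType) (C : eqType) (col : D -> C) (A B : {set D}).
Hypothesis sep : forall a b, a \in A -> b \in B -> col a != col b.
Implicit Types s a b : {perm D}.

Let AB p : p \in A -> p \notin B.
Proof. by move=> pA; apply/negP => /(sep pA); rewrite eqxx. Qed.

Lemma rotnU a b : rotn col A a -> rotn col B b -> rotn col (A :|: B) (a * b).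
Proof.
move=> ra rb; have [ka kb] := (rotn_kperm ra, rotn_kperm rb).
have sub (S : {set D}) c : S \subset A :|: B -> kperm col S c -> kperm col (A :|: B) c.
  move=> SAB /andP[oc cc]; rewrite /kperm cc andbT.
  exact: subset_trans oc SAB.
apply: rotnP => [|p q]; first by apply: kpermM; [apply: (sub A)|apply: (sub B)];
  rewrite ?subsetUl ?subsetUr.
have agA : {in A, a =1 a * b}.
  move=> c cA; rewrite permM (out_perm (kperm_on kb)) // AB //.
  by rewrite (perm_closed _ (kperm_on ka)).
have agB : {in B, b =1 a * b}.
  move=> c cB; rewrite permM (out_perm (kperm_on ka)) //.
  by apply: contraL cB; apply: AB.
rewrite !inE => /orP[pA|pB] /orP[qA|qB] e.
- have st (c : D) : c \in A -> a c \in A by rewrite (perm_closed _ (kperm_on ka)).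
  by have /andP[] := coorb_agree st agA pA (rotn_coorb ra pA qA e).
- by have := sep pA qB; rewrite e eqxx.
- by have := sep qA pB; rewrite e eqxx.
have st (c : D) : c \in B -> b c \in B by rewrite (perm_closed _ (kperm_on kb)).
by have /andP[] := coorb_agree st agB pB (rotn_coorb rb pB qB e).
Qed.

Lemma rotn_split s : rotn col (A :|: B) s ->
  exists a b, [/\ rotn col A a, rotn col B b & s = a * b].
Proof.
move=> rs; have ks := rotn_kperm rs.
have cl p : (s p \in A :|: B) = (p \in A :|: B).
  by rewrite (perm_closed _ (kperm_on ks)).
have clA p : (s p \in A) = (p \in A).
  have cs := kperm_col p ks; apply/idP/idP => pA.
    have : p \in A :|: B by rewrite -cl inE pA.
    by rewrite inE => /orP[//|pB]; have := sep pA pB; rewrite cs eqxx.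
  have : s p \in A :|: B by rewrite cl inE pA.
  by rewrite inE => /orP[//|pB]; have := sep pA pB; rewrite cs eqxx.
have inj : injective (fun p => if p \in A then s p else p).
  move=> p q; case: ifP => pA; case: ifP => qA //; first exact: perm_inj.
  - by move=> e; rewrite -e clA pA in qA.
  by move=> e; rewrite e clA qA in pA.
pose a := perm inj; have aE p : a p = if p \in A then s p else p by rewrite permE.
have kc c : (forall p, c p = p \/ c p = s p) -> forall p, col (c p) == col p.
  by move=> h p; case: (h p) => ->; rewrite ?(kperm_col _ ks).
have ka : kperm col A a.
  apply/andP; split; first by apply/subsetP=> p; rewrite inE aE; case: ifP; rewrite ?eqxx.
  by apply/forallP; apply: kc => p; rewrite aE; case: ifP; [right|left].
pose b := a^-1 * s.
have sE : s = a * b by rewrite /b mulKVg.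
have bE p : b p = if p \in A then p else s p.
  rewrite /b permM; have [pA|pA] := boolP (p \in A).
    have e : a (s^-1 p) = p by rewrite aE -clA permKV pA.
    by rewrite -{1}e permK permKV.
  have e : a p = p by rewrite aE (negPf pA).
  by rewrite -{1}e permK.
have kb : kperm col B b.
  apply/andP; split.
    apply/subsetP=> p; rewrite inE bE; case: ifP; rewrite ?eqxx // => pA.
    apply: contraR => pB; rewrite (out_perm (kperm_on ks)) // inE pA.
    by rewrite (negPf pB).
  by apply/forallP; apply: kc => p; rewrite bE; case: ifP; [left|right].
have agA : {in A, s =1 a} by move=> p pA; rewrite aE pA.
have agB : {in B, s =1 b}.
  by move=> p pB; rewrite bE; case: ifP => // /AB; rewrite pB.
exists a, b; split=> //.
  apply: (rotnP ka) => p q pA qA e.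
  have st (c : D) : c \in A -> s c \in A by rewrite clA.
  have := rotn_coorb rs (_ : p \in A :|: B) (_ : q \in A :|: B) e.
  rewrite !inE pA qA => /(_ isT isT) co.
  by have /andP[] := coorb_agree st agA pA co.
apply: (rotnP kb) => p q pB qB e.
have st (c : D) : c \in B -> s c \in B.
  move=> cB; have := cl c; rewrite !inE cB orbT clA.
  by case: (boolP (c \in A)) => [/AB|_ //]; rewrite cB.
have := rotn_coorb rs (_ : p \in A :|: B) (_ : q \in A :|: B) e.
rewrite !inE pB qB !orbT => /(_ isT isT) co.
by have /andP[] := coorb_agree st agB pB co.
Qed.
End RotnUnion.

Section EdgePerm.
Variable T : finType.
Implicit Types (E F : {set {set T}}) (W V : {set T}) (d : T * T) (u v x y : T).
Local Notation D := (T * T)%type.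
Local Notation dcol := (@fst T T).

(* Non-adjacent pairs are fixed: they act as harmless half-edges, so that all
   graphs on T share the same rotations. *)
Definition edge_swap E d := if [set d.1; d.2] \in E then (d.2, d.1) else d.

Lemma edge_swapK E : involutive (edge_swap E).
Proof.
move=> [u v]; rewrite /edge_swap /=.
case: (boolP ([set u; v] \in E)) => [uv|/negPf uv] /=; last by rewrite uv.
by rewrite setUC uv.
Qed.

Definition alpha E : {perm D} := perm (can_inj (edge_swapK E)).

Lemma alphaE E u v : alpha E (u, v) = if [set u; v] \in E then (v, u) else (u, v).
Proof. by rewrite permE. Qed.

Lemma alpha0 : alpha set0 = 1.
Proof. by apply/permP=> -[u v]; rewrite alphaE inE perm1. Qed.

Lemma alpha_mem E u v : alpha E (u, v) != (u, v) -> [set u; v] \in E.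
Proof. by rewrite alphaE; case: ifP; rewrite ?eqxx. Qed.

Lemma alphaU E F : [disjoint E & F] -> alpha (E :|: F) = alpha E * alpha F.
Proof.
move=> dj; apply/permP=> -[u v]; rewrite permM !alphaE inE.
case: (boolP (_ \in E)) => [uE|uE] /=; last by rewrite alphaE.
by rewrite alphaE setUC (disjointFr dj uE).
Qed.

Lemma set2_inj a b u v : [set a; b] = [set u; v] ->
  (a = u /\ b = v) \/ (a = v /\ b = u).
Proof.
move=> e; have /set2P ua : u \in [set a; b] by rewrite e set21.
have /set2P va : v \in [set a; b] by rewrite e set22.
have /set2P au : a \in [set u; v] by rewrite -e set21.
have /set2P bu : b \in [set u; v] by rewrite -e set22.
by case: au bu ua va => -> [] -> [] e1 [] e2; auto.
Qed.

Lemma alpha1 u v : alpha [set [set u; v]] = tperm (u, v) (v, u).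
Proof.
apply/permP=> -[a b]; rewrite alphaE inE.
case: tpermP => [[-> ->]|[-> ->]|n1 n2]; rewrite ?eqxx //.
  by rewrite (setUC [set v]) eqxx.
by case: eqP => // /set2_inj[] [e1 e2]; [case: n1|case: n2]; rewrite e1 e2.
Qed.

Definition fib W : {set D} := [set d | d.1 \in W].
Definition fullrot (s : {perm D}) := rotn dcol setT s.

Lemma fib_sep W V : [disjoint W & V] ->
  forall a b, a \in fib W -> b \in fib V -> a.1 != b.1.
Proof.
move=> dj a b; rewrite !inE => aW bV; apply: contraTneq bV => <-.
by rewrite (disjointFr dj).
Qed.

Lemma rotn_support W s : rotn dcol (fib W) s -> support s \subset fib W.
Proof.
move=> /rotn_kperm/kperm_on os; apply/subsetP=> d; rewrite inE.
by apply: contraR => dW; rewrite (out_perm os).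
Qed.

Definition inside E W := forall u v, [set u; v] \in E -> u \in W.

Lemma support_alpha E W : inside E W -> support (alpha E) \subset fib W.
Proof.
by move=> EW; apply/subsetP=> -[u v]; rewrite !inE => /alpha_mem/EW.
Qed.

Definition nverts := #|{: T}|.

Lemma cyc_fullrot s : fullrot s -> cyc s = nverts.
Proof.
move=> rs; have ks := rotn_kperm rs.
have h : porbits s = [set [set d | d.1 == u] | u in T].
  apply/setP=> O; apply/imsetP/imsetP => -[a _ ->].
    exists a.1 => //; apply/setP=> b; have := rotn_coorbE a b rs.
    rewrite /coorb => ->; rewrite !inE /= eq_sym.
    by case: eqP => [->|_] //=; rewrite eqxx.
  exists (a, a) => //; apply/setP=> b; have := rotn_coorbE (a, a) b rs.
  rewrite /coorb => ->; rewrite !inE /= eq_sym.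
  by case: ((a,a) =P b) => [<-|_] //=; rewrite eqxx.
rewrite /cyc /nverts h card_imset // => u v /setP/(_ (u, u)).
by rewrite !inE /= eqxx => /esym/eqP.
Qed.

(** The maximal number of faces over padded embeddings. It yields the genus by [genusE], and [altE]
    below yields epsilon by [alternating_minE]. *)
Definition Zmax E := \max_(s | fullrot s) cyc (alpha E * s).
Definition fiber u : {set D} := colset dcol u.
Definition altE x y E := [exists s, [&& fullrot s, cyc (alpha E * s) == Zmax E
                                      & alt (fiber x) (fiber y) (alpha E * s)]].

Lemma Zmax_ge E s : fullrot s -> cyc (alpha E * s) <= Zmax E.
Proof. exact: (leq_bigmax_cond (F := fun s => cyc (alpha E * s))). Qed.

Lemma Zmax_ex E : exists2 s, fullrot s & Zmax E = cyc (alpha E * s).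
Proof.
have [c0 r0] := rotn_exists dcol setT.
have [|c rc e] := @eq_bigmax_cond _ fullrot (fun s => cyc (alpha E * s)).
  by apply/card_gt0P; exists c0.
by exists c.
Qed.

Lemma altEP x y E : reflect (exists s, [/\ fullrot s,
    cyc (alpha E * s) = Zmax E & alt (fiber x) (fiber y) (alpha E * s)])
  (altE x y E).
Proof.
apply: (iffP existsP) => [[c /and3P[a /eqP b d]]|[c [a b d]]]; exists c => //.
by rewrite a b eqxx d.
Qed.

Section Split.
Variables (x y : T) (W1 W2 : {set T}).
Hypotheses (xy : x != y) (xW1 : x \notin W1) (yW1 : y \notin W1).
Hypothesis W2E : W2 = ~: (W1 :|: [set x; y]).
Local Notation maxcyc := (maxcyc dcol x y).
Local Notation altopt := (altopt dcol x y).
Local Notation rot := (rotn dcol (termset dcol x y)).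

Let djW : [disjoint W1 & W2].
Proof.
rewrite -setI_eq0 W2E; apply/eqP/setP=> u; rewrite !inE.
by case: (u \in W1).
Qed.
Let djWt : [disjoint W1 :|: W2 & [set x; y]].
Proof.
rewrite -setI_eq0 W2E; apply/eqP/setP=> u; rewrite !inE.
case: eqP => [->|_]; first by rewrite (negPf xW1).
by case: eqP => [->|_]; rewrite ?andbF // (negPf yW1).
Qed.
Let termE : termset dcol x y = fib [set x; y].
Proof. by apply/setP=> d; rewrite !inE. Qed.

Lemma fullrot_join s1 s2 c : rotn dcol (fib W1) s1 -> rotn dcol (fib W2) s2 ->
  rot c -> fullrot (s1 * s2 * c).
Proof.
move=> r1 r2; rewrite termE => rc.
have := @rotnU _ _ dcol _ _ (fib_sep djWt) _ _ (_ : rotn dcol (fib (W1 :|: W2)) (s1 * s2)) rc.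
have -> : fib (W1 :|: W2) :|: fib [set x; y] = setT.
  apply/setP=> d; rewrite !inE W2E !inE.
  by case: (d.1 \in W1); case: (d.1 == x); case: (d.1 == y).
apply; have -> : fib (W1 :|: W2) = fib W1 :|: fib W2.
  by apply/setP=> d; rewrite !inE.
exact: (@rotnU _ _ dcol _ _ (fib_sep djW)).
Qed.

Lemma fullrot_split s : fullrot s -> exists s1 s2 c,
  [/\ rotn dcol (fib W1) s1, rotn dcol (fib W2) s2, rot c & s = s1 * s2 * c].
Proof.
rewrite /fullrot => rs.
have e : fib (W1 :|: W2) :|: fib [set x; y] = setT.
  apply/setP=> d; rewrite !inE W2E !inE.
  by case: (d.1 \in W1); case: (d.1 == x); case: (d.1 == y).
rewrite -e in rs; have [a [c [ra rc ->]]] := rotn_split (fib_sep djWt) rs.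
have e2 : fib (W1 :|: W2) = fib W1 :|: fib W2.
  by apply/setP=> d; rewrite !inE.
rewrite e2 in ra; have [s1 [s2 [r1 r2 ->]]] := rotn_split (fib_sep djW) ra.
by exists s1, s2, c; rewrite termE.
Qed.

Variables E1 E2 : {set {set T}}.
Hypotheses (in1 : inside E1 (W1 :|: [set x; y]))
  (in2 : inside E2 (W2 :|: [set x; y])) (djE : [disjoint E1 & E2]).

(** The edges of [E2] have no dart at [W1], so [s1] commutes with their involution and the two sides
    separate. *)
Lemma alpha_split s1 s2 c :
  rotn dcol (fib W1) s1 -> rotn dcol (fib W2) s2 ->
  alpha (E1 :|: E2) * (s1 * s2 * c) = alpha E1 * s1 * (alpha E2 * s2) * c.
Proof.
move=> r1 r2; rewrite alphaU // -!mulgA; congr (_ * _).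
rewrite !mulgA; do 2 congr (_ * _); apply/esym/disjoint_commute.
apply: disjointWl (rotn_support r1) _; apply: disjointWr (support_alpha in2) _.
rewrite -setI_eq0; apply/eqP/setP=> d; rewrite !inE W2E !inE.
case: (d.1 =P x) => [->|_]; first by rewrite (negPf xW1).
case: (d.1 =P y) => [->|_]; first by rewrite (negPf yW1).
by case: (d.1 \in W1).
Qed.

Lemma psi_disjoint s1 s2 :
  rotn dcol (fib W1) s1 -> rotn dcol (fib W2) s2 ->
  [disjoint support (alpha E1 * s1) & support (alpha E2 * s2)].
Proof.
move=> r1 r2.
have sub E s W : rotn dcol (fib W) s ->
    support (alpha E * s) \subset support (alpha E) :|: fib W.
  move=> /rotn_support/subsetP ss; apply/subsetP=> d; rewrite in_setU.
  apply: contraLR; rewrite negb_or => /andP[/supportP aE dW].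
  by apply/supportP; rewrite permM aE; apply/supportP; apply: contra dW => /ss.
apply: disjointWl (sub _ _ _ r1) _; apply: disjointWr (sub _ _ _ r2) _.
rewrite -setI_eq0; apply/eqP/setP=> -[u v]; rewrite in_set0.
apply/negP; rewrite in_setI !in_setU => /andP[].
have i1 := subsetP (support_alpha in1) (u, v).
have i2 := subsetP (support_alpha in2) (u, v).
case/orP=> h1 /orP[] h2.
- move: h1 h2; rewrite !inE => /alpha_mem h1 /alpha_mem.
  by rewrite (disjointFr djE).
- move/i1: h1; rewrite !inE in h2 *; move: h2; rewrite W2E !inE.
  by case: (u \in W1); case: (u == x); case: (u == y).
- move/i2: h2; rewrite !inE in h1 *; rewrite W2E !inE h1 /=.
  by case/orP=> /eqP e; move: h1; rewrite e ?(negPf xW1) ?(negPf yW1).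
by move: h1 h2; rewrite !inE /= => h1; rewrite (disjointFr djW).
Qed.

Lemma Zsplit_ge s1 s2 : rotn dcol (fib W1) s1 -> rotn dcol (fib W2) s2 ->
  maxcyc (alpha E1 * s1 * (alpha E2 * s2)) <= Zmax (E1 :|: E2).
Proof.
move=> r1 r2; have [c rc ->] := maxcyc_ex dcol x y (alpha E1 * s1 * (alpha E2 * s2)).
by rewrite -alpha_split //; apply: Zmax_ge; apply: fullrot_join.
Qed.

Lemma Zsplit_ex : exists s1 s2, [/\ rotn dcol (fib W1) s1,
  rotn dcol (fib W2) s2 &
  maxcyc (alpha E1 * s1 * (alpha E2 * s2)) = Zmax (E1 :|: E2)].
Proof.
have [s /fullrot_split[s1 [s2 [c [r1 r2 rc ->]]]] e] := Zmax_ex (E1 :|: E2).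
exists s1, s2; split=> //; apply/eqP; rewrite eqn_leq Zsplit_ge //=.
by rewrite e alpha_split // maxcyc_ge.
Qed.

Lemma Zsplit_alt : altE x y (E1 :|: E2) <-> exists s1 s2,
  [/\ rotn dcol (fib W1) s1, rotn dcol (fib W2) s2,
  maxcyc (alpha E1 * s1 * (alpha E2 * s2)) = Zmax (E1 :|: E2) &
  altopt (alpha E1 * s1 * (alpha E2 * s2))].
Proof.
split=> [/altEP[s [/fullrot_split[s1 [s2 [c [r1 r2 rc ->]]]]]]|].
  rewrite alpha_split // => e al.
  have em : maxcyc (alpha E1 * s1 * (alpha E2 * s2)) = Zmax (E1 :|: E2).
    by apply/eqP; rewrite eqn_leq Zsplit_ge //= -e maxcyc_ge.
  by exists s1, s2; split=> //; apply/altoptP; exists c; rewrite em.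
move=> [s1 [s2 [r1 r2 e /altoptP[c [rc ec al]]]]]; apply/altEP.
by exists (s1 * s2 * c); rewrite alpha_split // ec e; split=> //; apply: fullrot_join.
Qed.
End Split.
End EdgePerm.

(** * Maximal numbers of faces of one side, with and without the edge xy *)

Section Zformulas.
Variable T : finType.
Implicit Types (E F : {set {set T}}) (W V : {set T}) (u v : T) (s : {perm T * T}).
Local Notation D := (T * T)%type.
Local Notation dcol := (@fst T T).

Lemma odd_fullrot s s' : fullrot s -> fullrot s' -> odd_perm s = odd_perm s'.
Proof. by move=> r r'; have := rotn_cyc r' r; rewrite /odd_perm /cyc => ->. Qed.

Lemma alphaU1 E u v : [set u; v] \notin E ->
  alpha ([set u; v] |: E) = tperm (u, v) (v, u) * alpha E.
Proof.
move=> uv; rewrite alphaU ?alpha1 //.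
by rewrite -setI_eq0; apply/eqP/setP=> e; rewrite !inE; case: eqP => // ->; apply/negbTE.
Qed.

Lemma cyc_alphaU1 E u v s : [set u; v] \notin E -> u != v ->
  cyc (alpha ([set u; v] |: E) * s) <= (cyc (alpha E * s)).+1 /\
  cyc (alpha E * s) <= (cyc (alpha ([set u; v] |: E) * s)).+1.
Proof.
move=> uvE uv; rewrite alphaU1 // -mulgA.
by rewrite (cycC (tperm _ _)); split; [exact: cyc_Mtperm_le | exact: cyc_Mtperm_ge].
Qed.

(** For a fixed rotation a new edge changes the number of faces by one, and all rotations give
    numbers of the same parity. *)
Lemma Zmax_add E u v : [set u; v] \notin E -> u != v ->
  Zmax ([set u; v] |: E) = (Zmax E).+1 \/
  Zmax E = (Zmax ([set u; v] |: E)).+1.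
Proof.
move=> uvE uv; have [s rs e] := Zmax_ex E.
have [s' rs' e'] := Zmax_ex ([set u; v] |: E).
have [_ h1] := cyc_alphaU1 s uvE uv; have [h2 _] := cyc_alphaU1 s' uvE uv.
have g1 := Zmax_ge ([set u; v] |: E) rs; have g2 := Zmax_ge E rs'.
have : odd (Zmax ([set u; v] |: E)) = ~~ odd (Zmax E).
  rewrite e e' !odd_cyc alphaU1 // !odd_permM odd_tperm (odd_fullrot rs rs').
  rewrite xpair_eqE (negPf uv) /=.
  by case: (odd _); case: (odd_perm _); case: (odd_perm _).
move: h1 h2 g1 g2; rewrite -e -e' => h1 h2 g1 g2 od.
have ne : Zmax ([set u; v] |: E) <> Zmax E.
  by move=> q; move: od; rewrite q; case: (odd _).
lia.
Qed.

Section Side.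
Variables (x y : T) (W1 W2 : {set T}).
Hypotheses (xy : x != y) (xW1 : x \notin W1) (yW1 : y \notin W1).
Hypothesis W2E : W2 = ~: (W1 :|: [set x; y]).
Local Notation maxcyc := (maxcyc dcol x y).
Local Notation altopt := (altopt dcol x y).
Local Notation linked := (linked dcol x y).
Local Notation K0 := (ncyc0 dcol x y).
Local Notation rot := (rotn dcol (termset dcol x y)).
Local Notation e := [set x; y].
Local Notation t := (tperm (x, y) (y, x)).

(* The value of maxcyc on any rotation of the vertices in W, see kapE. *)
Definition kap W := maxcyc (xchoose (rotn_exists dcol (fib W))).

Lemma kapE W s : x \notin W -> y \notin W -> rotn dcol (fib W) s ->
  maxcyc s = kap W.
Proof.
move=> xW yW rs; rewrite /kap; set s0 := xchoose _.
have r0 : rotn dcol (fib W) s0 by apply: xchooseP.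
have sep a b : a \in fib W -> b \in termset dcol x y -> a.1 != b.1.
  by rewrite !inE => aW; case/orP=> /eqP->; apply: contraTneq aW => ->.
have [c rc ->] := maxcyc_ex dcol x y s; have [c' rc' ->] := maxcyc_ex dcol x y s0.
apply: (@rotn_cyc _ _ dcol (fib W :|: termset dcol x y));
by apply: (@rotnU _ _ dcol _ _ sep).
Qed.

Lemma x0X : dcol (x, x) = x. Proof. by []. Qed.
Lemma y0Y : dcol (y, y) = y. Proof. by []. Qed.

Lemma maxcyc_disjoint' (psi1 psi2 : {perm D}) :
  [disjoint support psi1 & support psi2] ->
  maxcyc (psi1 * psi2) + K0 + (~~ (linked psi1 && linked psi2)).*2 =
    maxcyc psi1 + maxcyc psi2 + (altopt psi1 && altopt psi2).*2
  /\ altopt (psi1 * psi2) = altopt psi1 (+) altopt psi2.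
Proof. exact: (maxcyc_disjoint xy x0X y0Y). Qed.

Lemma altopt_linked' (psi : {perm D}) : altopt psi -> linked psi.
Proof. by move/(altopt_linked xy x0X y0Y)=> []. Qed.

Lemma unlinked_fib W s : x \notin W -> rotn dcol (fib W) s -> linked s = false.
Proof.
move=> xW rs; apply/linkedP => -[p [q [pX qY]]].
rewrite coorb_fix; last first.
  apply/supportP; apply: contra xW => /(subsetP (rotn_support rs)).
  by rewrite inE; move: pX; rewrite inE => /eqP->.
by move/eqP=> pq; move: pX qY xy; rewrite pq !inE => /eqP<- /eqP<-; rewrite eqxx.
Qed.

Let xW2 : x \notin W2. Proof. by rewrite W2E !inE eqxx orbT. Qed.
Let yW2 : y \notin W2. Proof. by rewrite W2E !inE eqxx !orbT. Qed.
Let djW : [disjoint fib W1 & fib W2].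
Proof.
rewrite -setI_eq0; apply/eqP/setP=> d; rewrite !inE W2E !inE.
by case: (d.1 \in W1).
Qed.

Lemma kap_sum : kap W1 + kap W2 = nverts T + K0 + 2.
Proof.
have [s1 r1] := rotn_exists dcol (fib W1).
have [s2 r2] := rotn_exists dcol (fib W2).
have dj : [disjoint support s1 & support s2].
  by apply: disjointWl (rotn_support r1) _; apply: disjointWr (rotn_support r2) _.
have [+ _] := maxcyc_disjoint' dj.
rewrite (unlinked_fib xW1 r1) (kapE xW1 yW1 r1) (kapE xW2 yW2 r2) /=.
have al : altopt s1 = false.
  by apply: contraFF (unlinked_fib xW1 r1); exact: altopt_linked'.
rewrite al /=; have [c rc ->] := maxcyc_ex dcol x y (s1 * s2).
rewrite (cyc_fullrot (fullrot_join xW1 yW1 W2E r1 r2 rc)) -!addnn; clear; lia.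
Qed.

Section OneSide.
Variable E : {set {set T}}.
Hypotheses (in1 : inside E (W1 :|: e)).

(** A single side is treated as a sum whose second side has no edges; that factor is unlinked, hence
    the 2. *)
Let psi_ok s1 s2 : rotn dcol (fib W1) s1 -> rotn dcol (fib W2) s2 ->
  maxcyc (alpha E * s1 * (alpha set0 * s2)) + K0 + 2 =
  maxcyc (alpha E * s1) + kap W2 /\
  altopt (alpha E * s1 * (alpha set0 * s2)) = altopt (alpha E * s1).
Proof.
move=> r1 r2.
have in2 : inside set0 (W2 :|: e) by move=> u v; rewrite inE.
have dj0 : [disjoint E & set0] by rewrite -setI_eq0 setI0.
have dj := psi_disjoint xW1 yW1 W2E in1 in2 dj0 r1 r2.
have [+ ->] := maxcyc_disjoint' dj; rewrite alpha0 mul1g.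
rewrite (unlinked_fib xW2 r2) andbF (kapE xW2 yW2 r2).
have al : altopt s2 = false.
  by apply: contraFF (unlinked_fib xW2 r2); exact: altopt_linked'.
rewrite al andbF addbF -!addnn /= => h; split; last by [].
by move: h; clear; lia.
Qed.

Lemma side_ge s1 : rotn dcol (fib W1) s1 ->
  maxcyc (alpha E * s1) + kap W2 <= Zmax E + K0 + 2.
Proof.
move=> r1; have [s2 r2] := rotn_exists dcol (fib W2).
have in2 : inside set0 (W2 :|: e) by move=> u v; rewrite inE.
have dj0 : [disjoint E & set0] by rewrite -setI_eq0 setI0.
have := Zsplit_ge xW1 yW1 W2E in2 dj0 r1 r2; rewrite setU0.
have [+ _] := psi_ok r1 r2.
set a := maxcyc (_ * _ * _); set b := maxcyc _; clear; lia.
Qed.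

Lemma side_ex : exists2 s1, rotn dcol (fib W1) s1 &
  maxcyc (alpha E * s1) + kap W2 = Zmax E + K0 + 2.
Proof.
have in2 : inside set0 (W2 :|: e) by move=> u v; rewrite inE.
have dj0 : [disjoint E & set0] by rewrite -setI_eq0 setI0.
have [s1 [s2 [r1 r2]]] := Zsplit_ex xW1 yW1 W2E in2 dj0.
by rewrite setU0 => <-; exists s1 => //; have [h _] := psi_ok r1 r2.
Qed.

Lemma side_alt : altE x y E <-> exists s1, [/\ rotn dcol (fib W1) s1,
  maxcyc (alpha E * s1) + kap W2 = Zmax E + K0 + 2 & altopt (alpha E * s1)].
Proof.
have in2 : inside set0 (W2 :|: e) by move=> u v; rewrite inE.
have dj0 : [disjoint E & set0] by rewrite -setI_eq0 setI0.
have := Zsplit_alt xW1 yW1 W2E in2 dj0; rewrite setU0 => h.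
split=> [/h[s1 [s2 [r1 r2 e1 al]]]|[s1 [r1 e1 al]]].
  have [h1 h2] := psi_ok r1 r2; exists s1; rewrite -e1 -h1 -h2.
  by split; [exact: r1| |exact: al].
have [s2 r2] := rotn_exists dcol (fib W2); have [h1 h2] := psi_ok r1 r2.
apply/h; exists s1, s2; split; [exact: r1|exact: r2| |by rewrite h2].
by apply: (@addIn (K0 + 2)); rewrite !addnA h1 e1.
Qed.

(** Serves to show that a choice on one side which is not optimal falls short by at least two. *)
Lemma side_parity s s' : rotn dcol (fib W1) s -> rotn dcol (fib W1) s' ->
  odd (maxcyc (alpha E * s)) = odd (maxcyc (alpha E * s')).
Proof.
move=> r r'; have [c rc ->] := maxcyc_ex dcol x y (alpha E * s).
have [c' rc' ->] := maxcyc_ex dcol x y (alpha E * s').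
rewrite !(odd_cyc_rot xy x0X y0Y) // !odd_permM; congr ((_ (+) _) (+) _).
by have := rotn_cyc r' r; rewrite /odd_perm /cyc => ->.
Qed.
End OneSide.

Section OneSidePlus.
Variable E : {set {set T}}.
Hypotheses (in1 : inside E (W1 :|: e)) (eE : e \notin E).

Lemma inside_plus : inside (e |: E) (W1 :|: e).
Proof.
move=> u v; rewrite in_setU1 => /orP[/eqP uv|/in1//].
by rewrite inE -uv set21 orbT.
Qed.

Lemma support_psi s d : rotn dcol (fib W1) s -> d \in support (alpha E * s) ->
  d.1 \in W1 \/ alpha E d != d.
Proof.
move=> rs; rewrite inE permM; case: (alpha E d =P d) => [->|]; last by right.
move=> h; left; have := subsetP (rotn_support rs) d.
by rewrite !inE => /(_ h).
Qed.

Lemma alpha_terminal : alpha E (x, y) = (x, y) /\ alpha E (y, x) = (y, x).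
Proof. by rewrite !alphaE (setUC [set y]) (negPf eE). Qed.

(** The edge xy becomes a disjoint factor of its own, so [maxcyc_disjoint] also describes its
    addition. *)
Lemma alpha_plus s : rotn dcol (fib W1) s ->
  alpha (e |: E) * s = alpha E * s * t /\
  [disjoint support (alpha E * s) & support t].
Proof.
move=> rs; have [a1 a2] := alpha_terminal.
have dj : [disjoint support (alpha E * s) & support t].
  rewrite -setI_eq0; apply/eqP/setP=> d; rewrite in_set0 in_setI.
  apply/negP => /andP[/(support_psi rs) h]; rewrite inE.
  case: tpermP => [ed|ed|]; rewrite ?eqxx // => _; move: h; rewrite ed ?a1 ?a2;
  by case=> [h|]; rewrite ?eqxx //; move: xW1 yW1; rewrite /= in h; rewrite h.
by split=> //; rewrite (disjoint_commute dj) alphaU1 // mulgA.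
Qed.

Lemma maxcyc_t : maxcyc t = K0.+1 /\ altopt t = false.
Proof.
have nt : (x, y) != (y, x) by rewrite xpair_eqE (negPf xy).
have st : salt dcol x y t.
  move=> d; case: tpermP => [->|->|_ _]; last by rewrite eqxx.
    by split; [rewrite in_A eqxx | rewrite eq_sym].
  by split; [rewrite in_A eqxx orbT | exact: xy].
have t1 : t != 1.
  by apply/eqP => /permP/(_ (x, y)); rewrite tpermL perm1 => -[e1 _];
    move: xy; rewrite e1 eqxx.
have ht : half dcol x t = [set (x, y)].
  apply/setP=> d; rewrite !inE; case: tpermP => [->|->|n1 n2] /=.
  - by rewrite eqxx eq_sym nt eqxx.
  - by rewrite !xpair_eqE (eq_sym y) (negPf xy).
  by rewrite eqxx andbF; apply/esym/eqP.
have [h ->] := maxcyc_salt xy x0X y0Y st t1; move: h.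
rewrite /altpar ht cards1 odd_tperm nt /= => h; split; last by [].
by move: h; clear; lia.
Qed.

Lemma linked_t : linked t.
Proof.
apply/linkedP; exists (x, y), (y, x); split; rewrite ?inE //.
by have := coorb_step t (x, y); rewrite tpermL.
Qed.

(** The factor [t] is linked and has no gap, so only the linkedness of the side itself matters. *)
Lemma plus_maxcyc s : rotn dcol (fib W1) s ->
  [/\ maxcyc (alpha (e |: E) * s) + (~~ linked (alpha E * s)).*2 =
      (maxcyc (alpha E * s)).+1,
      altopt (alpha (e |: E) * s) = altopt (alpha E * s) &
      linked (alpha (e |: E) * s)].
Proof.
move=> rs; have [-> dj] := alpha_plus rs.
have [+ ->] := maxcyc_disjoint' dj; have [-> ->] := maxcyc_t.
rewrite linked_t andbT andbF addbF => h; split.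
- by move: h; clear; lia.
- by [].
apply/linkedP; exists (x, y), (y, x); split; rewrite ?inE //.
have := coorb_step (alpha E * s * t) (x, y).
have fx : (alpha E * s) (x, y) = (x, y).
  have [a1 _] := alpha_terminal; rewrite permM a1.
  apply/supportP; apply: contra xW1 => /(subsetP (rotn_support rs)).
  by rewrite inE.
by rewrite permM fx tpermL.
Qed.

(** An alternating side is linked, so adding xy raises its number of cycles by one; as [Zmax] cannot
    rise by more, the choice stays optimal. Conversely, when [Zmax] rises, removing xy from an
    alternating optimum leaves an optimum. *)
Lemma altE_plus : altE x y E =
  (Zmax (e |: E) == (Zmax E).+1) && altE x y (e |: E).
Proof.
have in1p := inside_plus.
apply/idP/andP => [/(side_alt in1)[s [rs es al]]|[/eqP ez /(side_alt in1p)]].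
  have [h1 h2 h3] := plus_maxcyc rs.
  rewrite (altopt_linked' al) /= in h1.
  have ge := side_ge in1p rs.
  have ez : Zmax (e |: E) = (Zmax E).+1.
    by case: (Zmax_add eE xy) => //; move: ge h1 es; clear; lia.
  split; first by rewrite ez.
  apply/(side_alt in1p); exists s; rewrite h2; split; [exact: rs| |exact: al].
  by move: ez h1 es; clear; lia.
move=> [s [rs es al]]; have [h1 h2 h3] := plus_maxcyc rs.
rewrite h2 in al; rewrite (altopt_linked' al) /= in h1.
apply/(side_alt in1); exists s; split; [exact: rs| |exact: al].
by move: ez h1 es; clear; lia.
Qed.

(** By [altopt_linked] two darts at x are moved by the side without xy, and such darts belong to
    edges of [E]. *)
Lemma altE_deg : altE x y (e |: E) -> 1 < #|[set v | [set x; v] \in E]|.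
Proof.
move/(side_alt inside_plus) => [s [rs _]]; have [_ -> _] := plus_maxcyc rs.
case/(altopt_linked xy x0X y0Y)=> _; move/leq_trans; apply.
rewrite -(card_imset [set v | [set x; v] \in E] (f := fun v => (x, v))); last first.
  by move=> a b [].
apply: subset_leq_card; apply/subsetP=> -[u v]; rewrite inE => /andP[sd].
rewrite inE /= => /eqP ux; rewrite {u}ux in sd *; apply: imset_f.
case: (support_psi rs sd) => [/= h|/alpha_mem]; last by rewrite inE.
by move: xW1; rewrite h.
Qed.
End OneSidePlus.
End Side.
End Zformulas.

Lemma leq_same_parity a b : odd a = odd b -> a < b -> a.+2 <= b.
Proof. by move=> ab; rewrite leq_eqVlt => /orP[/eqP ba|//]; move: ab; rewrite -ba /=; case: odd. Qed.

(** * Maximal numbers of faces of a sum at x and y *)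

Section TwoSides.
Variables (T : finType) (x y : T) (W1 W2 : {set T}).
Local Notation D := (T * T)%type.
Local Notation dcol := (@fst T T).
Hypotheses (xy : x != y) (xW1 : x \notin W1) (yW1 : y \notin W1).
Hypothesis W2E : W2 = ~: (W1 :|: [set x; y]).
Local Notation maxcyc := (maxcyc dcol x y).
Local Notation altopt := (altopt dcol x y).
Local Notation linked := (linked dcol x y).
Local Notation K0 := (ncyc0 dcol x y).
Local Notation e := [set x; y].
Variables E1 E2 : {set {set T}}.
Hypotheses (in1 : inside E1 (W1 :|: e)) (in2 : inside E2 (W2 :|: e)).
Hypotheses (eE1 : e \notin E1) (eE2 : e \notin E2) (djE : [disjoint E1 & E2]).

Let xW2 : x \notin W2. Proof. by rewrite W2E !inE eqxx orbT. Qed.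
Let yW2 : y \notin W2. Proof. by rewrite W2E !inE eqxx !orbT. Qed.
Let W1E : W1 = ~: (W2 :|: e).
Proof.
apply/setP=> u; rewrite W2E !inE.
case: (u =P x) => [->|_]; first by rewrite (negPf xW1) orbT.
case: (u =P y) => [->|_]; first by rewrite (negPf yW1) !orbT.
by rewrite !orbF negbK.
Qed.
Let Z1 := Zmax E1. Let Z2 := Zmax E2.
Let Z1p := Zmax (e |: E1). Let Z2p := Zmax (e |: E2).
Let a1 := altE x y (e |: E1). Let a2 := altE x y (e |: E2).
Local Notation rot1 := (rotn dcol (fib W1)).
Local Notation rot2 := (rotn dcol (fib W2)).
Let psi1 s := alpha E1 * s. Let psi2 s := alpha E2 * s.

Let ksum : kap x y W1 + kap x y W2 = nverts T + K0 + 2.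
Proof. exact: kap_sum. Qed.

Let M12 s1 s2 : rot1 s1 -> rot2 s2 ->
  maxcyc (psi1 s1 * psi2 s2) + K0 + (~~ (linked (psi1 s1) && linked (psi2 s2))).*2 =
    maxcyc (psi1 s1) + maxcyc (psi2 s2) + (altopt (psi1 s1) && altopt (psi2 s2)).*2.
Proof.
move=> r1 r2; have dj := psi_disjoint xW1 yW1 W2E in1 in2 djE r1 r2.
by have [-> _] := maxcyc_disjoint' xy dj.
Qed.

Lemma Zsum_h0_ge : Z1 + Z2 <= Zmax (E1 :|: E2) + nverts T.
Proof.
have [s1 r1 e1] := side_ex xy xW1 yW1 W2E in1.
have [s2 r2 e2] := side_ex xy xW2 yW2 W1E in2.
have := Zsplit_ge xW1 yW1 W2E in2 djE r1 r2; have := M12 r1 r2.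
move: e1 e2 ksum; rewrite -!addnn -/Z1 -/Z2 -/(psi1 s1) -/(psi2 s2).
case: (linked (psi1 s1) && _); case: (altopt _ && _) => /=; clear; lia.
Qed.

(** The correction by two is then present for every choice and no gap can occur on the first side,
    so the two sides are optimised separately. *)
Lemma Zsum_unlinked : (forall s1, rot1 s1 -> ~~ linked (psi1 s1)) ->
  [/\ Zmax (E1 :|: E2) + nverts T = Z1 + Z2, a1 = false & Z1 = Z1p.+1].
Proof.
move=> nl; split.
- apply/eqP; rewrite eqn_leq Zsum_h0_ge andbT.
  have [s1 [s2 [r1 r2 e12]]] := Zsplit_ex xW1 yW1 W2E in2 djE.
  have g1 := side_ge xy xW1 yW1 W2E in1 r1; have g2 := side_ge xy xW2 yW2 W1E in2 r2.
  have := M12 r1 r2; rewrite (negPf (nl _ r1)) /=.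
  have -> : altopt (psi1 s1) = false.
    by apply: contraNF (nl _ r1); exact: altopt_linked'.
  move: e12 g1 g2 ksum; rewrite -!addnn -/Z1 -/Z2 -/(psi1 s1) -/(psi2 s2) /=.
  by clear; lia.
- case a1E: a1 => //; have /(side_alt xy xW1 yW1 W2E (inside_plus in1)) := a1E.
  move=> [s1 [r1 _ al]]; have [_ h _] := plus_maxcyc xy xW1 yW1 eE1 r1; rewrite h in al.
  by have := nl _ r1; rewrite (altopt_linked' xy al).
have in1p := inside_plus in1.
have [s1 r1 e1] := side_ex xy xW1 yW1 W2E in1p.
have [+ _ _] := plus_maxcyc xy xW1 yW1 eE1 r1; rewrite (negPf (nl _ r1)) -addnn /=.
have := side_ge xy xW1 yW1 W2E in1 r1; move: e1.
have := Zmax_add eE1 xy; rewrite -/Z1 -/Z1p; clear; lia.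
Qed.

Let in1p : inside (e |: E1) (W1 :|: e). Proof. exact: inside_plus. Qed.
Let in2p : inside (e |: E2) (W2 :|: e). Proof. exact: inside_plus. Qed.
Let djEp : [disjoint e |: E1 & E2].
Proof.
rewrite -setI_eq0; apply/eqP/setP=> f; rewrite in_set0; apply/negP.
rewrite in_setI in_setU1 => /andP[/orP[/eqP->|fE]]; first by rewrite (negPf eE2).
by rewrite (disjointFr djE).
Qed.

Let M12p s1 s2 : rot1 s1 -> rot2 s2 ->
  maxcyc (alpha (e |: E1) * s1 * psi2 s2) + K0 + 1 =
    maxcyc (alpha (e |: E1) * s1) + maxcyc (alpha (e |: E2) * s2)
    + (altopt (psi1 s1) && altopt (psi2 s2)).*2.
Proof.
move=> r1 r2; have dj := psi_disjoint xW1 yW1 W2E in1p in2 djEp r1 r2.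
have [+ _] := maxcyc_disjoint' xy dj.
have [_ -> ->] := plus_maxcyc xy xW1 yW1 eE1 r1.
have [+ _ _] := plus_maxcyc xy xW2 yW2 eE2 r2.
rewrite -/(psi1 s1) -/(psi2 s2) -!addnn.
have := @altopt_linked' _ x y xy (psi2 s2).
case: (linked (psi2 s2)); case: (altopt (psi2 s2)); case: (altopt _) => /= h;
  try (by have := h isT); clear; lia.
Qed.

(** With the edge xy present linkedness plays no part in the count; the only interaction between the
    sides is the gain of two when both alternate. *)
Lemma Zsum_h1 : Zmax (e |: (E1 :|: E2)) + nverts T =
  (Z1p + Z2p + (a1 && a2).*2).+1.
Proof.
rewrite setUA; apply/eqP; rewrite eqn_leq; apply/andP; split.
  have [s1 [s2 [r1 r2 <-]]] := Zsplit_ex xW1 yW1 W2E in2 djEp.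
  have g1 := side_ge xy xW1 yW1 W2E in1p r1.
  have g2 := side_ge xy xW2 yW2 W1E in2p r2.
  have [_ b1 _] := plus_maxcyc xy xW1 yW1 eE1 r1.
  have [_ b2 _] := plus_maxcyc xy xW2 yW2 eE2 r2.
  have m := M12p r1 r2.
  (* If a side alternates only for choices that are not optimal, these lose at least two by parity,
     which pays for the gain of an alternating pair. *)
  have s1' : altopt (psi1 s1) -> ~~ a1 ->
      maxcyc (alpha (e |: E1) * s1) + kap x y W2 + 2 <= Z1p + K0 + 2.
    move=> al na; have [t rt et] := side_ex xy xW1 yW1 W2E in1p.
    have ne : maxcyc (alpha (e |: E1) * s1) + kap x y W2 <> Z1p + K0 + 2.
      move=> q; case/negP: na; apply/(side_alt xy xW1 yW1 W2E in1p).
      exists s1; rewrite b1; split; [exact: r1|exact: q|exact: al].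
    have lt : maxcyc (alpha (e |: E1) * s1) < maxcyc (alpha (e |: E1) * t).
      by move: et g1 ne; rewrite -/Z1p; clear; lia.
    have := leq_same_parity (side_parity xy (e |: E1) r1 rt) lt.
    by move: et; rewrite -/Z1p; clear; lia.
  have s2' : altopt (psi2 s2) -> ~~ a2 ->
      maxcyc (alpha (e |: E2) * s2) + kap x y W1 + 2 <= Z2p + K0 + 2.
    move=> al na; have [t rt et] := side_ex xy xW2 yW2 W1E in2p.
    have ne : maxcyc (alpha (e |: E2) * s2) + kap x y W1 <> Z2p + K0 + 2.
      move=> q; case/negP: na; apply/(side_alt xy xW2 yW2 W1E in2p).
      exists s2; rewrite b2; split; [exact: r2|exact: q|exact: al].
    have lt : maxcyc (alpha (e |: E2) * s2) < maxcyc (alpha (e |: E2) * t).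
      by move: et g2 ne; rewrite -/Z2p; clear; lia.
    have := leq_same_parity (side_parity xy (e |: E2) r2 rt) lt.
    by move: et; rewrite -/Z2p; clear; lia.
  move: m g1 g2 s1' s2' ksum; rewrite /Z1p /Z2p /psi2.
  case: (altopt (psi1 s1)) => /=; last by clear; lia.
  case: (altopt (psi2 s2)) => /=; last by clear; lia.
  case: a1 => /=; last by clear; move=> ? ? ? /(_ isT isT); lia.
  case: a2 => /=; first by clear; lia.
  by clear; move=> ? ? ? _ /(_ isT isT); lia.
have [s1 [r1 e1 h1]] : exists s1, [/\ rot1 s1,
    maxcyc (alpha (e |: E1) * s1) + kap x y W2 = Z1p + K0 + 2 &
    a1 -> altopt (psi1 s1)].
  case a1E: a1.
    have /(side_alt xy xW1 yW1 W2E in1p)[s1 [r1 e1 al]] : a1 by [].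
    by exists s1; have [_ <- _] := plus_maxcyc xy xW1 yW1 eE1 r1.
  by have [s1 r1 e1] := side_ex xy xW1 yW1 W2E in1p; exists s1.
have [s2 [r2 e2 h2]] : exists s2, [/\ rot2 s2,
    maxcyc (alpha (e |: E2) * s2) + kap x y W1 = Z2p + K0 + 2 &
    a2 -> altopt (psi2 s2)].
  case a2E: a2.
    have /(side_alt xy xW2 yW2 W1E in2p)[s2 [r2 e2 al]] : a2 by [].
    by exists s2; have [_ <- _] := plus_maxcyc xy xW2 yW2 eE2 r2.
  by have [s2 r2 e2] := side_ex xy xW2 yW2 W1E in2p; exists s2.
have := Zsplit_ge xW1 yW1 W2E in2 djEp r1 r2; have := M12p r1 r2.
move: e1 e2 ksum h1 h2; rewrite /psi2.
set M := maxcyc (_ * (alpha E2 * s2)); set Z := Zmax (e |: E1 :|: E2).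
case: a1 => [+ + + /(_ isT)->|]; last first.
  by move=> + + + _ _; case: (altopt _ && _) => /=; clear; lia.
case: a2 => [+ + + /(_ isT)->|]; last first.
  by move=> + + + _ /=; case: (altopt (psi2 s2)) => /=; clear; lia.
by move=> /=; clear; lia.
Qed.

(** If an optimal choice has an unlinked side, the sides are bounded separately. If both sides are
    linked, adding xy to the same choice gains a face, so the bound follows from [Zsum_h1]. *)
Lemma Zsum : Zmax (E1 :|: E2) + nverts T =
  maxn (Z1 + Z2) (Z1p + Z2p + (a1 && a2).*2).
Proof.
apply/eqP; rewrite eqn_leq geq_max Zsum_h0_ge /=; apply/andP; split; last first.
  have e12 : e \notin E1 :|: E2 by rewrite inE negb_or eE1.
  have := Zsum_h1; have := Zmax_add e12 xy; clear; lia.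
have [s1 [s2 [r1 r2 e12]]] := Zsplit_ex xW1 yW1 W2E in2 djE.
have m := M12 r1 r2; have mp := M12p r1 r2.
rewrite leq_max; apply/orP.
case L: (linked (psi1 s1) && linked (psi2 s2)) m; last first.
  left; have g1 := side_ge xy xW1 yW1 W2E in1 r1.
  have g2 := side_ge xy xW2 yW2 W1E in2 r2; move: m.
  have -> : altopt (psi1 s1) && altopt (psi2 s2) = false.
    by apply: contraFF L => /andP[/(altopt_linked' xy)-> /(altopt_linked' xy)->].
  move: g1 g2 ksum e12; rewrite -!addnn -/Z1 -/Z2 -/(psi1 s1) -/(psi2 s2) /=.
  by clear; lia.
move=> m; right; have [l1 l2] := andP L.
have := Zsplit_ge xW1 yW1 W2E in2 djEp r1 r2.
have [+ _ _] := plus_maxcyc xy xW1 yW1 eE1 r1.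
have [+ _ _] := plus_maxcyc xy xW2 yW2 eE2 r2.
have := Zsum_h1; rewrite setUA; move: m mp e12.
move: l1 l2; rewrite /psi1 /psi2 => -> -> /=.
case: (altopt _ && _); case: (a1 && a2) => /=;
set Z := Zmax (e |: E1 :|: E2); set M := maxcyc (alpha E1 * s1 * (alpha E2 * s2));
by set Mp := maxcyc (alpha (e |: E1) * s1 * (alpha E2 * s2)); clear; lia.
Qed.
End TwoSides.

(** * Components *)

Lemma connect_min (T : finType) (e r : rel T) :
  reflexive r -> transitive r -> subrel e r -> subrel (connect e) r.
Proof.
move=> rr rt er u v /connectP[p]; elim: p u => [|w p IH] u /=.
  by move=> _ ->.
by case/andP=> /er uw /IH h /h; apply: rt.
Qed.

Section Comps.
Variable T : finType.
Implicit Types (E F : {set {set T}}) (W V : {set T}) (u v a b x y : T).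
Implicit Types (s : {perm T * T}).

Definition eadj E : rel T := fun u v => [set u; v] \in E.
Definition conn E := connect (eadj E).

Lemma eadj_sym E : symmetric (eadj E).
Proof. by move=> u v; rewrite /eadj setUC. Qed.
Lemma conn_sym E u v : conn E u v = conn E v u.
Proof. by apply: sym_connect_sym u v; apply: eadj_sym. Qed.
Lemma conn_refl E u : conn E u u. Proof. exact: connect0. Qed.
Lemma conn_trans E : transitive (conn E).
Proof. exact: connect_trans. Qed.
Lemma conn_edge E u v : [set u; v] \in E -> conn E u v.
Proof. exact: connect1. Qed.
Lemma conn_sub E F u v : E \subset F -> conn E u v -> conn F u v.
Proof.
move=> EF; apply: connect_sub => a b ab; apply: conn_edge.
exact: subsetP EF _ ab.
Qed.

Definition cclass E u := [set v | conn E u v].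
(** All of [T] is counted, so that vertices outside a graph are singleton components; [nverts]
    compensates for them in the formulas. *)
Definition ncomp E := #|[set cclass E u | u in T]|.

Lemma cclass_eq E u v : (cclass E u == cclass E v) = conn E u v.
Proof.
apply/eqP/idP => [/setP/(_ v)|uv]; first by rewrite !inE conn_refl.
apply/setP=> w; rewrite !inE; apply/idP/idP; apply: conn_trans => //.
by rewrite conn_sym.
Qed.

(** With components represented as cycles, adding an edge falls under the results on multiplication
    by a transposition. *)
Lemma conn_perm E : exists s : {perm T}, forall a b, coorb s a b = conn E a b.
Proof.
have [s rs] := rotn_exists (cclass E) setT; exists s => a b.
rewrite (rotn_coorbE _ _ rs) !inE /= cclass_eq.
by case: eqP => [->|]; rewrite ?conn_refl.
Qed.

Lemma ncomp_cyc E (s : {perm T}) : (forall a b, coorb s a b = conn E a b) ->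
  ncomp E = cyc s.
Proof.
move=> h; rewrite /ncomp /cyc /porbits; congr #|pred_of_set _|.
by apply: eq_imset => a; apply/setP=> b; rewrite inE -h.
Qed.

Lemma conn_add E u v a b : conn ([set u; v] |: E) a b =
  [|| conn E a b, conn E a u && conn E v b | conn E a v && conn E u b].
Proof.
apply/idP/idP.
  have [s hs] := conn_perm E.
  pose r c d := [|| conn E c d, conn E c u && conn E v d | conn E c v && conn E u d].
  case uv: (conn E u v).
    move=> ab; suff -> : conn E a b by [].
    move: a b ab; apply: connect_min; [exact: conn_refl|exact: conn_trans|].
    move=> a b; rewrite /eadj in_setU1 => /orP[/eqP/set2_inj[][-> ->]//|].
      by rewrite conn_sym.
    exact: conn_edge.
  have rE c d : r c d = coorb (s * tperm u v) c d.
    by rewrite coorb_merge ?hs ?uv // /r !hs.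
  move: a b; apply: (connect_min (r := r)).
  - by move=> c; rewrite rE coorb_refl.
  - by move=> c d f; rewrite !rE; apply: coorb_trans.
  move=> a b; rewrite /eadj in_setU1 => /orP[/eqP/set2_inj[][-> ->]|ab].
  - by rewrite /r !conn_refl orbT.
  - by rewrite /r !conn_refl !orbT.
  by rewrite /r conn_edge.
have sub : E \subset [set u; v] |: E by apply: subsetUr.
have uv : conn ([set u; v] |: E) u v by apply: conn_edge; rewrite setU11.
case/or3P => [/(conn_sub sub)//|/andP[/(conn_sub sub) h1 /(conn_sub sub) h2]
  |/andP[/(conn_sub sub) h1 /(conn_sub sub) h2]]; apply: conn_trans h1 _.
  exact: conn_trans uv h2.
by apply: conn_trans h2; rewrite conn_sym.
Qed.

Lemma ncomp_add E u v :
  ncomp ([set u; v] |: E) + ~~ conn E u v = ncomp E.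
Proof.
have [s hs] := conn_perm E; rewrite (ncomp_cyc hs).
case uv: (conn E u v).
  rewrite addn0; apply: ncomp_cyc => a b; rewrite conn_add hs.
  apply/idP/or3P => [h|[//|/andP[h1 h2]|/andP[h1 h2]]]; first by constructor.
    exact: conn_trans h1 (conn_trans uv h2).
  by apply: conn_trans h1 (conn_trans _ h2); rewrite conn_sym.
rewrite addn1 (@cyc_merge _ s u v) ?hs ?uv //; congr _.+1.
by apply: ncomp_cyc => a b; rewrite coorb_merge ?hs ?uv // conn_add ?hs.
Qed.

Lemma ncomp0 : ncomp set0 = nverts T.
Proof.
rewrite (@ncomp_cyc _ 1) ?cyc1 // => a b.
rewrite coorb_fix ?perm1 //; apply/idP/idP => [/eqP->|]; first exact: conn_refl.
move: a b; apply: (connect_min (r := fun a b => a == b)) => //.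
  by move=> c a b /eqP->.
by move=> a b; rewrite /eadj inE.
Qed.

Definition simple E := [forall e in E, #|e| == 2].

Lemma simpleP E : reflect (forall e, e \in E -> #|e| == 2) (simple E).
Proof. exact: forall_inP. Qed.

Lemma simple_ind (P : {set {set T}} -> Prop) :
  P set0 ->
  (forall E u v, u != v -> [set u; v] \notin E -> simple ([set u; v] |: E) ->
     P E -> P ([set u; v] |: E)) ->
  forall E, simple E -> P E.
Proof.
move=> P0 PS E; have [n] := ubnP #|E|; elim: n E => // n IH E lt sE.
have [e0|/set0Pn[e eE]] := eqVneq E set0; first by rewrite e0.
have /simpleP/(_ e eE)/cards2P[u [v [uv ee]]] := sE.
have EE : E = [set u; v] |: (E :\ e) by rewrite -ee setD1K.
rewrite EE; apply: PS uv _ _ _; [by rewrite -ee setD11|by rewrite -EE|].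
apply: IH; first by have := cardsD1 e E; rewrite eE; move: lt; clear; lia.
by apply/simpleP => f; rewrite !inE => /andP[_]; apply/simpleP.
Qed.

Lemma simple_sub E F : F \subset E -> simple E -> simple F.
Proof. by move=> FE /simpleP h; apply/simpleP => e /(subsetP FE)/h. Qed.

Lemma coorb_conn E s p q : (forall d, (s d).1 = d.1) ->
  coorb (alpha E * s) p q -> conn E p.1 q.1.
Proof.
move=> hs h; pattern q; apply: (coorb_ind h); first exact: conn_refl.
move=> [u v] IH; apply: conn_trans IH _; rewrite permM hs alphaE.
by case: ifP => [/conn_edge|] //= _; apply: conn_refl.
Qed.

(** Euler's inequality, by adding edges one at a time: each changes the number of cycles by one, and
    an edge between two components must merge cycles, since a cycle stays in one component. *)
Lemma cyc_alpha_bound E s : (forall d, (s d).1 = d.1) -> simple E ->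
  cyc (alpha E * s) + (nverts T).*2 <= cyc s + #|E| + (ncomp E).*2 /\
  odd (cyc (alpha E * s)) = odd (cyc s + #|E|).
Proof.
move=> hs; move: E; apply: simple_ind.
  rewrite alpha0 mul1g ncomp0 cards0 -!addnn; split; last by rewrite addn0.
  by clear; lia.
move=> E u v uv uvE _ [IH1 IH2].
have := ncomp_add E u v; rewrite alphaU1 // cardsU1 uvE /=.
have e := cyc_tpermM (alpha E * s) (u, v) (v, u).
rewrite -mulgA; set N := cyc (_ * (_ * _)).
have {e} : N + (~~ coorb (alpha E * s) (u, v) (v, u)).*2 = cyc (alpha E * s) + 1.
  by rewrite e xpair_eqE (negPf uv).
move=> e e2; have oN : odd N = odd (cyc s + (1 + #|E|)).
  have := congr1 odd e; rewrite !oddD odd_double IH2 !oddD /= addbF => ->.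
  by case: (odd (cyc s)); case: (odd #|E|).
split=> //; move: IH1 e e2; rewrite -!addnn.
case cuv: (conn E u v); first by case: (coorb _ _ _) => /=; clear; lia.
have -> : coorb (alpha E * s) (u, v) (v, u) = false.
  by apply: contraFF cuv => /(coorb_conn hs).
by rewrite /=; clear; lia.
Qed.

End Comps.

(** * Components of a sum *)

Section UnionComps.
Variables (T : finType) (x y : T) (W1 W2 : {set T}).
Hypotheses (xy : x != y) (xW1 : x \notin W1) (yW1 : y \notin W1).
Hypothesis W2E : W2 = ~: (W1 :|: [set x; y]).
Local Notation e := [set x; y].
Variable E1 : {set {set T}}.
Hypothesis in1 : inside E1 (W1 :|: e).

(** All that the second side can notice of [E1]: whether it joins x to y. *)
Definition shortcut : {set {set T}} := if conn E1 x y then [set e] else set0.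

Lemma insideR (E : {set {set T}}) W u v :
  inside E W -> [set u; v] \in E -> u \in W /\ v \in W.
Proof. by move=> h uv; split; [exact: h uv|rewrite setUC in uv; exact: h uv]. Qed.

Lemma conn_union_in (E2 : {set {set T}}) a b : inside E2 (W2 :|: e) ->
  a \in W2 :|: e -> b \in W2 :|: e ->
  conn (E1 :|: E2) a b = conn (E2 :|: shortcut) a b.
Proof.
move=> in2 aW bW; apply/idP/idP; last first.
  move: a b {aW bW}; apply: connect_min; [exact: conn_refl|exact: conn_trans|].
  move=> a b; rewrite /eadj in_setU => /orP[ab|].
    by apply: conn_edge; rewrite inE ab orbT.
  rewrite /shortcut; case: ifP => [xy1|]; rewrite !inE // => /eqP/set2_inj.
  have := conn_sub (subsetUl E1 E2) xy1.
  by move=> h [[-> ->]|[-> ->]] //; rewrite conn_sym.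
set G := E2 :|: shortcut.
(* Invariant along a walk from [a]: on the second side the current vertex is reached within [G], and
   inside [W1] some terminal reached within [G] is joined to it by [E1]. *)
pose R t := (t \in W2 :|: e -> conn G a t) /\
  (t \in W1 -> exists2 z, z \in e & conn G a z && conn E1 z t).
have W12 t : t \in W1 -> t \in W2 :|: e -> False.
  move=> tW; rewrite W2E !inE tW /=.
  by case/orP=> /eqP tz; move: tW; rewrite tz ?(negPf xW1) ?(negPf yW1).
have step t t' : eadj (E1 :|: E2) t t' -> R t -> R t'.
  rewrite /eadj in_setU => /orP[tt [r1 r2]|tt [r1 _]]; last first.
    have [tW tW'] := insideR in2 tt; split=> [_|/W12/(_ tW')//].
    apply: conn_trans (r1 tW) _; apply: conn_edge.
    by rewrite in_setU tt.
  have [tW tW'] := insideR in1 tt.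
  have [z ze /andP[az zt]] : exists2 z, z \in e & conn G a z && conn E1 z t.
    move: (tW); rewrite in_setU => /orP[/r2//|te]; exists t => //.
    by rewrite conn_refl andbT r1 // in_setU te orbT.
  have zt' : conn E1 z t' by apply: conn_trans zt (conn_edge tt).
  split=> [t'W|_]; last by exists z => //; rewrite az.
  have t'e : t' \in e.
    by move: tW'; rewrite in_setU => /orP[/W12/(_ t'W)|].
  apply: conn_trans az _.
  have sc : conn E1 x y -> conn G x y.
    by move=> c; apply: conn_edge; rewrite /G /shortcut c !inE eqxx orbT.
  move: ze t'e zt'; rewrite !inE => /orP[]/eqP-> /orP[]/eqP->;
    rewrite ?(conn_refl G) //.
  by rewrite conn_sym (conn_sym G); exact: sc.
have Ra : R a by split=> [_|/W12/(_ aW)//]; apply: conn_refl.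
move=> ab; suff [h _] : R b by apply: h.
move: {aW bW} ab Ra.
pose r t t' := R t -> R t'.
have : forall p t, path (eadj (E1 :|: E2)) t p -> R t -> R (last t p).
  by elim=> [|w p IH] t //= /andP[tw pw] /(step _ _ tw)/(IH _ pw).
by move=> h /connectP[p pp ->]; exact: h.
Qed.

Lemma ncomp_union_shortcut (E2 : {set {set T}}) : simple E2 -> inside E2 (W2 :|: e) ->
  ncomp (E1 :|: E2) + ncomp shortcut = ncomp E1 + ncomp (E2 :|: shortcut).
Proof.
move: E2; apply: simple_ind => [_|E u v uv _ _ IH in2].
  by rewrite setU0 set0U.
have inE' : inside E (W2 :|: e).
  by move=> a b ab; apply: (in2 a b); rewrite in_setU1 ab orbT.
have [uW vW] := insideR in2 (setU11 _ _).
have := ncomp_add (E1 :|: E) u v; have := ncomp_add (E :|: shortcut) u v.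
rewrite (setUCA E1) -(setUA _ E) (conn_union_in inE' uW vW).
have := IH inE'; set a := ncomp (_ |: (E1 :|: E)).
set b := ncomp (_ |: (E :|: shortcut)); set c := ncomp (E1 :|: E).
by set d := ncomp (E :|: shortcut); set f := conn _ u v; clear; lia.
Qed.

Lemma ncomp_pair : ncomp [set e] + 1 = nverts T.
Proof.
have := ncomp_add set0 x y; rewrite setU0 ncomp0.
have -> : conn set0 x y = false; last by [].
apply/negP => /connectP[[|w p] /=]; first by move=> _ ex; move: xy; rewrite ex eqxx.
by rewrite /eadj inE.
Qed.

Lemma ncomp_union (E2 : {set {set T}}) : simple E2 -> inside E2 (W2 :|: e) ->
  ncomp (E1 :|: E2) + nverts T =
  ncomp E1 + ncomp E2 + (conn E1 x y && conn E2 x y).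
Proof.
move=> s2 in2; have := ncomp_union_shortcut s2 in2; rewrite /shortcut.
case: ifP => _; last by rewrite setU0 ncomp0 addn0.
have := ncomp_pair; have := ncomp_add E2 x y; rewrite (setUC [set e]).
set a := ncomp (E1 :|: E2); set b := ncomp (E2 :|: [set e]).
by case: (conn E2 x y) => /=; clear; lia.
Qed.

Lemma conn_union (E2 : {set {set T}}) : inside E2 (W2 :|: e) ->
  conn (E1 :|: E2) x y = conn E1 x y || conn E2 x y.
Proof.
move=> in2; rewrite (conn_union_in in2) ?inE ?eqxx ?orbT // /shortcut.
case: ifP => _; last by rewrite setU0.
by apply: conn_edge; rewrite !inE eqxx orbT.
Qed.
End UnionComps.

(** * From padded to honest rotation systems *)

Section Pad.
Variables (D : finType) (C : finType) (col : D -> C) (x y : C).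
Hypothesis xy : x != y.
Implicit Types (A B : {set D}) (s a u : {perm D}).
Local Notation alt := (alt (colset col x) (colset col y)).

Lemma removable_col u p : col (u p) = col p ->
  removable (colset col x) (colset col y) u p.
Proof.
move=> e; rewrite /removable !inE e; case: (col p == x) => //=.
by case: (col p == y).
Qed.

(** The new dart [p], fixed by [a], is a half-edge. If its vertex has darts already, it is inserted
    next to one of them and its trivial cycle disappears; at a new vertex it stays a cycle of its
    own. *)
Lemma pad_up1 A s a p : p \notin A -> support a \subset A -> rotn col A s ->
  exists s', [/\ rotn col (p |: A) s', alt (a * s') = alt (a * s) &
   cyc (a * s') + #|p |: A| + #|col @: A| =
   cyc (a * s) + #|A| + #|col @: (p |: A)|].
Proof.
move=> pA sa rs; have ks := rotn_kperm rs.
have ap : a p = p by apply/supportP; apply: contra pA; apply: subsetP.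
have sp : s p = p by apply: out_perm (kperm_on ks) pA.
have imU : col @: (p |: A) = col p |: col @: A by rewrite imsetU1.
have sub c : kperm col A c -> kperm col (p |: A) c.
  move=> /andP[oc cc]; rewrite /kperm cc andbT.
  exact: subset_trans oc (subsetUr _ _).
rewrite imU !cardsU1 pA; case: (boolP (col p \in col @: A)) => [/imsetP[q qA e]|nc] /=.
  have pq : p != q by apply: contraNneq pA => ->.
  have np : ~~ coorb s p q by rewrite coorb_fix.
  exists (s * tperm p q); split.
  - apply: rotnP.
      apply: kpermM (sub _ ks) _; apply: kperm_tperm => //.
        by rewrite setU11.
      by rewrite setU1r.
    move=> b c; rewrite !in_setU1 => /orP[/eqP->|bA] /orP[/eqP->|cA] ebc.
    + exact: coorb_refl.
    + by rewrite coorb_merge // coorb_refl (rotn_coorb rs qA cA) ?orbT // -e.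
    + rewrite coorb_merge // (rotn_coorb rs bA qA) ?coorb_refl ?orbT //.
      by rewrite ebc.
    by apply: coorb_merge_sub => //; apply: rotn_coorb rs bA cA ebc.
  - rewrite mulgA -[in RHS](mulg_tpermK (a * s) p q).
    have up : (a * s * tperm p q) p = q by rewrite !permM ap sp tpermL.
    rewrite -{3}up -/(bypass _ p) alt_bypass //; first exact: colset_disj.
    by apply: removable_col; rewrite up e.
  have -> : cyc (a * s) = (cyc (a * (s * tperm p q))).+1.
    by rewrite mulgA; apply: cyc_merge; rewrite coorb_fix // permM ap.
  by clear; lia.
exists s; split=> //; last by clear; lia.
apply: (rotnP (sub _ ks)) => b c; rewrite !in_setU1.
move=> /orP[/eqP->|bA] /orP[/eqP->|cA] ebc; first exact: coorb_refl.
- by case/negP: nc; rewrite ebc imset_f.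
- by case/negP: nc; rewrite -ebc imset_f.
exact: rotn_coorb rs bA cA ebc.
Qed.

Lemma pad_down1 A s' a p : p \notin A -> support a \subset A ->
  rotn col (p |: A) s' ->
  exists s, [/\ rotn col A s, alt (a * s') = alt (a * s) &
   cyc (a * s') + #|p |: A| + #|col @: A| =
   cyc (a * s) + #|A| + #|col @: (p |: A)|].
Proof.
move=> pA sa rs; have ks := rotn_kperm rs.
have ap : a p = p by apply/supportP; apply: contra pA; apply: subsetP.
have up : (a * s') p = s' p by rewrite permM ap.
have E : a * bypass s' p = bypass (a * s') p by rewrite /bypass up mulgA.
have fx d : d != p -> s' d != p -> bypass s' p d = s' d.
  by move=> dp sdp; rewrite bypassE (negPf dp) (negPf sdp).
exists (bypass s' p); split.
- apply: rotnP.
    apply/andP; split.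
      apply/subsetP=> d; rewrite inE bypassE; case: (d =P p) => [->|/eqP dp].
        by rewrite eqxx.
      apply: contraR => dA; have sd : s' d = d.
        by apply: out_perm (kperm_on ks) _; rewrite in_setU1 negb_or dp.
      by rewrite sd (negPf dp).
    apply/forallP=> d; rewrite bypassE; case: (d =P p) => [->|_] //.
    case: (s' d =P p) => [e|_]; last by rewrite (kperm_col d ks).
    by rewrite (kperm_col p ks) -(kperm_col d ks) e.
  move=> b c bA cA e; rewrite coorb_bypass.
  - by apply: (rotn_coorb rs) => //; rewrite in_setU1 ?bA ?cA orbT.
  - by apply: contraNneq pA => <-.
  by apply: contraNneq pA => <-.
- rewrite E alt_bypass //; first exact: colset_disj.
  by apply: removable_col; rewrite up (kperm_col p ks).
rewrite E cyc_bypass up imsetU1 !cardsU1 pA.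
have -> : (s' p != p) = (col p \in col @: A).
  apply/idP/imsetP => [np|[q qA e]].
    exists (s' p); last by rewrite (kperm_col p ks).
    have : s' p \in p |: A by rewrite (perm_closed _ (kperm_on ks)) setU11.
    by rewrite in_setU1 (negPf np).
  have co : coorb s' p q.
    by apply: (rotn_coorb rs) => //; rewrite in_setU1 ?eqxx ?qA ?orbT.
  apply: contraTneq co => sp; rewrite coorb_fix //.
  by apply: contraNneq pA => ->.
by case: (_ \in _) => /=; clear; lia.
Qed.

(** The change in the number of cycles depends on the dart sets only, so padding preserves
    optimality. *)
Definition padded A B a s s' := alt (a * s') = alt (a * s) /\
  cyc (a * s') + #|B| + #|col @: A| = cyc (a * s) + #|A| + #|col @: B|.

Lemma pad_ind A (P : {set D} -> Prop) :
  P A -> (forall B p, p \notin B -> A \subset B -> P B -> P (p |: B)) -> P setT.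
Proof.
move=> PA PS; have [n] := ubnP #|~: A|; elim: n A PA PS => // n IH A PA PS lt.
case: (pickP (mem (~: A))) => [p /=|none]; last first.
  by rewrite (_ : setT = A) //; apply/setP=> p; have := none p; rewrite !inE => /negbFE.
rewrite inE => pA; apply: (IH (p |: A)).
- exact: PS.
- by move=> B q qB /(subset_trans (subsetUr _ _)); apply: PS.
have := cardsD1 p (~: A); rewrite inE pA /=.
rewrite (_ : ~: (p |: A) = ~: A :\ p); last by apply/setP=> q; rewrite !inE negb_or.
by move: lt; clear; lia.
Qed.

Lemma pad_up A a s : support a \subset A -> rotn col A s ->
  exists2 s', rotn col setT s' & padded A setT a s s'.
Proof.
move=> sa rs; apply: (@pad_ind A (fun B => exists2 s', rotn col B s' & padded A B a s s')).
  by exists s.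
move=> B p pB AB [s1 r1 [e1 c1]].
have [s2 [r2 e2 c2]] := pad_up1 pB (subset_trans sa AB) r1.
exists s2; [exact: r2|split; [by rewrite e2|]].
by move: c1 c2; clear; lia.
Qed.

Lemma pad_down A a s' : support a \subset A -> rotn col setT s' ->
  exists2 s, rotn col A s & padded A setT a s s'.
Proof.
move=> sa; move: s'; apply: (@pad_ind A (fun B => forall s', rotn col B s' ->
  exists2 s, rotn col A s & padded A B a s s')).
  by move=> s' rs; exists s'.
move=> B p pB AB IH s' rs.
have [s1 [r1 e1 c1]] := pad_down1 pB (subset_trans sa AB) rs.
have [s r [e c]] := IH _ r1; exists s; first exact: r.
split; first by rewrite e1.
by move: c c1; clear; lia.
Qed.
End Pad.

Lemma cyc_on (D : finType) (A : {set D}) (u : {perm D}) : perm_on A u ->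
  cyc u = #|porbit u @: A| + #|~: A|.
Proof.
move=> uA; have fx d : d \in ~: A -> u d = d.
  by rewrite inE; apply: out_perm.
have -> : cyc u = #|porbit u @: A :|: porbit u @: ~: A|.
  rewrite -imsetU setUCr; apply: eq_card => O.
  by apply/imsetP/imsetP => -[d _ ->]; exists d.
rewrite cardsU (_ : _ :&: _ = set0) ?cards0 ?subn0; last first.
  apply/setP=> O; rewrite !inE; apply/andP=> -[/imsetP[a aA ->] /imsetP[b bA]].
  move=> /eqP; rewrite -coorbE coorb_sym coorb_fix ?fx // => /eqP ba.
  by move: bA; rewrite ba inE aA.
rewrite [X in _ + X]card_in_imset // => a b aA bA /eqP.
by rewrite -coorbE coorb_fix ?fx // => /eqP.
Qed.

Lemma rotn_orbits (D C : finType) (col : D -> C) (A : {set D}) s :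
  rotn col A s -> #|porbit s @: A| = #|col @: A|.
Proof.
move=> rs; have h : porbit s @: A = (fun c => [set d in A | col d == c]) @: (col @: A).
  rewrite -imset_comp; apply: eq_in_imset => a aA /=; apply/setP=> b.
  have := rotn_coorbE a b rs; rewrite /coorb inE => ->.
  by rewrite aA eq_sym /= eq_sym; case: eqP => [<-|_]; rewrite ?aA ?eqxx //= (eq_sym (col a)).
rewrite h card_in_imset // => c d /imsetP[a aA ->] _ /setP/(_ a).
by rewrite !inE aA eqxx => /esym/eqP.
Qed.

(** Used to sum over components: [h] sends a vertex, an edge or a face to the component containing
    it. *)
Lemma card_split (S K : finType) (A : {set S}) (B : {set K}) (h : S -> K)
    (P : K -> S -> bool) :
  {in A, forall a, h a \in B} ->
  {in B & A, forall C a, P C a = (h a == C)} ->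
  \sum_(C in B) #|[set a in A | P C a]| = #|A|.
Proof.
move=> hB hP; rewrite -[RHS]sum1_card (partition_big h (mem B)) //=.
apply: eq_bigr => C CB; rewrite -sum1_card; apply: eq_bigl => a.
by rewrite inE; case: (boolP (a \in A)) => //= aA; rewrite hP.
Qed.

(** * Euler's formula for the rotation systems of a graph *)

Section Euler.
Variables (T : finType) (G : graph T).
Local Notation D := (T * T)%type.
Local Notation dcol := (@fst T T).
Local Notation E := (edges G).
Local Notation V := (verts G).

Lemma edgesP e : e \in E -> (e \subset V) /\ #|e| == 2.
Proof. by case: G => V0 E0 h /=; move/forall_inP: h => h /h /andP. Qed.

Lemma edge_verts u v : [set u; v] \in E -> u \in V /\ v \in V.
Proof. by case/edgesP => /subsetP h _; rewrite !h ?set21 ?set22. Qed.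

Lemma edges_simple : simple E.
Proof. by apply/simpleP => e /edgesP[]. Qed.

Definition cls u := [set v in V | connect (adj G) u v].

Lemma conn_adj u v : connect (adj G) u v = conn E u v. Proof. by []. Qed.

Lemma conn_verts u v : conn E u v -> u \in V -> v \in V.
Proof.
move=> h uV; pose r a b := (a \in V) ==> (b \in V).
suff : r u v by rewrite /r uV.
move: u v h {uV}; apply: (connect_min (r := r)).
- by move=> a; apply/implyP.
- by move=> b a c; rewrite /r; case: (a \in V); case: (b \in V).
by move=> a b /edge_verts[_]; rewrite /r => ->; rewrite implybT.
Qed.

Lemma in_cls u v : u \in V -> (v \in cls u) = conn E u v.
Proof.
move=> uV; rewrite inE conn_adj; case c: (conn E u v); rewrite ?andbF //.
by rewrite (conn_verts c uV).
Qed.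

Lemma cls_eq u v : u \in V -> v \in V -> (cls u == cls v) = conn E u v.
Proof.
move=> uV vV; apply/eqP/idP => [/setP/(_ v)|c].
  by rewrite !in_cls // conn_refl.
apply/setP=> w; rewrite !in_cls //; apply/idP/idP; apply: conn_trans => //.
by rewrite conn_sym.
Qed.

Lemma componentP C : C \in components G -> exists2 u, u \in V & C = cls u.
Proof. by case/imsetP=> u uV ->; exists u. Qed.

Lemma in_component C u : C \in components G -> u \in V ->
  (u \in C) = (cls u == C).
Proof.
by case/componentP=> w wV ->; move=> uV; rewrite in_cls // cls_eq // conn_sym.
Qed.

Lemma cls_component u : u \in V -> cls u \in components G.
Proof. exact: imset_f. Qed.

Lemma card_components : #|components G| + nverts T = ncomp E + #|V|.
Proof.
have e : [set cclass E u | u in T] = components G :|: [set [set u] | u in ~: V].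
  have ce u : u \in V -> cclass E u = cls u.
    by move=> uV; apply/setP=> w; rewrite in_cls // inE.
  have co u : u \notin V -> cclass E u = [set u].
    move=> uV; apply/setP=> w; rewrite !inE; apply/idP/eqP => [|->]; last exact: conn_refl.
    case/connectP=> -[|a p] /=; first by [].
    by case/andP=> /edge_verts[uV']; rewrite uV' in uV.
  apply/setP=> O; rewrite inE; apply/imsetP/orP.
    case=> u _ ->; case: (boolP (u \in V)) => uV; [left|right].
      by rewrite ce // cls_component.
    by rewrite co // imset_f // inE.
  case=> /imsetP[u uV ->]; exists u => //; first by rewrite ce.
  by rewrite co //; move: uV; rewrite inE.
rewrite /ncomp e cardsU (_ : _ :&: _ = set0) ?cards0 ?subn0; last first.
  apply/setP=> O; rewrite !inE; apply/andP=> -[/imsetP[u uV ->] /imsetP[w wV]].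
  move=> /setP/(_ u); rewrite in_cls // conn_refl inE => /esym/eqP uw.
  by move: wV; rewrite -uw inE uV.
rewrite [X in _ = _ + X + _](card_imset _ set1_inj).
by rewrite -addnA; congr (_ + _); rewrite addnC; apply/esym/cardsC.
Qed.

Lemma in_darts d : (d \in darts G) = ([set d.1; d.2] \in E).
Proof. by rewrite inE. Qed.

Lemma support_alpha_darts : support (alpha E) \subset darts G.
Proof. by apply/subsetP=> -[u v]; rewrite in_darts inE => /alpha_mem. Qed.

Lemma rotationP s : reflect (rotn dcol (darts G) s) (rotation G s).
Proof.
apply: (iffP and3P) => [[on /forall_inP h1 /forall_inP h2]|rs].
  apply: rotnP => [|p q pA qA e].
    rewrite /kperm on; apply/forallP=> d.
    by case: (boolP (d \in darts G)) => [/h1//|/(out_perm on)->].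
  by have /forall_inP/(_ q qA)/implyP := h2 p pA; rewrite e; apply.
have ks := rotn_kperm rs; split; first exact: kperm_on ks.
  by apply/forall_inP=> d _; rewrite (kperm_col d ks).
apply/forall_inP=> d dA; apply/forall_inP=> d' dA'; apply/implyP=> /eqP e.
exact: rotn_coorb rs dA dA' e.
Qed.

Section Rot.
Variable s : {perm D}.
Hypothesis rs : rotn dcol (darts G) s.
Let ks := rotn_kperm rs.
Let u := alpha E * s.

Let sd d : (s d \in darts G) = (d \in darts G).
Proof. exact: perm_closed (kperm_on ks). Qed.

Lemma face_permE : {in darts G, u =1 face_perm s}.
Proof.
move=> [a b]; rewrite in_darts /= => ab; rewrite /u /face_perm permM alphaE ab.
by rewrite permM permE.
Qed.

Lemma face_on : perm_on (darts G) u.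
Proof.
apply: perm_onM (kperm_on ks); apply/subsetP=> d; rewrite inE => h.
by apply: (subsetP support_alpha_darts); rewrite inE.
Qed.

Lemma face_closed d : (u d \in darts G) = (d \in darts G).
Proof. exact: perm_closed face_on. Qed.

Lemma face_porbit d : d \in darts G -> porbit (face_perm s) d = porbit u d.
Proof.
move=> dA; apply/setP=> c; have st1 p : p \in darts G -> u p \in darts G.
  by rewrite face_closed.
have st2 p : p \in darts G -> face_perm s p \in darts G.
  by move=> pA; rewrite -face_permE // st1.
have ag : {in darts G, face_perm s =1 u} by move=> p /face_permE->.
apply/idP/idP => h.
  by have /andP[] := coorb_agree st2 ag dA h.
by have /andP[] := coorb_agree st1 face_permE dA h.
Qed.

Lemma face_conn d c : coorb u d c -> conn E d.1 c.1.
Proof. by apply: coorb_conn => p; rewrite (kperm_col p ks). Qed.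

Lemma face_in d c : coorb u d c -> d \in darts G -> c \in darts G.
Proof.
by move=> h dA; pattern c; apply: (coorb_ind h) => // p; rewrite face_closed.
Qed.

Definition vdarts := dcol @: darts G.
Definition cdarts (C : {set T}) := [set d in darts G | d.1 \in C].
Definition faces := porbit u @: darts G.
Lemma in_cdarts (C : {set T}) d :
  (d \in cdarts C) = (d \in darts G) && (d.1 \in C).
Proof. by rewrite in_set. Qed.

Lemma comp_faces_eq (C : {set T}) :
  [set porbit (face_perm s) d | d in darts G & d.1 \in C] = porbit u @: cdarts C.
Proof.
apply/setP=> O; apply/imsetP/imsetP => -[d dC ->]; exists d.
- by move: dC; rewrite !inE.
- by apply: face_porbit; move: dC; rewrite !inE => /andP[].
- by move: dC; rewrite !inE.
by rewrite face_porbit //; move: dC; rewrite !inE => /andP[].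
Qed.

Lemma dart_vert d : d \in darts G -> d.1 \in V /\ d.2 \in V.
Proof. by rewrite in_darts => /edge_verts. Qed.

Lemma vdarts_sub : vdarts \subset V.
Proof. by apply/subsetP=> v /imsetP[d /dart_vert[dV _] ->]. Qed.

Definition iso (C : {set T}) := comp_edges G C == set0.

Lemma comp_edge_mem C a b : C \in components G -> [set a; b] \in E ->
  ([set a; b] \in comp_edges G C) = (a \in C).
Proof.
move=> CK ab; rewrite inE ab /=; apply/idP/idP => [/subsetP h|aC].
  by rewrite h ?set21.
have [aV bV] := edge_verts ab; apply/subsetP=> c; rewrite !inE => /orP[]/eqP-> //.
have [w wV e] := componentP CK; move: aC; rewrite e !in_cls // => h.
exact: conn_trans h (conn_edge ab).
Qed.

Lemma iso_vdarts C v : C \in components G -> v \in C ->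
  (v \in vdarts) = ~~ iso C.
Proof.
move=> CK vC; have [w wV eC] := componentP CK.
apply/imsetP/set0Pn => [[[a b] ab /= va]|[e]].
  rewrite in_darts /= in ab; exists [set a; b].
  by rewrite comp_edge_mem // -va.
rewrite inE => /andP[eE eC'].
have /simpleP/(_ e eE)/cards2P[a [b [_ ee]]] := edges_simple.
have aC : a \in C by apply: (subsetP eC'); rewrite ee set21.
have ab : [set a; b] \in E by rewrite -ee.
have cva : conn E v a.
  move: vC aC; rewrite eC !in_cls // => h1 h2; apply: conn_trans h2.
  by rewrite conn_sym.
case/connectP: cva => -[|c p] /=.
  by move=> _ av; exists (v, b); rewrite // in_darts /= -av.
by case/andP=> vc _ _; exists (v, c); rewrite // in_darts.
Qed.

Lemma card_component C : C \in components G ->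
  #|C| = #|[set v in vdarts | v \in C]| + iso C.
Proof.
move=> CK; have [w wV eC] := componentP CK.
have wC : w \in C by rewrite eC in_cls // conn_refl.
have := iso_vdarts CK; case: (boolP (iso C)) => /= isoC h.
  have -> : [set v in vdarts | v \in C] = set0.
    apply/setP=> v; rewrite !inE; case: (boolP (v \in C)) => [/h->//|_].
    by rewrite andbF.
  rewrite cards0; apply/eqP/cards1P; exists w; apply/setP=> v; rewrite inE.
  apply/idP/eqP => [|->//]; rewrite eC in_cls //.
  case/connectP=> -[|c p] /=; first by [].
  case/andP=> wc _ _; have : w \in vdarts.
    by apply/imsetP; exists (w, c); rewrite // in_darts.
  by rewrite h.
rewrite addn0; apply: eq_card => v; rewrite inE.
by case: (boolP (v \in C)) => [/h->|_]; rewrite ?andbF.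
Qed.

Lemma comp_faces_card C : C \in components G ->
  comp_faces G s C = #|porbit u @: cdarts C| + iso C.
Proof.
move=> CK; rewrite /comp_faces -/(iso C) comp_faces_eq; case: ifP => isoC.
  have -> : cdarts C = set0.
    apply/setP=> -[a b]; rewrite inE in_set0; apply/negP => /andP[ab aC].
    rewrite in_darts /= in ab.
    have : [set a; b] \in comp_edges G C by rewrite comp_edge_mem.
    by rewrite (eqP isoC) inE.
  by rewrite imset0 cards0.
by rewrite addn0.
Qed.

(** Shows that in [embedding_genus] the subtraction does not truncate and the halving is exact. It
    is [cyc_alpha_bound] for the part of the rotation that acts on the darts of [C]. *)
Lemma comp_euler C : C \in components G ->
  #|porbit u @: cdarts C| + #|[set v in vdarts | v \in C]| + (iso C).*2
    <= 2 + #|comp_edges G C| /\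
  odd (#|porbit u @: cdarts C| + #|[set v in vdarts | v \in C]|) =
  odd #|comp_edges G C|.
Proof.
move=> CK; have [w wV eC] := componentP CK.
have wC : w \in C by rewrite eC in_cls // conn_refl.
have sep a b : a \in cdarts C -> b \in darts G :\: cdarts C -> a.1 != b.1.
  rewrite in_setD !in_cdarts => /andP[_ aC] /andP[+ bA]; rewrite bA /= => bC.
  by apply: contraNneq bC => <-.
have dE : darts G = cdarts C :|: (darts G :\: cdarts C).
  apply/setP=> d; rewrite in_setU in_setD in_cdarts.
  by case: (d \in darts G); case: (d.1 \in C).
have rs' := rs; rewrite dE in rs'.
have [a [b [ra rb sE]]] := rotn_split sep rs'; have ka := rotn_kperm ra.
have hE : comp_edges G C \subset E by apply/subsetP=> e; rewrite inE => /andP[].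
have := @cyc_alpha_bound _ (comp_edges G C) a (fun d => kperm_col d ka)
  (simple_sub hE edges_simple).
have aE d : d \in cdarts C -> alpha (comp_edges G C) d = alpha E d.
  case: d => p q; rewrite in_cdarts in_darts /= => /andP[pq pC].
  by rewrite !alphaE comp_edge_mem // pC pq.
have aO d : d \notin cdarts C -> alpha (comp_edges G C) d = d.
  case: d => p q; rewrite in_cdarts in_darts /= alphaE => h.
  case: ifP => // pqC; have pq := subsetP hE _ pqC.
  by move: pqC; rewrite comp_edge_mem // => pC; rewrite pq pC in h.
have alc d : d \in cdarts C -> alpha E d \in cdarts C.
  case: d => p q; rewrite in_cdarts in_darts /= => /andP[pq pC].
  have qp : [set q; p] \in E by rewrite setUC.
  rewrite alphaE pq in_cdarts in_darts /= qp -(comp_edge_mem CK qp) setUC.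
  by rewrite comp_edge_mem.
set al := alpha (comp_edges G C).
have aon : perm_on (cdarts C) (al * a).
  apply: perm_onM (kperm_on ka); apply/subsetP=> d; rewrite inE.
  by apply: contraR => /aO->.
have uE : {in cdarts C, u =1 al * a}.
  move=> d dC; rewrite /u sE !permM aE //.
  rewrite (out_perm (kperm_on (rotn_kperm rb))) //.
  by rewrite in_setD negb_and negbK (perm_closed _ (kperm_on ka)) alc.
have orb : porbit u @: cdarts C = porbit (al * a) @: cdarts C.
  apply: eq_in_imset => d dC; apply/setP=> c.
  have st1 p : p \in cdarts C -> (al * a) p \in cdarts C.
    by rewrite (perm_closed _ aon).
  have st2 p : p \in cdarts C -> u p \in cdarts C.
    by move=> pC; rewrite uE // st1.
  have uE' : {in cdarts C, al * a =1 u} by move=> p /uE->.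
  apply/idP/idP => h.
    by have /andP[] := coorb_agree st2 uE dC h.
  by have /andP[] := coorb_agree st1 uE' dC h.
rewrite (cyc_on aon) -orb (cyc_on (kperm_on ka)) (rotn_orbits ra).
have -> : dcol @: cdarts C = [set v in vdarts | v \in C].
  apply/setP=> v; rewrite inE; apply/imsetP/andP => [[d]|[/imsetP[d dA ->] vC]].
    by rewrite in_cdarts => /andP[dA dC ->]; rewrite imset_f.
  by exists d => //; rewrite in_cdarts dA.
(* The vertices of [C] form a single class, and each other vertex contributes at most one. *)
have nc : ncomp (comp_edges G C) + #|C| <= nverts T + 1.
  have sub : [set cclass (comp_edges G C) v | v in T] \subset
      cclass (comp_edges G C) w |: [set cclass (comp_edges G C) v | v in ~: C].
    apply/subsetP=> O /imsetP[v _ ->]; rewrite in_setU1.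
    case: (boolP (v \in C)) => vC; last by rewrite [X in _ || X]imset_f ?orbT // inE.
    rewrite cclass_eq; apply/orP; left.
    have h : conn E v w by move: vC; rewrite {1}eC in_cls // conn_sym.
    pose r p q := (p \in C) ==> (q \in C) && conn (comp_edges G C) p q.
    have : r w v.
      rewrite conn_sym in h; move: w v h {wV eC wC vC}.
      apply: (connect_min (r := r)).
      - by move=> p; rewrite /r conn_refl andbT implybb.
      - move=> q p t; rewrite /r; case: (p \in C) => //= /andP[-> /=] h1 /andP[-> h2].
        exact: conn_trans h1 h2.
      move=> p q pq; rewrite /r; apply/implyP => pC.
      have pqC : [set p; q] \in comp_edges G C by rewrite comp_edge_mem.
      by rewrite conn_edge // andbT -(comp_edge_mem CK (_ : [set q; p] \in E)) setUC.
    by rewrite /r wC /= => /andP[_]; rewrite conn_sym.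
  have := subset_leq_card sub; rewrite cardsU1 => le.
  have := leq_trans le (leq_add (leq_b1 _) (leq_imset_card _ _)).
  have <- : #|C| + #|~: C| = nverts T by apply: cardsC.
  by rewrite /ncomp; clear; lia.
have cc := card_component CK; rewrite -!addnA.
move: nc; set N := ncomp _; set k := #|~: _|; set f := #|porbit u @: _|.
set c := #|[set v in vdarts | v \in C]| in cc *; set e := #|comp_edges G C|.
move=> nc [h1 h2]; have od : odd (f + c) = odd e.
  by move: h2; rewrite !oddD; case: (odd f); case: (odd k); case: (odd c); case: (odd e).
split=> //; move: h1 nc; rewrite cc.
case isoC: (iso C); last by rewrite -!addnn /=; clear; lia.
have -> : e = 0 by rewrite /e (eqP isoC) cards0.
have -> : c = 0.
  apply/eqP; rewrite cards_eq0; apply/eqP/setP=> v; rewrite !inE.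
  case: (boolP (v \in C)) => vC; rewrite ?andbF //.
  by rewrite (iso_vdarts CK vC) isoC.
have -> : f = 0; last by [].
rewrite /f; have -> : cdarts C = set0; last by rewrite imset0 cards0.
apply/setP=> d; rewrite in_cdarts in_set0; apply/negP => /andP[dA dC].
have : d.1 \in vdarts by apply: imset_f.
by rewrite (iso_vdarts CK dC) isoC.
Qed.

Lemma comp_genus C : C \in components G ->
  (2 + #|comp_edges G C| - (#|C| + comp_faces G s C))./2.*2 +
  #|porbit u @: cdarts C| + #|[set v in vdarts | v \in C]| + (iso C).*2 =
  2 + #|comp_edges G C|.
Proof.
move=> CK; have [h1 h2] := comp_euler CK.
rewrite card_component // comp_faces_card //.
move: h1 h2; set f := #|porbit u @: _|; set c := #|[set v in vdarts | _]|.
set e := #|comp_edges G C|; set i := nat_of_bool (iso C) => h1 h2.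
have -> : c + i + (f + i) = f + c + i.*2 by rewrite -addnn; clear; lia.
rewrite even_halfK; first by move: h1; clear; lia.
by rewrite oddB // !oddD odd_double addbF -h2 oddD /= addbb.
Qed.

(** The formula of each component, summed. Isolated vertices, which have a face by convention but no
    dart, cancel; this is why only [vdarts] occurs. *)
Lemma embedding_genusE :
  (embedding_genus G s).*2 + #|faces| + (nverts T).*2 =
  (ncomp E).*2 + #|E| + #|vdarts|.
Proof.
have sumf : \sum_(C in components G) #|porbit u @: cdarts C| = #|faces|.
  pose h (O : {set D}) := \bigcup_(d in O) cls d.1.
  have hE d : d \in darts G -> h (porbit u d) = cls d.1.
    move=> dA; have [dV _] := dart_vert dA.
    apply/setP=> v; apply/bigcupP/idP => [[c cO]|vd]; last first.
      by exists d => //; apply: coorb_refl.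
    have [cV _] := dart_vert (face_in cO dA).
    by rewrite !in_cls //; apply: conn_trans; apply: face_conn.
  pose P (C : {set T}) (O : {set D}) := O \in porbit u @: cdarts C.
  rewrite -(@card_split _ _ faces (components G) h P).
  - apply: eq_bigr => C _; apply: eq_card => O; rewrite !inE /P andb_idl //.
    case/imsetP=> d; rewrite in_cdarts => /andP[dA _] ->; exact: imset_f.
  - move=> O /imsetP[d dA ->]; rewrite hE //; apply: cls_component.
    by have [] := dart_vert dA.
  move=> C O CK /imsetP[d dA ->]; rewrite hE //.
  have [dV _] := dart_vert dA; rewrite -in_component //; apply/imsetP/idP.
    case=> c; rewrite in_cdarts => /andP[cA cC] /eqP; rewrite -coorbE => /face_conn.
    have [cV _] := dart_vert cA; rewrite -cls_eq // => /eqP e.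
    by rewrite in_component // e -in_component.
  by move=> dC; exists d; rewrite ?in_cdarts ?dA.
have clsK v : v \in V -> cls v \in components G by apply: cls_component.
have sumv : \sum_(C in components G) #|[set v in vdarts | v \in C]| = #|vdarts|.
  apply: (@card_split _ _ vdarts (components G) cls (fun C v => v \in C)).
    by move=> v /(subsetP vdarts_sub); apply: clsK.
  by move=> C v CK /(subsetP vdarts_sub)/(in_component CK).
have sumV : \sum_(C in components G) #|C| = #|V|.
  rewrite -(@card_split _ _ V (components G) cls (fun C v => v \in C)) //.
    apply: eq_bigr => C CK; apply: eq_card => v; rewrite inE andb_idl //.
    by case/componentP: CK => w _ ->; rewrite inE => /andP[].
  by move=> C v CK; apply: in_component.
have sume : \sum_(C in components G) #|comp_edges G C| = #|E|.
  pose h (e : {set T}) := \bigcup_(v in e) cls v.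
  have hE a b : [set a; b] \in E -> h [set a; b] = cls a.
    move=> ab; have [aV bV] := edge_verts ab; rewrite /h bigcup_setU !big_set1.
    have /eqP-> : cls b == cls a by rewrite cls_eq // conn_sym conn_edge.
    exact: setUid.
  apply: (@card_split _ _ E (components G) h (fun C e => e \subset C)).
    move=> e eE; have /simpleP/(_ e eE)/cards2P[a [b [_ ee]]] := edges_simple.
    rewrite ee in eE *; rewrite hE //; apply: clsK.
    by have [] := edge_verts eE.
  move=> C e CK eE; have /simpleP/(_ e eE)/cards2P[a [b [_ ee]]] := edges_simple.
  rewrite ee in eE *; rewrite hE // -in_component //; last by have [] := edge_verts eE.
  by rewrite -(comp_edge_mem CK eE) inE eE.
have sumi : #|V| = #|vdarts| + \sum_(C in components G) iso C.
  by rewrite -sumV -sumv -big_split /=; apply: eq_bigr => C; apply: card_component.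
have sum : (embedding_genus G s).*2 + #|faces| + #|vdarts|
    + (\sum_(C in components G) iso C).*2 = #|components G|.*2 + #|E|.
  rewrite -sumf -sumv -sume -!mul2n /embedding_genus -sum1_card.
  rewrite !big_distrr -!big_split /=; apply: eq_bigr => C CK.
  by rewrite muln1 !mul2n comp_genus.
move: sum sumi card_components; set i := \sum_(_ in _) _; set c := #|vdarts|.
set k := #|components G|; set v := #|V|; set m := #|E|; set n := ncomp E.
by rewrite -!addnn; clear; lia.
Qed.

Lemma cyc_face : cyc u + #|darts G| = #|faces| + #|{: D}|.
Proof.
rewrite (cyc_on face_on) -addnA; congr (_ + _).
by rewrite addnC; apply: cardsC.
Qed.

Lemma padded_genus s' : fullrot s' ->
  cyc (alpha E * s') + #|[set: D]| + #|vdarts| =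
    cyc u + #|darts G| + #|dcol @: [set: D]| ->
  (embedding_genus G s).*2 + nverts T + cyc (alpha E * s') =
  (ncomp E).*2 + #|E|.
Proof.
move=> rs'; rewrite cyc_face cardsT.
have -> : #|dcol @: [set: D]| = nverts T.
  apply: eq_card => v; rewrite inE; apply/imsetP; exists (v, v) => //.
set t := #|{: D}|; have := embedding_genusE.
set f := #|faces|; set m := #|E|; set c := #|vdarts|; set z := cyc _.
by rewrite -!addnn; clear; lia.
Qed.
End Rot.
End Euler.

(** * Alternation read off facial walks *)

Lemma subseq_consP (S : eqType) (a : S) (t s : seq S) :
  reflect (exists i, [/\ i < size s, nth a s i = a & subseq t (drop i.+1 s)])
          (subseq (a :: t) s).
Proof.
elim: s => [|b s IH]; first by constructor=> -[i []].
apply: (iffP idP) => [/=|[[|i] [lt /= e h]]].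
- case: eqP => [->|ab h]; first by exists 0; rewrite drop0.
  by have [i [lt e sb]] := IH h; exists i.+1.
- by rewrite /= -e eqxx; move: h; rewrite drop0.
apply: (@subseq_trans _ s (a :: t) (b :: s) _ (subseq_cons s b)).
by apply/IH; exists i.
Qed.

Section AltWalk.
Variables (D : finType) (C : eqType) (col : D -> C) (x y : C).
Hypothesis xy : x != y.
Variable u : {perm D}.
Local Notation X := (colset col x).
Local Notation Y := (colset col y).
Local Notation N d := #|porbit u d|.
Local Notation walk d := (map col (traject u d (N d))).
Local Notation pt d i := (iter i u d).

Lemma pt_inj d i j : i < N d -> j < N d -> pt d i = pt d j -> i = j.
Proof.
move=> ib jb e; apply/eqP; rewrite -(nth_uniq d _ _ (uniq_traject_porbit u d)).
- by rewrite !nth_traject // e.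
- by rewrite size_traject.
by rewrite size_traject.
Qed.

Lemma pt_orbit d p : coorb u d p -> exists2 i, i < N d & p = pt d i.
Proof.
rewrite /coorb porbit_traject => /(nthP d)[i]; rewrite size_traject => ib.
by rewrite nth_traject // => <-; exists i.
Qed.

Lemma coorb_pt d i : coorb u d (pt d i).
Proof. by rewrite -permX; apply: mem_porbit. Qed.

Lemma coorb_pt2 d i j : coorb u (pt d i) (pt d j).
Proof. by apply: coorb_trans (coorb_pt d j); rewrite coorb_sym coorb_pt. Qed.

Lemma subseq_walkP d : subseq [:: x; y; x; y] (walk d) <->
  exists i j k l, [/\ i < j, j < k, k < l, l < N d &
    [/\ col (pt d i) = x, col (pt d j) = y, col (pt d k) = x & col (pt d l) = y]].
Proof.
have nth' a i : i < N d -> nth a (walk d) i = col (pt d i).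
  by move=> ib; rewrite (nth_map d) ?size_traject // nth_traject.
have sz : size (walk d) = N d by rewrite size_map size_traject.
split.
  case/subseq_consP=> i [ib ei /subseq_consP[j [jb ej]]].
  case/subseq_consP=> k [kb ek /subseq_consP[l [lb el _]]].
  move: ib ei jb ej kb ek lb el; rewrite !size_drop !nth_drop sz => ib ei jb ej kb ek lb el.
  exists i, (i.+1 + j), (i.+1 + (j.+1 + k)), (i.+1 + (j.+1 + (k.+1 + l))).
  have b1 : i.+1 + j < N d by move: jb; clear; lia.
  have b2 : i.+1 + (j.+1 + k) < N d by move: kb; clear; lia.
  have b3 : i.+1 + (j.+1 + (k.+1 + l)) < N d by move: lb; clear; lia.
  rewrite !nth' // in ei ej ek el.
  by split=> //; clear; lia.
case=> i [j [k [l [ij jk kl lN [ei ej ek el]]]]].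
have [iN jN kN] : [/\ i < N d, j < N d & k < N d].
  by move: ij jk kl lN; clear => ? ? ? ?; split; lia.
have jE : i.+1 + (j - i.+1) = j by move: ij; clear; lia.
have kE : j.+1 + (k - j.+1) = k by move: jk; clear; lia.
have lE : k.+1 + (l - k.+1) = l by move: kl; clear; lia.
apply/subseq_consP; exists i; rewrite sz nth' //; split=> //.
apply/subseq_consP; exists (j - i.+1).
rewrite size_drop sz nth_drop nth' ?jE //; split=> //.
  by move: ij jN; clear; lia.
rewrite drop_drop; have -> : (j - i.+1).+1 + i.+1 = j.+1 by move: ij; clear; lia.
apply/subseq_consP; exists (k - j.+1).
rewrite size_drop sz nth_drop nth' ?kE //; split=> //.
  by move: jk kN; clear; lia.
rewrite drop_drop; have -> : (k - j.+1).+1 + j.+1 = k.+1 by move: jk; clear; lia.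
apply/subseq_consP; exists (l - k.+1).
rewrite size_drop sz nth_drop nth' ?lE //; split=> //; last exact: sub0seq.
by move: kl lN; clear; lia.
Qed.

(** The positions from [i] to [k - 1] close up under the cut. *)
Lemma cut_stable d i k : i < k -> k < N d ->
  let th := u * tperm (pt d i) (pt d k) in
  forall m, i <= m < k -> exists2 m', i <= m' < k & th (pt d m) = pt d m'.
Proof.
move=> ik kN th m /andP[im mk]; rewrite /th permM -iterS.
have iN := ltn_trans ik kN.
have [e|ne] := eqVneq m.+1 k.
  by exists i; rewrite ?leqnn // e tpermR.
have mk' : m.+1 < k by rewrite ltn_neqAle ne.
exists m.+1; first by rewrite mk' leqW.
have mN := ltn_trans mk' kN.
rewrite tpermD //; apply/eqP => /(pt_inj _ _) e.
  by have := e iN mN => ei; move: im; rewrite ei ltnn.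
by have := e kN mN => ei; move: mk'; rewrite ei ltnn.
Qed.

(** Cutting at two occurrences of x separates the arc between them from the rest of the cycle. For
    the direct implication the walk starts at [v1]: the positions before [v2] and those from [v2] on
    each stay in one cycle of the cut permutation, so [y1] and [y2] lie on different sides of
    [v2]. *)
Lemma alt_walk : alt X Y u <-> exists d, subseq [:: x; y; x; y] (walk d).
Proof.
have nXY a b : col a = x -> col b = y -> a != b.
  by move=> ax bY; apply: contra_neq xy => e; rewrite -ax -bY e.
split; last first.
  case=> d /subseq_walkP[i [j [k [l [ij jk kl lN [ei ej ek el]]]]]].
  apply/altP; exists (pt d i), (pt d k), (pt d j), (pt d l).
  split; rewrite ?inE ?ei ?ej ?ek ?el //; split; try exact: coorb_pt2.
  have ik := ltn_trans ij jk; have kN := ltn_trans kl lN.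
  set th := u * _; apply/negP => co.
  have : exists2 m, i <= m < k & pt d l = pt d m.
    pattern (pt d l); apply: (coorb_ind co).
      by exists j => //; rewrite jk ltnW.
    by move=> r [m mb ->]; have [m' mb' e] := cut_stable ik kN mb; exists m'.
  case=> m /andP[_ mk] /pt_inj e; have ml := e lN (ltn_trans mk kN).
  by move: kl; rewrite ml ltnNge ltnW.
case/altP=> v1 [v2 [y1 [y2 [X1 X2 Y1 Y2 [sv sy ny]]]]].
move: X1 X2 Y1 Y2; rewrite !inE => /eqP X1 /eqP X2 /eqP Y1 /eqP Y2.
set th := u * tperm v1 v2 in ny.
have [k kN ek] := pt_orbit sv.
have k0 : 0 < k.
  rewrite lt0n; apply: contraNneq ny => k0; move: ek; rewrite /th k0 /= => ->.
  by rewrite tperm1 mulg1.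
have thE r : u r != v1 -> u r != v2 -> th r = u r.
  by move=> n1 n2; rewrite /th permM tpermD // eq_sym.
have y1o : coorb u v1 y1.
  apply: contraNT ny => no; pose P p := ~~ coorb u v1 p.
  have ag : {in [pred p | ~~ coorb u v1 p], u =1 th}.
    move=> p; rewrite inE => np; rewrite thE //.
      by apply: contraNneq np => e; rewrite -coorb_stepr e coorb_refl.
    by apply: contraNneq np => e; rewrite -coorb_stepr e.
  have st p : ~~ coorb u v1 p -> ~~ coorb u v1 (u p) by rewrite coorb_stepr.
  by have /andP[] := coorb_agree (P := [pred p | ~~ coorb u v1 p]) st ag no sy.
have y2o := coorb_trans y1o sy.
have [a aN ea] := pt_orbit y1o; have [b bN eb] := pt_orbit y2o.
have low m : m < k -> coorb th v1 (pt v1 m).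
  elim: m => [|m IH] mk; first exact: coorb_refl.
  have mN : m.+1 < N v1 by apply: ltn_trans mk kN.
  rewrite iterS -thE ?coorb_stepr; first by apply: IH; apply: ltnW.
    by rewrite -iterS; apply/eqP => /(@pt_inj v1 m.+1 0 mN (ltn_trans k0 kN)).
  rewrite -iterS ek; apply/eqP => /(pt_inj mN kN) e.
  by move: mk; rewrite e ltnn.
have high m : k <= m -> m < N v1 -> coorb th v2 (pt v1 m).
  move=> km; rewrite -(subnKC km); elim: (m - k) => [|j IH] mN.
    by rewrite addn0 -ek coorb_refl.
  rewrite addnS in mN *; rewrite iterS -thE ?coorb_stepr; first by apply: IH; apply: ltnW.
    by rewrite -iterS; apply/eqP => /(@pt_inj v1 _ 0 mN (ltn_trans k0 kN)).
  rewrite -iterS ek; apply/eqP => /(pt_inj mN kN) e.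
  by move: e; clear; lia.
have a0 : a != 0.
  by apply: contraTneq (nXY _ _ X1 Y1) => e; rewrite ea e eqxx.
have b0 : b != 0.
  by apply: contraTneq (nXY _ _ X1 Y2) => e; rewrite eb e eqxx.
have ak : a != k.
  by apply: contraTneq (nXY _ _ X2 Y1) => e; rewrite ea e -ek eqxx.
have bk : b != k.
  by apply: contraTneq (nXY _ _ X2 Y2) => e; rewrite eb e -ek eqxx.
exists v1; apply/subseq_walkP; case: (ltnP a k) => ak'; case: (ltnP b k) => bk'.
- case/negP: ny; rewrite ea eb; apply: coorb_trans (low _ bk').
  by rewrite coorb_sym low.
- exists 0, a, k, b; rewrite -ea -eb -ek lt0n a0 ak'; split=> //.
  by rewrite ltn_neqAle eq_sym bk.
- exists 0, b, k, a; rewrite -ea -eb -ek lt0n b0 bk'; split=> //.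
  by rewrite ltn_neqAle eq_sym ak.
case/negP: ny; rewrite ea eb; apply: coorb_trans (high _ bk' bN).
by rewrite coorb_sym high.
Qed.
End AltWalk.

(** * Genus and epsilon through padded rotations *)

Section Translate.
Variables (T : finType) (x y : T) (G : graph T).
Hypothesis xy : x != y.
Local Notation D := (T * T)%type.
Local Notation dcol := (@fst T T).
Local Notation E := (edges G).

Lemma genusP : (exists2 s, rotation G s & embedding_genus G s = genus G) /\
  forall s, rotation G s -> genus G <= embedding_genus G s.
Proof.
rewrite /genus; case: ex_minnP => m /existsP[s /andP[rs /eqP e]] h.
split; first by exists s.
by move=> r rr; apply: h; apply/existsP; exists r; rewrite rr eqxx.
Qed.

Lemma alternatingE s : rotn dcol (darts G) s ->
  alternating x y G s = alt (fiber x) (fiber y) (alpha E * s).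
Proof.
move=> rs; pose u := alpha E * s; have W := @alt_walk _ _ dcol x y xy u.
have fw d : d \in darts G ->
    facial_walk s d = [seq p.1 | p <- traject u d #|porbit u d|].
  move=> dA; rewrite /facial_walk (face_porbit rs dA); congr map.
  rewrite -/u; move: #|porbit u d| => n; elim: n d dA => // n IH d dA.
  have e : face_perm s d = u d by rewrite -(face_permE s dA).
  by rewrite !trajectS e IH // (face_closed rs).
apply/idP/idP => [/exists_inP[d dA]|/W[d]].
  by rewrite fw // => h; apply/W; exists d.
(* A pair that is not a dart is a fixed point, and its walk of length one is too short for the
   pattern. *)
move=> h; have dA : d \in darts G.
  apply: contraLR h => dA; apply/negP => /size_subseq.
  rewrite size_map size_traject /= => le.
  have ud : u d = d by apply: out_perm (face_on rs) dA.
  have : porbit u d \subset [set d].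
    apply/subsetP=> p h; have := coorb_fix p ud; rewrite /coorb h inE.
    by rewrite eq_sym => <-.
  by move/subset_leq_card; rewrite cards1 => /(leq_trans le).
by apply/exists_inP; exists d; rewrite ?fw.
Qed.

Lemma pad_genus s s' : rotn dcol (darts G) s -> fullrot s' ->
  padded dcol x y (darts G) setT (alpha E) s s' ->
  (embedding_genus G s).*2 + nverts T + cyc (alpha E * s') =
    (ncomp E).*2 + #|E| /\
  alternating x y G s = alt (fiber x) (fiber y) (alpha E * s').
Proof.
move=> rs rs' [e c]; split; first exact: padded_genus.
by rewrite alternatingE // -e.
Qed.

(** Rotation systems of the graph and full rotations are exchanged by padding, under which Euler's
    formula keeps this shape; so minimal genus means a maximal number of cycles. *)
Lemma genusE : (genus G).*2 + nverts T + Zmax E = (ncomp E).*2 + #|E|.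
Proof.
have [[s /rotationP rs es] gmin] := genusP.
have sa := support_alpha_darts G.
have [s' rs' pd] := pad_up xy sa rs.
have [e1 _] := pad_genus rs rs' pd; have z1 := Zmax_ge E rs'.
have [r' rr' e2] := Zmax_ex E; have [r rr pd'] := pad_down xy sa rr'.
have [e3 _] := pad_genus rr rr' pd'.
have le := gmin r (introT (rotationP _ _) rr).
move: e1 e3 z1 le; rewrite -e2 -es; set m := #|E|; set z := Zmax E.
set g1 := embedding_genus G s; set g2 := embedding_genus G r.
by rewrite -!addnn; clear; lia.
Qed.

Lemma alternating_minE : alternating_min x y G = altE x y E.
Proof.
have sa := support_alpha_darts G; have gE := genusE.
apply/existsP/altEP => [[s /and3P[/rotationP rs /eqP es al]]|[s' [rs' es al]]].
  have [s' rs' pd] := pad_up xy sa rs.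
  have [e1 e2] := pad_genus rs rs' pd; exists s'; split=> //; last by rewrite -e2.
  move: e1 gE; rewrite es; set m := #|E|; set z := Zmax E; clear; lia.
have [s rs pd] := pad_down xy sa rs'.
have [e1 e2] := pad_genus rs rs' pd; exists s.
rewrite e2 al andbT; apply/andP; split; first exact/rotationP.
move: e1 gE; rewrite es; set m := #|E|; set z := Zmax E.
set g1 := embedding_genus G s; set g2 := genus G; rewrite -!addnn; clear=> a b.
by apply/eqP; lia.
Qed.
End Translate.

Local Close Scope group_scope.

(** * Genera of edge sets *)

Section EdgeGenus.
Variables (T : finType) (x y : T).
Hypothesis xy : x != y.
Implicit Types (E F : {set {set T}}) (V W : {set T}).
Local Notation e := [set x; y].

(** The genus depends on the edges alone, see [genus_gE], so all graphs are given the same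
    vertices. *)
Definition gE E := genus (mkgraph setT E).

Lemma edges_setT E : simple E -> edges (mkgraph setT E) = E.
Proof.
move=> /simpleP sE; apply/setP=> f; rewrite inE subsetT /=.
by case: (boolP (f \in E)) => //= /sE.
Qed.

Lemma gEE E : simple E ->
  (gE E).*2 + nverts T + Zmax E = (ncomp E).*2 + #|E|.
Proof. by move=> sE; have := genusE (mkgraph setT E) xy; rewrite edges_setT. Qed.

Lemma genus_gE (G : graph T) : genus G = gE (edges G).
Proof.
have h1 := genusE G xy; have h2 := gEE (edges_simple G).
move: h1 h2; set m := #|_|; set z := Zmax _; set a := genus _; set b := gE _.
by rewrite -!addnn; clear; lia.
Qed.

Lemma simple_add E u v : u != v -> simple E -> simple ([set u; v] |: E).
Proof.
move=> uv /simpleP sE; apply/simpleP=> f; rewrite in_setU1.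
by case/orP=> [/eqP->|/sE//]; rewrite cards2 uv.
Qed.

Lemma unlinked_conn E W s : rotn (@fst T T) (fib W) s -> ~~ conn E x y ->
  ~~ linked (@fst T T) x y (alpha E * s)%g.
Proof.
move=> rs; apply: contra => /linkedP[p [q [pX qY]]] /coorb_conn.
have ks := rotn_kperm rs; move=> /(_ (fun d => kperm_col d ks)).
by move: pX qY; rewrite !inE => /eqP-> /eqP->.
Qed.

Section Sum.
Variables (V1 V2 : {set T}) (E1 E2 : {set {set T}}).
Hypotheses (V12 : V1 :&: V2 \subset e).
Hypotheses (in1 : inside E1 V1) (in2 : inside E2 V2).
Hypotheses (s1 : simple E1) (s2 : simple E2).
Hypotheses (eE1 : e \notin E1) (eE2 : e \notin E2).

(** The vertices outside both parts go to [W2], because full rotations act on all of [T]. *)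
Let W1 := V1 :\: e.
Let W2 := ~: (W1 :|: e).
Let xW1 : x \notin W1. Proof. by rewrite !inE eqxx. Qed.
Let yW1 : y \notin W1. Proof. by rewrite !inE eqxx orbT. Qed.
Let W2E : W2 = ~: (W1 :|: e). Proof. by []. Qed.
Let inW1 : inside E1 (W1 :|: e).
Proof. by move=> u v /in1 uV; rewrite !inE uV andbT orNb. Qed.
Let inW2 : inside E2 (W2 :|: e).
Proof.
move=> u v /in2 uV; have h : u \in V1 -> u \in e.
  by move=> uV1; apply: (subsetP V12); rewrite in_setI uV1.
rewrite /W2 /W1 !inE; move: h; rewrite !inE.
by case: (u == x); case: (u == y); case: (u \in V1) => //= /(_ isT).
Qed.

Lemma sum_disjoint : [disjoint E1 & E2].
Proof.
rewrite -setI_eq0; apply/eqP/setP=> f; rewrite in_set0 in_setI.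
apply/negP => /andP[f1 f2].
have /simpleP/(_ f f1)/cards2P[a [b [ab ef]]] := s1.
rewrite ef in f1 f2; have [a1 b1] := insideR in1 f1; have [a2 b2] := insideR in2 f2.
have ae : a \in e by apply: (subsetP V12); rewrite inE a1.
have be : b \in e by apply: (subsetP V12); rewrite inE b1.
case/negP: eE1; suff -> : e = [set a; b] by [].
by move: ae be ab; rewrite !inE => /orP[]/eqP-> /orP[]/eqP->; rewrite ?eqxx // setUC.
Qed.
Let dj := sum_disjoint.

Lemma simpleU : simple (E1 :|: E2).
Proof.
apply/simpleP=> f; rewrite inE => /orP[]; first exact: simpleP.
exact: (simpleP _ s2).
Qed.

Lemma notin_sum : e \notin E1 :|: E2.
Proof. by rewrite inE negb_or eE1. Qed.

Lemma cardsU_sum : #|E1 :|: E2| = #|E1| + #|E2|.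
Proof. by rewrite cardsU (eqP (_ : E1 :&: E2 == set0)) ?cards0 ?subn0 // setI_eq0. Qed.

Lemma conn_sum : conn (E1 :|: E2) x y = conn E1 x y || conn E2 x y.
Proof. exact: (conn_union xW1 yW1 W2E inW1 inW2). Qed.

Let nc : ncomp (E1 :|: E2) + nverts T =
  ncomp E1 + ncomp E2 + (conn E1 x y && conn E2 x y).
Proof. exact: (ncomp_union xy xW1 yW1 W2E inW1 s2 inW2). Qed.

(** [Zsum_h1] read through Euler's formula: the two faces gained by an alternating pair are one unit
    of genus. *)
Lemma genus_sum_plus :
  gE (e |: (E1 :|: E2)) + (altE x y (e |: E1) && altE x y (e |: E2)) =
  gE (e |: E1) + gE (e |: E2).
Proof.
have := gEE (simple_add xy simpleU).
have := gEE (simple_add xy s1); have := gEE (simple_add xy s2).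
rewrite !cardsU1 eE1 eE2 notin_sum cardsU_sum.
have := Zsum_h1 xy xW1 yW1 W2E inW1 inW2 eE1 eE2 dj.
have := ncomp_add E1 x y; have := ncomp_add E2 x y; have := ncomp_add (E1 :|: E2) x y.
rewrite conn_sum; move: nc.
set b := altE _ _ _ && _; set k1 := conn _ _ _; set k2 := conn _ _ _.
set n1 := ncomp (e |: E1); set n2 := ncomp (e |: E2); set n12 := ncomp (e |: (E1 :|: E2)).
set c1 := ncomp E1; set c2 := ncomp E2; set c12 := ncomp (E1 :|: E2).
set z1 := Zmax (e |: E1); set z2 := Zmax (e |: E2); set z12 := Zmax (e |: (E1 :|: E2)).
set g1 := gE (e |: E1); set g2 := gE (e |: E2); set g12 := gE (e |: (E1 :|: E2)).
set m1 := #|E1|; set m2 := #|E2|; rewrite -!addnn /=.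
by clearbody k1 k2 b; case: k1; case: k2 => /=; clear; lia.
Qed.

(** The two terms are those of the maximum in [Zsum]. When both parts join x to y, [ncomp] of the
    union is one larger than otherwise, which is the origin of the successor. *)
Lemma genus_sum : conn E1 x y -> conn E2 x y ->
  gE (E1 :|: E2) = minn (gE E1 + gE E2).+1 (gE (e |: (E1 :|: E2))).
Proof.
move=> k1 k2; have := gEE (simple_add xy simpleU); have := gEE simpleU.
have := gEE s1; have := gEE s2.
rewrite !cardsU1 notin_sum cardsU_sum.
have := Zsum_h1 xy xW1 yW1 W2E inW1 inW2 eE1 eE2 dj.
have := Zsum xy xW1 yW1 W2E inW1 inW2 eE1 eE2 dj.
have := ncomp_add (E1 :|: E2) x y.
rewrite conn_sum k1 /=; move: nc; rewrite k1 k2 /=.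
set b := altE _ _ _ && _.
set c1 := ncomp E1; set c2 := ncomp E2; set c12 := ncomp (E1 :|: E2).
set n12 := ncomp (e |: (E1 :|: E2)).
set z1 := Zmax (e |: E1); set z2 := Zmax (e |: E2); set z12 := Zmax (e |: (E1 :|: E2)).
set y1 := Zmax E1; set y2 := Zmax E2; set y12 := Zmax (E1 :|: E2).
set g1 := gE E1; set g2 := gE E2; set g12 := gE (E1 :|: E2).
set h12 := gE (e |: (E1 :|: E2)).
by set m1 := #|E1|; set m2 := #|E2|; rewrite -!addnn /=; clear; lia.
Qed.

Lemma genus_sum_split : ~~ conn E1 x y -> gE (E1 :|: E2) = gE E1 + gE E2.
Proof.
move=> k1; have := gEE simpleU; have := gEE s1; have := gEE s2.
have ul s : rotn (@fst T T) (fib W1) s ->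
  ~~ linked (@fst T T) x y (alpha E1 * s)%g.
  by move=> rs; apply: unlinked_conn rs k1.
have [+ _ _] := Zsum_unlinked xy xW1 yW1 W2E inW1 inW2 eE1 dj ul.
rewrite cardsU_sum; move: nc; rewrite (negPf k1) /=.
set c1 := ncomp E1; set c2 := ncomp E2; set c12 := ncomp (E1 :|: E2).
set y1 := Zmax E1; set y2 := Zmax E2; set y12 := Zmax (E1 :|: E2).
set g1 := gE E1; set g2 := gE E2; set g12 := gE (E1 :|: E2).
by set m1 := #|E1|; set m2 := #|E2|; rewrite -!addnn /=; clear; lia.
Qed.
End Sum.

Section Single.
Variable E : {set {set T}}.
Hypotheses (sE : simple E) (eE : e \notin E).
(** A single edge set is regarded as a sum with an empty second part. *)
Let W1 := ~: e.
Let xW1 : x \notin W1. Proof. by rewrite !inE eqxx. Qed.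
Let yW1 : y \notin W1. Proof. by rewrite !inE eqxx orbT. Qed.
Let W2E : set0 = ~: (W1 :|: e).
Proof. by rewrite setUC setUCr setCT. Qed.
Let inW1 : inside E (W1 :|: e).
Proof. by move=> u v _; rewrite setUC setUCr inE. Qed.
Let in0 : inside (set0 : {set {set T}}) (set0 :|: e).
Proof. by move=> u v; rewrite inE. Qed.

Lemma plus_unconn : ~~ conn E x y ->
  gE (e |: E) = gE E /\ altE x y (e |: E) = false.
Proof.
move=> k; have := gEE sE; have := gEE (simple_add xy sE).
have ul s : rotn (@fst T T) (fib W1) s ->
  ~~ linked (@fst T T) x y (alpha E * s)%g.
  by move=> rs; apply: unlinked_conn rs k.
have dj0 : [disjoint E & set0] by rewrite -setI_eq0 setI0.
have e0 : e \notin set0 by rewrite inE.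
have [_ -> +] := Zsum_unlinked xy xW1 yW1 W2E inW1 in0 eE dj0 ul.
have := ncomp_add E x y; rewrite (negPf k) cardsU1 eE.
set c1 := ncomp E; set c2 := ncomp (e |: E).
set y1 := Zmax E; set y2 := Zmax (e |: E).
set g1 := gE E; set g2 := gE (e |: E); set m1 := #|E|.
by rewrite -!addnn /=; clear => *; split=> //; lia.
Qed.

Lemma genus_plus : gE E <= gE (e |: E) <= (gE E).+1.
Proof.
case: (boolP (conn E x y)) => k; last first.
  by have [-> _] := plus_unconn k; rewrite leqnn leqnSn.
have := gEE sE; have := gEE (simple_add xy sE).
have := ncomp_add E x y; have := Zmax_add eE xy; rewrite k cardsU1 eE.
set c1 := ncomp E; set c2 := ncomp (e |: E).
set y1 := Zmax E; set y2 := Zmax (e |: E).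
set g1 := gE E; set g2 := gE (e |: E); set m1 := #|E|.
by rewrite -!addnn /=; clear => *; apply/andP; split; lia.
Qed.

Lemma altE_genus : altE x y E = (gE (e |: E) == gE E) && altE x y (e |: E).
Proof.
rewrite (altE_plus xy xW1 yW1 W2E inW1 eE).
case: (boolP (conn E x y)) => k; last first.
  by have [_ ->] := plus_unconn k; rewrite !andbF.
congr (_ && _).
have := gEE sE; have := gEE (simple_add xy sE).
have := ncomp_add E x y; have := Zmax_add eE xy; rewrite k cardsU1 eE.
set c1 := ncomp E; set c2 := ncomp (e |: E).
set y1 := Zmax E; set y2 := Zmax (e |: E).
set g1 := gE E; set g2 := gE (e |: E); set m1 := #|E|.
by rewrite -!addnn /=; clear => *; apply/eqP/eqP; lia.
Qed.

Lemma altE_degree : altE x y (e |: E) -> 1 < #|[set v | [set x; v] \in E]|.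
Proof. exact: (altE_deg xy xW1 yW1 W2E inW1 eE). Qed.
End Single.
End EdgeGenus.

(** * Renaming vertices, and bridges between the terminals *)

Section Relabel.
Variable T : finType.
Implicit Types (E F : {set {set T}}) (V W : {set T}) (p : {perm T}).
Local Notation D := (T * T)%type.
Local Open Scope group_scope.

(** Contracting a bridge uv amounts to renaming v as u on one side, see [econtract_bridge]. *)
Definition relabel p E := [set p @: (f : {set T}) | f in E].

Lemma mem_relabel p E f : (p @: (f : {set T}) \in relabel p E) = (f \in E).
Proof. exact: mem_imset (imset_inj perm_inj). Qed.

Lemma mem_relabel2 p E u v : ([set p u; p v] \in relabel p E) = ([set u; v] \in E).
Proof. by rewrite -(mem_relabel p E [set u; v]) imsetU !imset_set1. Qed.

Lemma relabelK p : cancel (relabel p) (relabel p^-1).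
Proof.
move=> E; rewrite /relabel -imset_comp -[RHS]imset_id; apply: eq_imset => f /=.
by rewrite -imset_comp -[RHS]imset_id; apply: eq_imset => a /=; rewrite permK.
Qed.

Lemma relabel_simple p E : simple E -> simple (relabel p E).
Proof.
move=> /simpleP sE; apply/simpleP=> f /imsetP[h /sE hE ->].
by rewrite card_imset //; apply: perm_inj.
Qed.

Lemma card_relabel p E : #|relabel p E| = #|E|.
Proof. by rewrite card_imset //; apply: imset_inj; apply: perm_inj. Qed.

Lemma relabelU p E F : relabel p (E :|: F) = relabel p E :|: relabel p F.
Proof. exact: imsetU. Qed.

Lemma relabelU1 p E u v :
  relabel p ([set u; v] |: E) = [set p u; p v] |: relabel p E.
Proof. by rewrite relabelU /relabel imset_set1 imsetU !imset_set1. Qed.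

Lemma conn_relabel_sub p E a b : conn E a b -> conn (relabel p E) (p a) (p b).
Proof.
move: a b; apply: (connect_min (r := fun a b => conn (relabel p E) (p a) (p b))).
- by move=> a; apply: conn_refl.
- by move=> b a c; apply: conn_trans.
by move=> a b ab; apply: conn_edge; rewrite mem_relabel2.
Qed.

Lemma conn_relabel p E a b : conn (relabel p E) (p a) (p b) = conn E a b.
Proof.
apply/idP/idP; last exact: conn_relabel_sub.
by move/(conn_relabel_sub p^-1); rewrite relabelK !permK.
Qed.

Lemma coorbJ (S : finType) (s t : {perm S}) a b :
  coorb (s ^ t) (t a) (t b) = coorb s a b.
Proof.
apply/porbitP/porbitP => -[i e]; exists i; last by rewrite e -conjXg permJ.
by move: e; rewrite -conjXg permJ => /perm_inj.
Qed.

Lemma ncomp_relabel p E : ncomp (relabel p E) = ncomp E.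
Proof.
have [s hs] := conn_perm E; rewrite (ncomp_cyc hs) -(cycJ s p).
apply: ncomp_cyc => a b.
by rewrite -[a](permKV p) -[b](permKV p) coorbJ conn_relabel.
Qed.

Definition dpermf p (d : D) := (p d.1, p d.2).
Lemma dpermf_inj p : injective (dpermf p).
Proof. by move=> [a b] [c d] [] /perm_inj-> /perm_inj->. Qed.
Definition dperm p : {perm D} := perm (@dpermf_inj p).

Lemma dpermE p a b : dperm p (a, b) = (p a, p b).
Proof. by rewrite permE. Qed.

Lemma alpha_relabel p E : alpha (relabel p E) = alpha E ^ dperm p.
Proof.
apply/permP=> -[a b]; have [c ->] : exists c, a = p c by exists (p^-1 a); rewrite permKV.
have [d ->] : exists d, b = p d by exists (p^-1 b); rewrite permKV.
by rewrite -(dpermE p c d) permJ dpermE !alphaE mem_relabel2; case: ifP => _; rewrite dpermE.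
Qed.

Lemma fullrotJ p s : fullrot s -> fullrot (s ^ dperm p).
Proof.
move=> rs; have ks := rotn_kperm rs.
have ex (a b : T) : exists d, (a, b) = dperm p d.
  by exists (p^-1 a, p^-1 b); rewrite dpermE !permKV.
have dp1 d : (dperm p d).1 = p d.1 by case: d => a b; rewrite dpermE.
apply: rotnP.
  rewrite /kperm; apply/andP; split; first by apply/subsetP=> d; rewrite in_setT.
  apply/forallP=> -[a b]; have [d ->] := ex a b.
  by rewrite permJ !dp1 (kperm_col d ks).
move=> [a b] [c d] _ _; have [i ->] := ex a b; have [j ->] := ex c d.
rewrite coorbJ !dp1 => /perm_inj e.
by apply: (rotn_coorb rs); rewrite ?in_setT.
Qed.

Lemma Zmax_relabel p E : Zmax (relabel p E) = Zmax E.
Proof.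
suff le q F : Zmax F <= Zmax (relabel q F).
  by apply/eqP; rewrite eqn_leq le andbT -{2}(relabelK p E) le.
have [s rs ->] := Zmax_ex F; rewrite -(cycJ _ (dperm q)) conjMg -alpha_relabel.
by apply: Zmax_ge; apply: fullrotJ.
Qed.

(** Each cycle stays in one component, and every component is reached because every vertex has a
    padded dart. *)
Lemma ncomp_le_Zmax E : ncomp E <= Zmax E.
Proof.
have [s rs ->] := Zmax_ex E; have ks := rotn_kperm rs.
pose h (O : {set D}) := \bigcup_(d in O) cclass E d.1.
rewrite /ncomp; have -> : [set cclass E u | u in T] = h @: porbits (alpha E * s).
  have hE d : h (porbit (alpha E * s) d) = cclass E d.1.
    apply/setP=> v; apply/bigcupP/idP => [[c dc]|vd]; last first.
      by exists d => //; apply: coorb_refl.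
    rewrite !inE; apply: conn_trans.
    by apply: (coorb_conn (s := s)) => // a; rewrite (kperm_col a ks).
  apply/setP=> O; apply/imsetP/imsetP => [[u _ ->]|[P /imsetP[d _ ->] ->]].
    by exists (porbit (alpha E * s) (u, u)); rewrite ?hE // imset_f.
  by exists d.1; rewrite ?hE.
exact: leq_imset_card.
Qed.

(* A bridge of the graph separating x from y prevents alternation, because it
   is crossed only twice by the faces. *)
Lemma altE_bridge E u v x y : x != y -> [set u; v] \notin E -> u != v ->
  ~~ conn E x y -> altE x y ([set u; v] |: E) = false.
Proof.
move=> xy uvE uv nc; apply/altEP => -[s [rs _]].
have ks := rotn_kperm rs; rewrite alphaU1 // -mulgA tpermMl.
set f0 := alpha E * s; set p := f0 _; set q := f0 _.
(* The darts on the side of x, closed under the faces [f0] of the graph without the bridge. The cut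
   [tv] acts inside [S], while [y1] and [y2] lie outside. *)
pose S := [pred d : D | conn E x d.1].
have stS d : (f0 d \in S) = (d \in S).
  rewrite !inE; have : conn E d.1 (f0 d).1.
    apply: (coorb_conn (s := s)) (coorb_step _ _).
    by move=> a; rewrite (kperm_col a ks).
  move=> h; apply/idP/idP => h2; apply: conn_trans h2 _ => //.
  by rewrite conn_sym.
case/altP=> v1 [v2 [y1 [y2 [X1 X2 Y1 Y2 [sv sy ny]]]]].
have inS d : d \in fiber x -> d \in S by rewrite !inE => /eqP->; apply: conn_refl.
have ninS d : d \in fiber y -> d \notin S by rewrite !inE => /eqP->.
have S1 := inS _ X1; have S2 := inS _ X2.
have N1 := ninS _ Y1; have N2 := ninS _ Y2.
set tv := tperm v1 v2 in ny.
have tvN d : d \notin S -> tv d = d.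
  by move=> dS; rewrite /tv tpermD //; apply: contraNneq dS => <-.
have tvS d : (tv d \in S) = (d \in S).
  by rewrite /tv; case: tpermP => [->|->|_ _]; rewrite ?S1 ?S2.
have agree (a b : {perm D}) : (forall d, d \notin S -> a d \notin S) ->
    {in [predC S], a =1 b} -> coorb a y1 y2 -> coorb b y1 y2.
  move=> st ag co.
  have st' d : d \in [predC S] -> a d \in [predC S].
    by rewrite !inE => h; have := st d; rewrite !inE; apply.
  have N1' : y1 \in [predC S] by rewrite !inE; move: N1; rewrite inE.
  by have /andP[] := coorb_agree (P := [predC S]) st' ag N1' co.
have stN d : d \notin S -> f0 d \notin S by rewrite stS.
(* If [p] and [q] lie on the same side, the complement of [S] is invariant and the cut does nothing
   there. If they lie on different sides, the bridge merges two cycles, and [y1] and [y2] already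
   shared one before; the merging commutes with the cut. *)
case pS: (p \in S); case qS: (q \in S).
- case/negP: ny; apply: agree sy => [d dS|d].
    rewrite permM tpermD ?stN //; apply: contraTneq (stN _ dS) => <-;
    by rewrite negbK ?pS ?qS.
  rewrite inE => dS; rewrite [RHS]permM tvN // permM tpermD ?stN //;
    by apply: contraTneq (stN _ dS) => <-; rewrite negbK ?pS ?qS.
- have npq : ~~ coorb f0 p q.
    apply: contraFN qS => h; pattern q; apply: (coorb_ind h) => // d.
    by rewrite stS.
  move: sy; rewrite coorb_merge //.
  have out d c : c \in S -> d \notin S -> ~~ coorb f0 d c.
    move=> cS; apply: contra; rewrite coorb_sym => h.
    by pattern d; apply: (coorb_ind h) => // a; rewrite stS.
  rewrite (negPf (out _ _ pS N1)) (coorb_sym _ p) (negPf (out _ _ pS N2)) andbF !orbF.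
  move=> sy; case/negP: ny.
  have -> : f0 * tperm p q * tv = f0 * tv * tperm (tv p) (tv q).
    by rewrite -!mulgA -tpermMl.
  have stv d : ((f0 * tv) d \in S) = (d \in S) by rewrite permM tvS stS.
  apply: coorb_merge_sub.
    apply/negP => h; have : tv q \in S.
      pattern (tv q); apply: (coorb_ind h); first by rewrite tvS.
      by move=> d; rewrite stv.
    by rewrite tvS qS.
  by apply: agree sy => // d; rewrite inE => dS; rewrite [RHS]permM tvN // stN.
- have npq : ~~ coorb f0 p q.
    apply: contraFN pS; rewrite coorb_sym => h; pattern p.
    by apply: (coorb_ind h) => // d; rewrite stS.
  move: sy; rewrite coorb_merge //.
  have out d c : c \in S -> d \notin S -> ~~ coorb f0 d c.
    move=> cS; apply: contra; rewrite coorb_sym => h.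
    by pattern d; apply: (coorb_ind h) => // a; rewrite stS.
  rewrite (negPf (out _ _ qS N1)) (coorb_sym _ q) (negPf (out _ _ qS N2)) andbF !orbF.
  move=> sy; case/negP: ny.
  have -> : f0 * tperm p q * tv = f0 * tv * tperm (tv p) (tv q).
    by rewrite -!mulgA -tpermMl.
  have stv d : ((f0 * tv) d \in S) = (d \in S) by rewrite permM tvS stS.
  apply: coorb_merge_sub.
    apply/negP; rewrite coorb_sym => h; have : tv p \in S.
      pattern (tv p); apply: (coorb_ind h); first by rewrite tvS.
      by move=> d; rewrite stv.
    by rewrite tvS pS.
  by apply: agree sy => // d; rewrite inE => dS; rewrite [RHS]permM tvN // stN.
have stT d : d \notin S -> (f0 * tperm p q) d \notin S.
  move=> dS; rewrite permM; case: tpermP => [_|_|_ _]; rewrite ?pS ?qS //.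
  exact: stN.
case/negP: ny; apply: agree sy => // d; rewrite inE => dS.
by rewrite [RHS]permM tvN // stT.
Qed.
End Relabel.

(** * Subdivision and contraction of a bridge *)

Section Bridge.
Variable T : finType.
Implicit Types (E F : {set {set T}}) (V U W : {set T}) (u v w x y : T).

Lemma gE_relabel x y p E : x != y -> simple E -> gE (relabel p E) = gE E.
Proof.
move=> xy sE; have := gEE xy sE; have := gEE xy (relabel_simple p sE).
rewrite Zmax_relabel ncomp_relabel card_relabel.
set a := gE _; set b := gE E; set m := #|E|; rewrite -!addnn; clear; lia.
Qed.

(** Every component has at least one face. The estimate suffices to see that a path and a triangle
    are planar. *)
Lemma gE_small x y E : x != y -> simple E ->
  (gE E).*2 + nverts T <= ncomp E + #|E|.
Proof.
move=> xy sE; have := gEE xy sE; have := ncomp_le_Zmax E.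
set a := gE _; set m := #|E|; rewrite -!addnn; clear; lia.
Qed.

Lemma conn_closed E (U : {set T}) u v :
  (forall a b, [set a; b] \in E -> a \in U -> b \in U) ->
  conn E u v -> u \in U -> v \in U.
Proof.
move=> cl h uU; pose r a b := (a \in U) ==> (b \in U).
suff : r u v by rewrite /r uU.
move: u v h {uU}; apply: (connect_min (r := r)).
- by move=> a; rewrite /r implybb.
- by move=> b a c; rewrite /r => /implyP ab /implyP bc; apply/implyP => /ab.
by move=> a b /cl ab; apply/implyP.
Qed.

Definition isolated E u := forall w, [set u; w] \notin E.

Lemma isolated_inside E W u : inside E W -> u \notin W -> isolated E u.
Proof. by move=> h uW w; apply: contraNN uW => /h. Qed.

Lemma isolatedU1 E u a b : isolated E u -> u != a -> u != b ->
  isolated ([set a; b] |: E) u.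
Proof.
move=> iso ua ub w; rewrite in_setU1 negb_or iso andbT.
apply/eqP => /setP/(_ u); rewrite !inE eqxx /= => /esym/orP[]/eqP e.
  by rewrite e eqxx in ua.
by rewrite e eqxx in ub.
Qed.

Lemma conn_isolated E u w : isolated E u -> u != w -> conn E u w = false.
Proof.
move=> iso uw; apply: contraNF uw => h.
have := conn_closed (U := [set u]) _ h; rewrite !inE eqxx eq_sym; apply=> //.
by move=> a b ab; rewrite inE => /eqP ea; rewrite ea (negPf (iso b)) in ab.
Qed.

Lemma gE_pendant E u v : u != v -> simple E -> isolated E u ->
  gE ([set u; v] |: E) = gE E.
Proof.
move=> uv sE iso; have [] := plus_unconn uv sE (iso v) => //.
by rewrite conn_isolated.
Qed.

(** By [altE_degree], since [v] is the only neighbour of [u] besides [w]. *)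
Lemma altE_pendant E u v w : u != w -> w != v -> u != v -> simple E ->
  isolated E u -> altE u w ([set u; w] |: ([set u; v] |: E)) = false.
Proof.
move=> uw wv uv sE iso; have sF := simple_add uv sE.
have ne : [set u; w] \notin [set u; v] |: E.
  rewrite in_setU1 negb_or iso andbT; apply/eqP=> /set2_inj[] [e1 e2].
    by rewrite e2 eqxx in wv.
  by rewrite e1 eqxx in uv.
apply: contraTF isT => /(altE_degree uw ne).
rewrite (_ : [set _ | _] = [set v]) ?cards1 //; apply/setP=> b; rewrite !inE (negPf (iso b)) orbF.
by apply/eqP/eqP => [/set2_inj[] [e1 e2]|-> //]; rewrite // e2.
Qed.

Lemma inside_add E W a b : inside E W -> a \in W -> b \in W ->
  inside ([set a; b] |: E) W.
Proof.
move=> h aW bW u v; rewrite in_setU1 => /orP[/eqP/setP/(_ u)|/h//].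
by rewrite !inE eqxx => /esym/orP[]/eqP->.
Qed.

Lemma inside_sub E F W : inside E W -> F \subset E -> inside F W.
Proof. by move=> h FE u v /(subsetP FE)/h. Qed.

Lemma insideS E V W : V \subset W -> inside E V -> inside E W.
Proof. by move=> VW h u v /h/(subsetP VW). Qed.

(** The path through [u] is one part of a sum at [v] and [x]. It is planar, also together with the
    edge vx, and the latter graph is not alternating; so the sum formulas see no difference between
    the path and the edge. *)
Lemma gE_subdivide E u v x : u != v -> u != x -> v != x -> simple E ->
  isolated E u -> conn E v x ->
  gE ([set u; v] |: ([set u; x] |: E)) = gE ([set v; x] |: E).
Proof.
move=> uv ux vx sE iso k.
have s0 : simple (set0 : {set {set T}}) by apply/simpleP=> f; rewrite inE.
have i0 a : isolated (set0 : {set {set T}}) a by move=> w; rewrite inE.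
pose P : {set {set T}} := [set u; v] |: ([set u; x] |: set0).
have sP : simple P by do 2![apply: simple_add => //].
have nvx : [set v; x] \notin P.
  rewrite !in_setU1 in_set0 orbF negb_or.
  by apply/andP; split; apply/eqP => /setP/(_ u); rewrite !inE eqxx (negPf uv) (negPf ux).
have nuv : [set u; v] \notin [set u; x] |: set0.
  rewrite in_setU1 in_set0 orbF.
  by apply/eqP => /setP/(_ v); rewrite !inE eqxx orbT ![v == _]eq_sym (negPf uv) eq_sym (negPf vx).
have cP : #|P| = 2 by rewrite !cardsU1 nuv in_set0 cards0.
have nP : ncomp P + 2 = nverts T.
  have := ncomp_add ([set u; x] |: set0) u v; have := ncomp_add set0 u x.
  rewrite conn_add conn_refl !(conn_isolated (i0 _)) ?ncomp0 //=; last by rewrite eq_sym.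
  by move=> <- <-; rewrite -addnA.
have gP : gE P = 0.
  have := gE_small uv sP; rewrite cP; move: nP; rewrite -!addnn; clear; lia.
have kP : conn P v x.
  by apply: (@conn_trans _ _ u); [rewrite conn_sym|]; apply: conn_edge; rewrite !inE eqxx ?orbT.
have gvP : gE ([set v; x] |: P) = 0.
  have := gE_small uv (simple_add vx sP); rewrite cardsU1 nvx cP.
  have := ncomp_add P v x; rewrite kP; move: nP; rewrite -!addnn; clear; lia.
have aP : altE v x ([set v; x] |: P) = false.
  have vu : v != u by rewrite eq_sym.
  have xu : x != u by rewrite eq_sym.
  have sux : simple ([set u; x] |: set0) by apply: simple_add.
  rewrite /P (_ : [set u; v] = [set v; u]); last exact: setUC.
  by apply: (altE_pendant vx xu vu sux); apply: isolatedU1.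
pose E' := E :\ [set v; x].
have sE' : simple E' by apply: simple_sub sE; apply: subsetDl.
have in1 : inside E (~: [set u]).
  by move=> a b ab; rewrite !inE; apply: contraTneq ab => ->.
have in1' : inside E' (~: [set u]) by apply: inside_sub in1 _; apply: subsetDl.
have in2 : inside P [set u; v; x].
  by do 2![apply: inside_add; rewrite ?inE ?eqxx ?orbT //]; move=> a b; rewrite inE.
have V12 : ~: [set u] :&: [set u; v; x] \subset [set v; x].
  by apply/subsetP=> a; rewrite !inE; case: (a == u).
have nE' : [set v; x] \notin E' by rewrite !inE eqxx.
have -> : [set u; v] |: ([set u; x] |: E) = E :|: P.
  by rewrite /P setU0 [RHS]setUC -setUA.
case: (boolP ([set v; x] \in E)) => vxE.
  have := genus_sum_plus vx V12 in1' in2 sE' sP nE' nvx.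
  have -> : [set v; x] |: (E' :|: P) = E :|: P by rewrite setUA setD1K.
  rewrite aP andbF addn0 gvP addn0 setD1K // => ->.
  by rewrite (setUidPr _) ?sub1set.
have := genus_sum_plus vx V12 in1 in2 sE sP vxE nvx.
rewrite aP andbF addn0 gvP addn0 => e.
have := genus_sum vx V12 in1 in2 sE sP vxE nvx k kP.
rewrite e gP addn0 => ->; apply/minn_idPr.
by have /andP[] := genus_plus vx sE vxE.
Qed.

(** The right-hand side depends on [F] only through its genera without and with xu, so that two
    choices of [F] can be compared. *)
Lemma genus_sum_unalt x u A F V1 V2 : x != u ->
  V1 :&: V2 \subset [set x; u] -> inside A V1 -> inside F V2 ->
  simple A -> simple F -> [set x; u] \notin F -> conn A x u -> conn F x u ->
  altE x u ([set x; u] |: F) = false ->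
  gE (A :|: F) = if [set x; u] \in A then gE A + gE ([set x; u] |: F)
    else minn (gE A + gE F).+1 (gE ([set x; u] |: A) + gE ([set x; u] |: F)).
Proof.
move=> xu V12 iA iF sA sF nF kA kF aF; case: ifP => xuA.
  pose A' := A :\ [set x; u].
  have nA : [set x; u] \notin A' by rewrite !inE eqxx.
  have sA' : simple A' by apply: simple_sub sA; apply: subsetDl.
  have iA' : inside A' V1 by apply: inside_sub iA _; apply: subsetDl.
  have := genus_sum_plus xu V12 iA' iF sA' sF nA nF.
  have -> : [set x; u] |: (A' :|: F) = A :|: F by rewrite setUA setD1K.
  by rewrite aF andbF addn0 setD1K.
rewrite (genus_sum xu V12 iA iF sA sF (negbT xuA) nF kA kF).
have := genus_sum_plus xu V12 iA iF sA sF (negbT xuA) nF.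
by rewrite aF andbF addn0 => ->.
Qed.

Section Contraction.
Variables (A B : {set {set T}}) (U W : {set T}) (u v x y : T).
Hypotheses (UW : [disjoint U & W]) (iA : inside A U) (iB : inside B W).
Hypotheses (sA : simple A) (sB : simple B).
Hypotheses (uU : u \in U) (xU : x \in U) (vW : v \in W) (yW : y \in W).
Hypotheses (kA : conn A x u) (kB : conn B v y).

Let sepn a b : a \in U -> b \in W -> a != b.
Proof. by move=> aU bW; apply: contraTneq aU => ->; rewrite (disjointFl UW). Qed.
Let uv : u != v. Proof. exact: sepn. Qed.
Let notA w a : w \in W -> [set w; a] \notin A.
Proof. by move=> wW; apply: contraTN wW => /iA h; rewrite (disjointFr UW). Qed.
Let notB w : w \in U -> isolated B w.
Proof. by move=> wU a; apply: contraTN wU => /iB h; rewrite (disjointFl UW). Qed.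
Let UW0 a b : U :&: W \subset [set a; b].
Proof. by move: UW; rewrite -setI_eq0 => /eqP->; apply: sub0set. Qed.

(** [H] is the graph with the bridge uv, and [A :|: B'] is its contraction onto the end [u]. *)
Let p := tperm u v.
Let B' := relabel p B.
Let H := [set u; v] |: (A :|: B).

Let nkA a b : a \in U -> b \in W -> ~~ conn A a b.
Proof.
move=> aU bW; apply: contraL bW => h.
rewrite (disjointFr UW) //; apply: conn_closed h aU => c d cd _.
by have [] := insideR iA cd.
Qed.
Let sB' : simple B'. Proof. exact: relabel_simple. Qed.
Let iB' : inside B' (u |: (W :\ v)).
Proof.
move=> a b ab; have [c ea] : exists c, a = p c by exists (p a); rewrite tpermK.
have [d eb] : exists d, b = p d by exists (p b); rewrite tpermK.
move: ab; rewrite ea eb mem_relabel2 => /iB cW; rewrite /p.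
case: tpermP => [e|_|_ /eqP cv]; rewrite !inE ?eqxx ?orbT //.
- by move: cW; rewrite e (disjointFr UW).
by rewrite cv cW orbT.
Qed.

Let nA : [set u; v] \notin A. Proof. by rewrite setUC notA. Qed.
Let nB : [set u; v] \notin B. Proof. exact: notB. Qed.
Let sAB : simple (A :|: B). Proof. exact: simpleU. Qed.
Let nAB : [set u; v] \notin A :|: B. Proof. by rewrite inE negb_or nA. Qed.

Lemma conn_disjoint a b : a \in U -> b \in W -> ~~ conn (A :|: B) a b.
Proof.
move=> aU bW; apply: contraL bW => h.
rewrite (disjointFr UW) //; apply: conn_closed h aU => c d.
rewrite in_setU => /orP[cd _|cd cU]; first by have [] := insideR iA cd.
by move: cd; rewrite (negPf (notB cU d)).
Qed.

Lemma genus_disjoint : gE (A :|: B) = gE A + gE B.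
Proof. exact: (genus_sum_split uv (UW0 u v) iA iB sA sB nA (nkA uU vW)). Qed.

Lemma bridge_genus : gE H = gE A + gE B.
Proof. by have [-> _] := plus_unconn uv sAB nAB (conn_disjoint uU vW); exact: genus_disjoint. Qed.

Lemma contracted_genus : gE (A :|: B') = gE A + gE B.
Proof.
have V12 : U :&: (u |: (W :\ v)) \subset [set u; v].
  apply/subsetP=> a; rewrite !inE => /andP[aU] /orP[->//|/andP[_ aW]].
  by move: aU; rewrite (disjointFl UW).
rewrite (genus_sum_split uv V12 iA iB' sA sB' nA (nkA uU vW)).
by rewrite (gE_relabel p uv sB).
Qed.

Hypothesis vy : v != y.

Let xy : x != y. Proof. exact: sepn. Qed.
Let uy : u != y. Proof. exact: sepn. Qed.
Let py : p y = y. Proof. by rewrite /p tpermD. Qed.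
Let pv : p v = u. Proof. exact: tpermR. Qed.
Let kB' : conn B' u y. Proof. by rewrite -pv -py conn_relabel. Qed.
Let gB' : gE B' = gE B. Proof. exact: gE_relabel uv sB. Qed.
Let gvB : gE ([set u; y] |: B') = gE ([set v; y] |: B).
Proof.
rewrite -{1}pv -{1}py -relabelU1 (gE_relabel p uv) //.
exact: simple_add.
Qed.

(** If [x = u], the set [A] is attached at [u] only, and the bridge together with xy forms a
    subdivided edge from [v] to [y]. Otherwise [A] is one part of a sum at [x] and [u]; in the other
    part [x] has a single neighbour apart from [u], so it does not alternate, and its genera with
    and without xu agree before and after contraction by the results on pendant edges and
    subdivisions. *)
Lemma contracted_genus_plus :
  gE ([set x; y] |: (A :|: B')) = gE ([set x; y] |: H).
Proof.
have suB : simple ([set u; v] |: B) by apply: simple_add.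
have [ex|xu] := eqVneq x u.
  have V12 : U :&: (u |: W) \subset [set u; v].
    apply/subsetP=> a; rewrite !inE => /andP[aU] /orP[->//|aW].
    by move: aU; rewrite (disjointFl UW).
  rewrite ex /H.
  have -> : [set u; y] |: (A :|: B') = A :|: ([set u; y] |: B') by rewrite setUCA.
  have -> : [set u; y] |: ([set u; v] |: (A :|: B)) =
      A :|: ([set u; v] |: ([set u; y] |: B)).
    by apply/setP=> f; rewrite !in_setU; case: (f \in A); rewrite ?orbT //= orbCA.
  have wU : inside B' (u |: W) by apply: insideS iB'; apply: setUS; apply: subsetDl.
  have wB : inside B (u |: W) by apply: insideS iB; apply: subsetUr.
  have uW : u \in u |: W by rewrite setU11.
  have yW' : y \in u |: W by rewrite setU1r.
  have vW' : v \in u |: W by rewrite setU1r.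
  have i1 : inside ([set u; y] |: B') (u |: W) by apply: inside_add.
  have i2 : inside ([set u; v] |: ([set u; y] |: B)) (u |: W).
    by do 2! apply: inside_add => //.
  rewrite (genus_sum_split uv V12 iA i1 sA _ nA (nkA uU vW)) ?simple_add //.
  rewrite (genus_sum_split uv V12 iA i2 sA _ nA (nkA uU vW)) ?simple_add //.
  by rewrite gvB gE_subdivide //; apply: notB.
have V12 : U :&: (x |: (u |: W)) \subset [set x; u].
  apply/subsetP=> a; rewrite !inE => /andP[aU]; rewrite orbA => /orP[//|].
  by rewrite (disjointFr UW).
have wB' : inside B' (x |: (u |: W)).
  apply: insideS iB'; apply: subset_trans (subsetUr _ _); apply: setUS.
  exact: subsetDl.
have wB : inside B (x |: (u |: W)).
  by apply: insideS iB; apply: subset_trans (subsetUr _ _); apply: subsetUr.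
have [xS uS] : x \in x |: (u |: W) /\ u \in x |: (u |: W).
  by rewrite !inE !eqxx orbT.
have [vS yS] : v \in x |: (u |: W) /\ y \in x |: (u |: W).
  by rewrite !inE vW yW !orbT.
have ux : u != x by rewrite eq_sym.
pose F := [set x; y] |: ([set u; v] |: B); pose F' := [set x; y] |: B'.
have xB : isolated B x by apply: notB.
have xuB : isolated ([set u; v] |: B) x by apply: isolatedU1 => //; apply: sepn.
have xB' : isolated B' x.
  apply: isolated_inside iB' _; rewrite !inE negb_or xu.
  by rewrite (disjointFr UW xU) andbF.
have sF : simple F by apply: simple_add.
have sF' : simple F' by apply: simple_add.
have iF : inside F (x |: (u |: W)) by do 2! apply: inside_add => //.
have iF' : inside F' (x |: (u |: W)) by apply: inside_add.
have nF : [set x; u] \notin F.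
  rewrite in_setU1 negb_or xuB andbT; apply/eqP => /set2_inj[] [_ e].
    by move: uy; rewrite e eqxx.
  by rewrite e eqxx in xu.
have nF' : [set x; u] \notin F'.
  rewrite in_setU1 negb_or xB' andbT; apply/eqP => /set2_inj[] [_ e].
    by move: uy; rewrite e eqxx.
  by rewrite e eqxx in xu.
have kF : conn F x u.
  apply: (@conn_trans _ _ y); first by apply: conn_edge; rewrite !inE eqxx.
  apply: (@conn_trans _ _ v).
    by rewrite conn_sym; apply: conn_sub kB; do 2! apply: subset_trans (subsetUr _ _).
  by apply: conn_edge; rewrite (setUC [set v]) !inE eqxx orbT.
have kF' : conn F' x u.
  apply: (@conn_trans _ _ y); first by apply: conn_edge; rewrite !inE eqxx.
  by rewrite conn_sym; apply: conn_sub kB'; apply: subsetUr.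
have yu : y != u by rewrite eq_sym.
have aF : altE x u ([set x; u] |: F) = false by apply: altE_pendant.
have aF' : altE x u ([set x; u] |: F') = false by apply: altE_pendant.
have -> : [set x; y] |: (A :|: B') = A :|: F' by rewrite setUCA.
have -> : [set x; y] |: H = A :|: F.
  by apply/setP=> f; rewrite !in_setU; case: (f \in A); rewrite ?orbT.
rewrite (genus_sum_unalt xu V12 iA iF sA sF nF kA kF aF).
rewrite (genus_sum_unalt xu V12 iA iF' sA sF' nF' kA kF' aF').
have -> : gE F = gE F'.
  by rewrite !gE_pendant ?gB' //; apply: notB.
suff -> : gE ([set x; u] |: F) = gE ([set x; u] |: F') by [].
have kuy : conn ([set u; v] |: B) u y.
  by apply: conn_trans (conn_sub (subsetUr _ _) kB); apply: conn_edge; rewrite setU11.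
rewrite /F /F' !(gE_subdivide xu xy uy) // gvB.
by rewrite setUCA gE_subdivide //; apply: notB.
Qed.
End Contraction.
End Bridge.

(** * Minor operations on edge sets *)

Section Ops.
Variables (T : finType) (x y : T).
Hypothesis xy : x != y.
Implicit Types (E F : {set {set T}}) (V : {set T}) (f h : {set T}) (a b z : T).
Local Notation e := [set x; y].
Local Notation cm := (contract_map x y).

Lemma contract_vertex_in f : #|f| == 2 -> contract_vertex x y f \in f.
Proof.
rewrite /contract_vertex => f2; case: ifP => // _; case: ifP => // _.
by case: pickP => //= h; rewrite (eq_card0 h) in f2.
Qed.

Lemma contract_map_x f : cm f x = x.
Proof. by rewrite /contract_map /contract_vertex; case: ifP => // ->. Qed.

Lemma contract_map_y f : f != e -> #|f| == 2 -> cm f y = y.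
Proof.
move=> ne f2; rewrite /contract_map; case: ifP => // yf; rewrite /contract_vertex yf.
case: (boolP (x \in f)) => // xf; case/negP: ne.
by rewrite eq_sym eqEcard subUset !sub1set xf yf (eqP f2) cards2 xy.
Qed.

Lemma contract_map_closed f V z : #|f| == 2 -> f \subset V -> z \in V ->
  cm f z \in V.
Proof.
move=> f2 fV zV; rewrite /contract_map; case: ifP => // _.
by apply: (subsetP fV); apply: contract_vertex_in.
Qed.

Definition econtract f E : {set {set T}} :=
  [set h in [set cm f @: (h : {set T}) | h in E] | #|h| == 2].

Lemma econtractP f E h :
  reflect (exists2 h', h' \in E & h = cm f @: h' /\ #|h| == 2)
          (h \in econtract f E).
Proof.
rewrite inE; apply: (iffP andP) => [[/imsetP[h' hE eh] h2]|[h' hE [eh h2]]].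
  by exists h'.
by split=> //; apply/imsetP; exists h'.
Qed.

Lemma econtract_simple f E : simple (econtract f E).
Proof. by apply/simpleP=> h /econtractP[h' _ []]. Qed.

Lemma econtract_edge f E a b : simple E -> [set a; b] \in econtract f E ->
  exists c d, [/\ [set c; d] \in E, a = cm f c & b = cm f d].
Proof.
move=> /simpleP sE /econtractP[h hE [eh _]].
have /cards2P[c [d [_ ehc]]] := sE h hE.
move: eh; rewrite ehc imsetU !imset_set1 => /set2_inj[] [-> ->].
  by exists c, d; rewrite -ehc.
by exists d, c; rewrite (setUC [set d]) -ehc.
Qed.

Lemma econtract_inside f E V : simple E -> inside E V -> #|f| == 2 ->
  f \subset V -> inside (econtract f E) V.
Proof.
move=> sE iE f2 fV a b /(econtract_edge sE)[c [d [cd -> _]]].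
by apply: contract_map_closed => //; apply: iE cd.
Qed.

Lemma conn_econtract f E a b : conn E a b ->
  conn (econtract f E) (cm f a) (cm f b).
Proof.
move: a b; apply: (connect_min (r := fun a b => conn (econtract f E) (cm f a) (cm f b))).
- by move=> a; apply: conn_refl.
- by move=> b a c; apply: conn_trans.
move=> a b ab; have [->|ne] := eqVneq (cm f a) (cm f b); first exact: conn_refl.
apply: conn_edge; apply/econtractP; exists [set a; b] => //.
by rewrite imsetU !imset_set1 cards2 ne.
Qed.

Lemma econtractU f E F : econtract f (E :|: F) = econtract f E :|: econtract f F.
Proof.
apply/setP=> h; apply/econtractP/setUP.
  case=> h'; rewrite in_setU => /orP[hE|hE] hh; [left|right];
  by apply/econtractP; exists h'.
by case=> /econtractP[h' hE hh]; exists h'; rewrite // inE hE ?orbT.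
Qed.

Lemma econtract_inj f E (p : T -> T) : simple E -> injective p ->
  (forall h, h \in E -> {in h, cm f =1 p}) ->
  econtract f E = [set p @: (h : {set T}) | h in E].
Proof.
move=> /simpleP sE pI ep; apply/setP=> h; apply/econtractP/imsetP => -[h' hE].
  by case=> -> _; exists h'; rewrite // (eq_in_imset (ep h' hE)).
by move=> ->; exists h'; rewrite // (eq_in_imset (ep h' hE)) card_imset // sE.
Qed.

Lemma econtract_id f E : simple E ->
  (forall h z, h \in E -> z \in h -> cm f z = z) -> econtract f E = E.
Proof.
move=> sE ep; rewrite (econtract_inj sE (p := id)) //.
  by rewrite -[RHS]imset_id; apply: eq_imset => h; rewrite imset_id.
by move=> h hE z; apply: ep.
Qed.

Lemma econtract_relabel f E (p : {perm T}) : simple E ->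
  (forall h z, h \in E -> z \in h -> cm f z = p z) -> econtract f E = relabel p E.
Proof.
move=> sE ep; rewrite (econtract_inj sE (p := p)) //; first exact: perm_inj.
by move=> h hE z; apply: ep.
Qed.

Lemma econtract_self f : #|f| == 2 -> econtract f [set f] = set0.
Proof.
move=> f2; apply/setP=> h; rewrite [RHS]inE; apply/econtractP => -[h' /set1P-> [-> ]].
rewrite (_ : _ @: f = [set contract_vertex x y f]) ?cards1 //.
apply/setP=> z; apply/imsetP/set1P => [[c cf ->]|->].
  by rewrite /contract_map cf.
exists (contract_vertex x y f); first exact: contract_vertex_in.
by rewrite /contract_map contract_vertex_in.
Qed.

Lemma edges_contract f (G : graph T) :
  edges (contract x y f G) = econtract f (edges G).
Proof.
apply/setP=> h; rewrite /econtract !inE.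
case: imsetP => //= -[h' /edgesP[hV _] ->].
by rewrite imsetS.
Qed.

Lemma edges_delete f (G : graph T) : edges (delete f G) = edges G :\ f.
Proof.
apply/setP=> h; rewrite inE andbC; case: (boolP (h \in edges G :\ f)) => [|_].
  by rewrite inE => /andP[_ /edgesP[-> ->]].
by rewrite andbF.
Qed.

Lemma edges_add_xy (G : graph T) : x \in verts G -> y \in verts G ->
  edges (add_xy x y G) = e |: edges G.
Proof.
move=> xV yV; apply/setP=> h; rewrite inE in_setU1; case: eqP => [->|_] /=.
  by rewrite cards2 xy subUset !sub1set xV yV.
by case: (boolP (h \in edges G)) => // /edgesP[-> ->].
Qed.

Definition eop (mu : minor_op T) E : {set {set T}} :=
  if mu.2 then econtract mu.1 E else E :\ mu.1.

Lemma edges_apply_op mu (G : graph T) :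
  edges (apply_op x y mu G) = eop mu (edges G).
Proof. by rewrite /apply_op /eop; case: ifP => _; rewrite ?edges_contract ?edges_delete. Qed.

Section Spec.
Variables (V1 V2 : {set T}) (E2 : {set {set T}}).
Hypotheses (V12 : V1 :&: V2 \subset e) (in2 : inside E2 V2).
Hypotheses (s2 : simple E2) (eE2 : e \notin E2) (k2 : conn E2 x y).

(** What tightness needs to know about a minor [F] of the first part, in a form that is valid also
    when a contraction has created the edge xy. *)
Definition sum_spec F :=
 [/\ gE F <= gE (e |: F) <= (gE F).+1,
     gE (e |: (F :|: E2)) + (altE x y (e |: F) && altE x y (e |: E2)) =
       gE (e |: F) + gE (e |: E2),
     conn F x y -> gE (F :|: E2) = minn (gE F + gE E2).+1 (gE (e |: (F :|: E2))),
     ~~ conn F x y ->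
       [/\ gE (F :|: E2) = gE F + gE E2, gE (e |: F) = gE F & altE x y (e |: F) = false]
   & altE x y F = (gE (e |: F) == gE F) && altE x y (e |: F)].

Lemma sum_specP F : inside F V1 -> simple F -> sum_spec F.
Proof.
move=> in1 s1; case: (boolP (e \in F)) => eF; last first.
  split; first exact: genus_plus.
  - exact: (genus_sum_plus xy V12).
  - by move=> k1; apply: (genus_sum xy V12).
  - move=> k1; have [-> ->] := plus_unconn xy s1 eF k1.
    by split=> //; apply: (genus_sum_split xy V12 in1 in2).
  exact: altE_genus.
have eFE : e |: F = F by apply/setUidPr; rewrite sub1set.
have eFE2 : e |: (F :|: E2) = F :|: E2 by rewrite setUA eFE.
have sp : gE (F :|: E2) + (altE x y F && altE x y (e |: E2)) = gE F + gE (e |: E2).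
  pose F' := F :\ e.
  have s' : simple F' by apply: simple_sub s1; apply: subsetDl.
  have in' : inside F' V1 by apply: inside_sub in1 _; apply: subsetDl.
  have nF' : e \notin F' by rewrite !inE eqxx.
  have := genus_sum_plus xy V12 in' in2 s' s2 nF' eE2.
  by rewrite setUA setD1K.
have kF : conn F x y by apply: conn_edge.
rewrite /sum_spec eFE eFE2 kF eqxx sp leqnn leqnSn; split=> //.
move=> _; apply/esym/minn_idPr; have /andP[_] := genus_plus xy s2 eE2; move: sp.
set p := gE (_ :|: _); set q := _ && _; set r := gE F; set t := gE (_ |: _).
by set u := gE E2; clear; lia.
Qed.
End Spec.
End Ops.

Section BridgeOps.
Variables (T : finType) (x y : T).
Hypothesis xy : x != y.
Local Notation e := [set x; y].
Local Notation cm := (contract_map x y).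

Lemma econtract_bridge (A B : {set {set T}}) (U W : {set T}) u v :
  [disjoint U & W] -> inside A U -> inside B W -> simple A -> simple B ->
  u \in U -> v \in W -> contract_vertex x y [set u; v] = u ->
  econtract x y [set u; v] ([set u; v] |: (A :|: B)) =
    A :|: relabel (tperm u v) B.
Proof.
move=> UW iA iB sA sB uU vW cu.
have vU : v \notin U by rewrite (disjointFl UW).
have uW : u \notin W by rewrite (disjointFr UW).
have uv : u != v by apply: contraNneq vU => <-.
have mem (E : {set {set T}}) V (h : {set T}) z : simple E -> inside E V -> h \in E -> z \in h -> z \in V.
  move=> /simpleP sE iE hE; have /cards2P[c [d [_ eh]]] := sE h hE.
  by rewrite eh in hE *; have [cV dV] := insideR iE hE; case/set2P=> ->.
rewrite !econtractU econtract_self ?cards2 ?uv // set0U.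
rewrite (@econtract_id _ x y _ A) //.
  rewrite (@econtract_relabel _ x y _ B (tperm u v)) // => h z hB zh.
  have zW := mem _ _ _ _ sB iB hB zh; rewrite /contract_map in_set2.
  have zu : z != u by apply: contraNneq uW => <-.
  rewrite (negPf zu) /=; have [->|zv] := eqVneq z v; first by rewrite tpermR.
  by rewrite tpermD // eq_sym.
move=> h z hA zh; have zU := mem _ _ _ _ sA iA hA zh.
have zv : z != v by apply: contraNneq vU => <-.
by rewrite /contract_map in_set2 (negPf zv) orbF; case: eqP => // ->.
Qed.

Variables (E : {set {set T}}) (b : {set T}).
Hypotheses (sE : simple E) (eE : e \notin E) (bE : b \in E).
Hypotheses (kE : conn E x y) (nk : ~~ conn (E :\ b) x y).

Lemma bridge_split : exists u v (A B : {set {set T}}) (U : {set T}),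
  [/\ [/\ b = [set u; v], E = b |: (A :|: B), inside A U & inside B (~: U)],
      [/\ u \in U, x \in U, v \in ~: U & y \in ~: U],
      conn A x u, conn B v y & simple A /\ simple B].
Proof.
pose E' := E :\ b; have nk' : ~~ conn E' x y by exact: nk.
have sE' : simple E' by apply: simple_sub sE; apply: subsetDl.
have [u [v [eb xu vy]]] : exists u v, [/\ b = [set u; v], conn E' x u & conn E' v y].
  have /cards2P[u [v [_ eb]]] := simpleP _ sE b bE.
  move: kE; rewrite -(setD1K bE) eb conn_add -eb -/E' (negPf nk') /=.
  case/orP=> /andP[h1 h2]; first by exists u, v.
  by exists v, u; rewrite eb setUC.
pose U := cclass E' x.
have cU a c : [set a; c] \in E' -> (a \in U) = (c \in U).
  move=> ac; rewrite !inE; apply/idP/idP => h; apply: conn_trans h _.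
    exact: conn_edge.
  by apply: conn_edge; rewrite setUC.
pose A := [set h in E' | h \subset U]; pose B := [set h in E' | h \subset ~: U].
have inA a c : ([set a; c] \in A) = ([set a; c] \in E') && (a \in U).
  rewrite inE subUset !sub1set; case h: (_ \in E') => //=.
  by rewrite -(cU _ _ h) andbb.
have inB a c : ([set a; c] \in B) = ([set a; c] \in E') && (a \notin U).
  rewrite inE subUset !sub1set; case h: (_ \in E') => //=.
  by rewrite !in_setC -(cU _ _ h) andbb.
have xU : x \in U by rewrite inE conn_refl.
have yU : y \notin U by rewrite inE.
have uU : u \in U by rewrite inE.
have vU : v \notin U.
  by rewrite inE; apply: contra nk' => h; apply: conn_trans h vy.
exists u, v, A, B, U; split; rewrite ?in_setC //.
- split=> //; last 2 first.
  + by move=> a c; rewrite inA => /andP[].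
  + by move=> a c; rewrite inB in_setC => /andP[].
  rewrite -{1}(setD1K bE); congr (_ |: _); rewrite -/E'; apply/setP=> h; rewrite in_setU.
  case: (boolP (h \in E')) => hE; last first.
    have hA : h \notin A by apply: contra hE; rewrite inE => /andP[].
    have hB : h \notin B by apply: contra hE; rewrite inE => /andP[].
    by rewrite (negPf hA) (negPf hB).
  have /cards2P[c [d [_ eh]]] := simpleP _ sE' h hE.
  by rewrite eh in hE *; rewrite inA inB hE; case: (_ \in U).
- suff : u \in cclass A x by rewrite inE.
  apply: (conn_closed _ xu); last by rewrite inE conn_refl.
  move=> a c ac; rewrite !inE => h; apply: (conn_trans h); apply: conn_edge.
  rewrite inA ac inE /=; apply: conn_sub h; apply/subsetP=> h.
  by rewrite inE => /andP[].
- suff : y \in cclass B v by rewrite inE.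
  apply: (conn_closed _ vy); last by rewrite inE conn_refl.
  move=> a c ac; rewrite !inE => h; apply: (conn_trans h); apply: conn_edge.
  rewrite inB ac /=; apply: contra vU; rewrite !inE => xa; apply: conn_trans xa _.
  rewrite conn_sym; apply: conn_sub h; apply/subsetP=> h.
  by rewrite inE => /andP[].
by split; apply: simple_sub sE'; apply/subsetP=> h; rewrite inE => /andP[].
Qed.

Lemma bridge_genera : [/\ gE (E :\ b) = gE E, gE (econtract x y b E) = gE E &
  gE (e |: econtract x y b E) = gE (e |: E)].
Proof.
have [u [v [A [B [U [[eb EE iA iB] [uU xU vW yW] xu vy [sA sB]]]]]]] := bridge_split.
have UW : [disjoint U & ~: U] by rewrite -setI_eq0 setICr.
have WU : [disjoint ~: U & U] by rewrite disjoint_sym.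
have uv : u != v by apply: contraTneq uU => ->; rewrite -in_setC.
have gD : gE (E :\ b) = gE E.
  have -> : E :\ b = A :|: B.
    rewrite EE setU1K // eb in_setU negb_or; apply/andP; split.
      by rewrite setUC; apply/negP => /iA h; rewrite in_setC h in vW.
    by apply/negP => /iB; rewrite in_setC uU.
  rewrite EE eb (bridge_genus UW iA iB sA sB uU vW).
  exact: (genus_disjoint UW iA iB sA sB uU vW).
have nb : (x == u) && (y == v) = false.
  apply: contraNF eE => /andP[/eqP-> /eqP->]; by rewrite -eb.
have xv : (x == v) = false by apply: contraTF xU => /eqP->; rewrite -in_setC.
have yu : (y == u) = false by apply: contraTF yW => /eqP->; rewrite in_setC uU.
(* The end that disappears is never a terminal, as [contracted_genus_plus] requires; if it is [u],
   the two sides exchange their roles. *)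
have cv : contract_vertex x y b = u /\ y != v \/ contract_vertex x y b = v /\ x != u.
  have b2 : #|b| == 2 by rewrite eb cards2 uv.
  have [ex|nx] := eqVneq x u.
    left; split; first by rewrite /contract_vertex eb in_set2 ex eqxx.
    by apply: contraFN nb => /eqP->; rewrite ex !eqxx.
  have [ey|ny] := eqVneq y v.
    right; split=> //; rewrite /contract_vertex eb !in_set2 xv (negPf nx).
    by rewrite ey eqxx orbT.
  by have := contract_vertex_in x y b2; rewrite {2}eb in_set2 => /orP[]/eqP; [left|right].
split=> //; case: cv => -[cv nv].
- rewrite EE eb (econtract_bridge UW iA iB sA sB uU vW) -?eb //.
  by rewrite (contracted_genus UW iA iB sA sB uU vW) eb (bridge_genus UW iA iB sA sB uU vW).
- rewrite EE eb (setUC [set u]) (setUC A).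
  rewrite (econtract_bridge WU iB iA sB sA vW uU) ?(setUC [set v]) -?eb //.
  by rewrite (contracted_genus WU iB iA sB sA vW uU) eb (setUC [set u]) (bridge_genus WU iB iA sB sA vW uU).
- rewrite EE eb (econtract_bridge UW iA iB sA sB uU vW) -?eb // eb.
  by rewrite (contracted_genus_plus UW iA iB sA sB uU xU vW yW xu vy) // eq_sym.
rewrite EE eb (setUC [set u]) (setUC A).
rewrite (econtract_bridge WU iB iA sB sA vW uU) ?(setUC [set v]) -?eb //.
rewrite eb (setUC [set u]) (setUC [set x]).
rewrite conn_sym in xu; rewrite conn_sym in vy.
by rewrite (contracted_genus_plus WU iB iA sB sA vW yW uU xU vy xu) // eq_sym.
Qed.

(** An operation on another edge stays on one side of [b], so [b] or its image still separates the
    terminals and [altE_bridge] applies. *)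
Lemma bridge_alt f op : f \in E -> f != b -> f != e ->
  altE x y (eop x y (f, op) E) = false.
Proof.
move=> fE fb fe.
have [u [v [A [B [U [[eb EE iA iB] [uU xU vW yW] _ _ [sA sB]]]]]]] := bridge_split.
have uv : u != v by apply: contraTneq uU => ->; rewrite -in_setC.
have sAB : simple (A :|: B) by apply: simpleU.
have side (c d : T) : [set c; d] \in A :|: B -> (c \in U) = (d \in U).
  rewrite in_setU => /orP[]/insideR-h; first by have [-> ->] := h U iA.
  by have [] := h _ iB; rewrite !in_setC => /negPf-> /negPf->.
have f2 := simpleP _ sE f fE.
have fAB : f \in A :|: B by move: fE; rewrite EE in_setU1 (negPf fb).
have bAB : b \notin A :|: B.
  by rewrite eb; apply/negP => /side; rewrite uU; rewrite in_setC in vW; rewrite (negPf vW).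
rewrite /eop /=; case: op; last first.
  have -> : E :\ f = [set u; v] |: ((A :|: B) :\ f).
    apply/setP=> h; rewrite EE -eb !(in_setD1, in_setU1).
    by case: (eqVneq h b) => [->|_] //=; rewrite eq_sym fb.
  apply: altE_bridge => //; first by rewrite -eb in_setD1 (negPf bAB) andbF.
  apply: contra nk; apply: conn_sub; rewrite EE setU1K //; exact: subsetDl.
have cU z : (cm f z \in U) = (z \in U).
  have /cards2P[c [d [_ ef]]] := f2; have cd : (c \in U) = (d \in U).
    by apply: side; rewrite -ef.
  have fU a : a \in f -> (a \in U) = (c \in U).
    by rewrite ef => /set2P[]->.
  rewrite /contract_map; case: ifP => // zf; rewrite (fU z zf) fU //.
  exact: contract_vertex_in.
have cs c d : [set c; d] \in econtract x y f (A :|: B) -> (c \in U) = (d \in U).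
  by move=> /(econtract_edge sAB)[c' [d' [/side cd -> ->]]]; rewrite !cU.
have nuv : cm f u != cm f v.
  apply: contraTneq uU => h; by rewrite -cU h cU -in_setC.
have -> : econtract x y f E = [set cm f u; cm f v] |: econtract x y f (A :|: B).
  rewrite EE [LHS]econtractU eb; congr (_ :|: _); apply/setP=> h; rewrite in_set1.
  apply/econtractP/eqP => [[h' /set1P-> [-> _]]|->].
    by rewrite imsetU !imset_set1.
  exists [set u; v]; first exact: set11.
  by rewrite imsetU !imset_set1 cards2 nuv.
apply: altE_bridge => //.
  apply/negP => /cs; rewrite !cU uU; rewrite in_setC in vW; by rewrite (negPf vW).
apply: contraL yW => h; rewrite in_setC negbK.
by apply: conn_closed h xU => a c /cs->.
Qed.
End BridgeOps.

(** * Case analysis on eta *)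

Section Numeric.
Variables (T : finType) (M : {set minor_op T}).
Variables (g1 p1 s1 g2 p2 : nat) (a1 a2 e1 : bool).
Variables (gm pm sm : minor_op T -> nat) (am em km : minor_op T -> bool).

(* For mu in M the arguments stand for g, g+, the genus of the sum, eps+, eps
   and the connection of x to y after mu.  Below, eta is compared to a constant
   without subtractions. *)
Definition num_spec g p s (a e k : bool) :=
  [/\ g <= p <= g.+1 /\ (a && a2) <= p + p2, e = (p == g) && a,
      k -> s = minn (g + g2).+1 (p + p2 - (a && a2)) &
      ~~ k -> [/\ s = g + g2, p = g & a = false]].

Hypotheses (f1 : num_spec g1 p1 s1 a1 e1 true) (f2 : g2 <= p2 <= g2.+1).
Hypothesis fm : forall mu, mu \in M -> num_spec (gm mu) (pm mu) (sm mu) (am mu) (em mu) (km mu).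
Hypothesis fb : forall mu, mu \in M -> ~~ km mu -> let nu := con_op mu.1 in
  [/\ mu = del_op mu.1, gm mu = g1,
      [/\ nu \in M, km nu, gm nu = g1 & pm nu = p1] &
      forall mu', mu' \in M -> mu'.1 != mu.1 -> em mu' = false].

Definition tight := forall mu, mu \in M -> sm mu < s1.

Let dG mu := gm mu < g1.
Let dP mu := pm mu < p1.
Let dA mu := pm mu + a1 < p1 + am mu.
Let dE mu := gm mu + e1 < g1 + em mu.
Let dG2 mu := gm mu + 2 <= g1.
Let dA2 mu := pm mu + a1 + 2 <= p1 + am mu.

Lemma op_cases mu : mu \in M -> [/\ g1 <= p1 <= g1.+1 /\ (a1 && a2) <= p1 + p2,
    s1 = minn (g1 + g2).+1 (p1 + p2 - (a1 && a2)),
    gm mu <= pm mu <= (gm mu).+1 /\ (am mu && a2) <= pm mu + p2 &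
    (km mu /\ sm mu = minn (gm mu + g2).+1 (pm mu + p2 - (am mu && a2))) \/
    (~~ km mu /\ sm mu = g1 + g2 /\ gm mu = g1 /\ pm mu = g1 /\ am mu = false)].
Proof.
move=> muM; have [h1 _ /(_ isT) h2 _] := f1; have [h3 _ h4 h5] := fm muM.
have h6 := fb muM; split=> //; case: (boolP (km mu)) h4 h5 h6 => k.
  by move=> /(_ isT); left.
by move=> _ /(_ isT)[-> -> ->] /(_ isT)[_ -> _ _]; right.
Qed.

(** Once the Boolean flags are fixed, the genera are plain natural numbers and each case is linear
    arithmetic. *)
Ltac num muM :=
  have [] := op_cases muM; move: f2; rewrite /dG /dP /dA /dE /dG2 /dA2;
  move: (gm _) (pm _) (sm _) (am _) (km _);
  case: a1; case: a2 => /= gq pq sq [] [] /=; clear; lia.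

Lemma tight_eta_m1 mu : mu \in M -> p1 + p2 + 1 = g1 + g2 + (a1 && a2) ->
  (sm mu < s1) = dA mu.
Proof. by move=> muM; num muM. Qed.

Lemma tight_eta0_0 mu : mu \in M -> p1 + p2 = g1 + g2 + (a1 && a2) -> a2 = false ->
  (sm mu < s1) = dP mu.
Proof. by move=> muM; num muM. Qed.

Lemma tight_eta0_1 mu : mu \in M -> p1 + p2 = g1 + g2 + (a1 && a2) -> a2 ->
  (sm mu < s1) = dA mu || dG2 mu.
Proof. by move=> muM; num muM. Qed.

(** Tightness also applies to the contraction of the bridge, which keeps g and g+; so only eps+ can
    make the genus of the sum drop there. *)
Lemma nonconn_not_tight mu : mu \in M -> ~~ km mu -> tight ->
  [/\ g1 + g2 < s1, pm (con_op mu.1) = p1, gm (con_op mu.1) = g1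
    & sm (con_op mu.1) = minn (g1 + g2).+1 (p1 + p2 - (am (con_op mu.1) && a2)) /\
      sm (con_op mu.1) < s1].
Proof.
move=> muM k ti; have /= [_ _ [nM kn gn pn] _] := fb muM k.
have := ti _ muM; have := ti _ nM; have [_ _ _ [[kk _]|[_ [-> _]]]] := op_cases muM.
  by rewrite kk in k.
have [_ _ /(_ kn) + _] := fm nM; rewrite gn pn => -> h1 h2.
by [].
Qed.

(** Exactly one part has theta = 1. If [p1 = g1], a decrease of g+ forces one of g, and if
    [p1 = g1 + 1], a decrease of g forces one of g+; so a single parameter drops for all operations.
    Without eps+ a bridge contraction cannot lower the genus of the sum. *)
Lemma tight_eta1_0 : p1 + p2 = (g1 + g2).+1 + (a1 && a2) -> a2 = false ->
  tight <-> (forall mu, mu \in M -> dG mu) \/ (forall mu, mu \in M -> dP mu).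
Proof.
move=> eta a20; split=> [ti|h mu muM]; last first.
  have : dG mu || dP mu by case: h => ->; rewrite ?orbT.
  by move: eta a20; num muM.
case: (leqP p1 g1) => pg; [left|right] => mu muM; have := ti mu muM.
  case: (boolP (km mu)) => k.
    by move: eta a20 pg k; num muM.
  have [_ _ _ [+ +]] := nonconn_not_tight muM k ti; move: eta a20 pg; num muM.
by move: eta a20 pg; num muM.
Qed.

(** The numerical form of membership in the class of dumbbells, see [classDP]. *)
Definition bridge_spec b :=
  [/\ p1 = g1, del_op b \in M, con_op b \in M, ~~ km (del_op b) &
     am (con_op b) /\ forall mu, mu \in M -> mu.1 != b -> dG mu].

Lemma tight_eta1_1 : p1 + p2 = (g1 + g2).+1 + (a1 && a2) -> a2 ->
  tight <-> [\/ forall mu, mu \in M -> dG mu, forall mu, mu \in M -> dE mu,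
     forall mu, mu \in M -> dA mu | exists b, bridge_spec b].
Proof.
move=> eta a21; split=> [ti|h mu muM]; last first.
  case: h => [h|h|h|[b [pg dM cM kb [ab h]]]].
  - by have := h mu muM; move: eta a21; num muM.
  - have := h mu muM; rewrite /dE; have [_ -> _ _] := f1; have [_ -> _ _] := fm muM.
    by case: eqP => pg; case: eqP => pgm; move: eta a21 pg pgm; num muM.
  - by have := h mu muM; move: eta a21; num muM.
  have [eb|nb] := eqVneq mu.1 b; last by have := h mu muM nb; move: eta a21; num muM.
  have [_ _ [_ _ gc pc] _] := fb dM kb; rewrite [_.1]/= in gc pc.
  have [em'|em'] : mu = del_op b \/ mu = con_op b.
  - by rewrite -eb; case: (mu) => f []; [right|left].
  - by rewrite em' in muM *; move: kb eta a21; num muM.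
  by rewrite em' in muM *; move: ab gc pc pg eta a21; num muM.
(* With theta = 1 and eps+ = 0 for the first part, every drop of the sum is a drop of g_a+. In the
   remaining case it is a drop of g_a, unless some operation disconnects x from y. *)
case: (boolP ((g1 < p1) && ~~ a1)) => [/andP[pg na]|th].
  by apply: Or43 => mu muM; have := ti mu muM; move: eta a21 pg na; num muM.
have th' : p1 <= g1 \/ a1 by case: leqP th => //=; [left|rewrite negbK; right].
case: (boolP [exists mu in M, ~~ km mu]) => [/exists_inP[mu0 mM k0]|/exists_inPn nk]; last first.
  apply: Or42 => mu muM; have := ti mu muM; have := nk mu muM; rewrite negbK.
  rewrite /dE; have [_ -> _ _] := f1; have [_ -> _ _] := fm muM.
  by case: eqP => pg'; case: eqP => pgm; move: eta a21 th' pg' pgm; num muM.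
have [m0E g0 [nM kn gn pn] alt0] := fb mM k0; set b := mu0.1 in m0E nM kn gn pn alt0.
have tn := ti _ nM.
(* If theta were 1 here, eps+ would be 1 already, and the contraction of the bridge could not lower
   the genus of the sum. *)
have [pg|pg] := leqP p1 g1; last first.
  by exfalso; move: tn kn gn pn eta a21 pg th'; num nM.
case: (boolP a1) => a10.
  by exfalso; move: eta a21 pg a10; num nM.
apply: Or44; exists b; split; rewrite -?m0E //.
  by move: pg; num nM.
split; first by move: tn kn gn pn eta a21 pg a10; num nM.
(* The bridge survives this operation, so eps is 0 afterwards: eps+ can be 1 only if theta is 1, and
   then it does not help. Hence g itself must drop. *)
move=> mu muM nb; have eF := alt0 _ muM nb; have tm := ti _ muM.
have [_ eE _ _] := fm muM; rewrite eF in eE.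
case: (boolP (km mu)) => k.
  move: eE; case: eqP => /= pgm; first by move=> am0; move: (esym am0) k tm eta a21 pg a10 pgm; num muM.
  by move=> _; move: k tm eta a21 pg a10 pgm; num muM.
have /= [_ _ [cM kc gc pc] _] := fb muM k.
have [_ eE' _ _] := fm cM; rewrite (alt0 _ cM nb) gc pc in eE'.
exfalso; move: eE'; case: eqP => /= [_|]; last by move: pg; num cM.
by move=> /esym; move: (ti _ cM) kc gc pc eta a21 pg a10; num cM.
Qed.

(** Both parts have theta = 1, so [g1 + g2 + 1] is the genus of the sum, before and after
    contracting a bridge. A tight part therefore has no bridge between the terminals. *)
Lemma tight_eta2_0 : p1 + p2 = (g1 + g2).+2 + (a1 && a2) -> a2 = false ->
  tight <-> forall mu, mu \in M -> dG mu.
Proof.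
move=> eta a20; split=> [ti|h] mu muM; last by have := h mu muM; move: eta a20; num muM.
case: (boolP (km mu)) => k; first by have := ti mu muM; move: k eta a20; num muM.
have [_ _ [cM kc gc pc] _] := fb muM k.
by exfalso; move: (ti _ cM) kc gc pc eta a20; num cM.
Qed.

Lemma tight_eta2_1 : p1 + p2 = (g1 + g2).+2 + (a1 && a2) -> a2 ->
  tight <-> forall mu, mu \in M -> dG mu || dA2 mu.
Proof.
move=> eta a20; split=> [ti|h] mu muM; last by have := h mu muM; move: eta a20; num muM.
case: (boolP (km mu)) => k; first by have := ti mu muM; move: k eta a20; num muM.
have [_ _ [cM kc gc pc] _] := fb muM k.
by exfalso; move: (ti _ cM) kc gc pc eta a20; num cM.
Qed.

End Numeric.

(** * Invariants and classes *)

Import Order.TTheory GRing.Theory Num.Theory.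
Local Open Scope ring_scope.

Section Values.
Variables (T : finType) (x y : T) (G : graph T).
Hypotheses (xy : x != y) (xG : x \in verts G) (yG : y \in verts G).
Local Notation e := [set x; y].
Local Notation E := (edges G).

Lemma gE_g : g x y G = (gE E)%:Z.
Proof. by rewrite /g (genus_gE xy). Qed.

Lemma gE_g_plus : g_plus x y G = (gE (e |: E))%:Z.
Proof. by rewrite /g_plus /g (genus_gE xy) edges_add_xy. Qed.

Lemma altE_eps : eps x y G = (altE x y E : nat)%:Z.
Proof. by rewrite /eps alternating_minE. Qed.

Lemma altE_eps_plus : eps_plus x y G = (altE x y (e |: E) : nat)%:Z.
Proof. by rewrite /eps_plus /eps (alternating_minE _ xy) (edges_add_xy xy xG yG). Qed.

Lemma theta_gE : theta x y G = (gE (e |: E))%:Z - (gE E)%:Z.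
Proof. by rewrite /theta gE_g_plus gE_g. Qed.

Lemma g_aE : g_a x y G = (gE E)%:Z - (altE x y E : nat)%:Z.
Proof. by rewrite /g_a gE_g altE_eps. Qed.

Lemma g_a_plusE : g_a_plus x y G = (gE (e |: E))%:Z - (altE x y (e |: E) : nat)%:Z.
Proof.
rewrite /g_a_plus /g_a; have := gE_g_plus; rewrite /g_plus => ->.
by have := altE_eps_plus; rewrite /eps_plus => ->.
Qed.
End Values.

Section Classes.
Variables (T : finType) (x y : T) (G : graph T).
Local Notation M := (minor_ops x y G).
Implicit Types (P Q : parameter T).

Lemma DeltaP k P mu : mu \in M ->
  (mu \in Delta k P x y G) = (P x y (apply_op x y mu G) <= P x y G - k%:Z).
Proof. by move=> muM; rewrite in_set muM. Qed.

Lemma Delta_sub k P : Delta k P x y G \subset M.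
Proof. by apply/subsetP=> mu; rewrite in_set => /andP[]. Qed.

Lemma CoP P : in_Gxyo x y G -> Co P x y G <->
  forall mu, mu \in M -> P x y (apply_op x y mu G) <= P x y G - 1.
Proof.
rewrite /Co => -> /=; split=> [/eqP h mu muM|h]; first by rewrite -DeltaP -?h.
rewrite eqEsubset Delta_sub andbT; apply/subsetP=> mu muM.
by rewrite DeltaP ?h.
Qed.

Lemma Delta2P P Q : M == Delta 1 P x y G :|: Delta 2 Q x y G <->
  forall mu, mu \in M -> (P x y (apply_op x y mu G) <= P x y G - 1) ||
                         (Q x y (apply_op x y mu G) <= Q x y G - 2).
Proof.
split=> [/eqP h mu muM|h].
  by have := muM; rewrite {1}h in_setU !DeltaP.
rewrite eqEsubset subUset !Delta_sub !andbT; apply/subsetP=> mu muM.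
by rewrite in_setU !DeltaP ?h.
Qed.
End Classes.

Lemma connected_conn (T : finType) (G : graph T) u v : connected_graph G ->
  u \in verts G -> v \in verts G -> conn (edges G) u v.
Proof.
rewrite /connected_graph => /cards1P[C eC] uV vV; rewrite -cls_eq //.
by have := cls_component uV; have := cls_component vV; rewrite eC !inE => /eqP-> /eqP->.
Qed.

(** * Minor-tight parts of a sum *)

Section Main.
Variables (T : finType) (x y : T) (G G1 G2 : graph T).
Hypotheses (conn1 : connected_graph G1) (conn2 : connected_graph G2).
Hypothesis sumG : xy_sum x y G G1 G2.
Local Notation e := [set x; y].
Local Notation E1 := (edges G1).
Local Notation E2 := (edges G2).
Local Notation M := (minor_ops x y G1).
Local Notation F mu := (eop x y mu E1).

Let o1 : in_Gxyo x y G1. Proof. by case: sumG. Qed.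
Let o2 : in_Gxyo x y G2. Proof. by case: sumG. Qed.
Let xy : x != y. Proof. by case/andP: o1 => /and3P[]. Qed.
Let x1 : x \in verts G1. Proof. by case/andP: o1 => /and3P[]. Qed.
Let y1 : y \in verts G1. Proof. by case/andP: o1 => /and3P[]. Qed.
Let x2 : x \in verts G2. Proof. by case/andP: o2 => /and3P[]. Qed.
Let y2 : y \in verts G2. Proof. by case/andP: o2 => /and3P[]. Qed.
Let eE1 : e \notin E1. Proof. by case/andP: o1. Qed.
Let eE2 : e \notin E2. Proof. by case/andP: o2. Qed.
Let V12 : verts G1 :&: verts G2 \subset e. Proof. by case: sumG => _ _ ->. Qed.
Let s1 : simple E1 := edges_simple G1.
Let s2 : simple E2 := edges_simple G2.
Let in1 : inside E1 (verts G1). Proof. by move=> u v /edge_verts[]. Qed.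
Let in2 : inside E2 (verts G2). Proof. by move=> u v /edge_verts[]. Qed.
Let k1 : conn E1 x y. Proof. exact: connected_conn. Qed.
Let k2 : conn E2 x y. Proof. exact: connected_conn. Qed.
Let in_o1 : in_Gxyo x y G1 := o1.
Let opE mu : mu \in M -> [/\ mu.1 \in E1, #|mu.1| == 2 & mu.1 != e].
Proof.
rewrite in_set => /andP[fE _]; split=> //; first by case: (edgesP fE).
by apply: contraTneq fE => ->.
Qed.

Let opM mu : (mu \in M) = (mu.1 \in E1).
Proof.
rewrite in_set; case: (boolP (mu.1 \in E1)) => //= fE.
by rewrite (contraTneq _ fE) ?implybT // => ->.
Qed.

Lemma eop_simple mu : mu \in M -> simple (F mu).
Proof.
move=> muM; rewrite /eop; case: ifP => _; first exact: econtract_simple.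
by apply: simple_sub s1; apply: subsetDl.
Qed.

Lemma eop_inside mu : mu \in M -> inside (F mu) (verts G1).
Proof.
move=> /opE[fE f2 _]; rewrite /eop; case: ifP => _.
  by apply: econtract_inside => //; case: (edgesP fE).
by apply: inside_sub in1 _; apply: subsetDl.
Qed.

Lemma apply_op_terminals mu : mu \in M ->
  x \in verts (apply_op x y mu G1) /\ y \in verts (apply_op x y mu G1).
Proof.
move=> /opE[_ f2 fe]; rewrite /apply_op; case: ifP => _ //=; split.
  by apply/imsetP; exists x; rewrite // contract_map_x.
by apply/imsetP; exists y; rewrite // contract_map_y.
Qed.

(** The edge operated on belongs to [G1]. Its ends can meet [G2] only in terminals, and contraction
    keeps the terminals fixed. *)
Lemma eop_sum mu : mu \in M -> eop x y mu (E1 :|: E2) = F mu :|: E2.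
Proof.
move=> /opE[fE f2 fe]; rewrite /eop; case: ifP => _.
  rewrite econtractU (econtract_id (E := E2)) // => h z hE zh.
  have zV : z \in verts G2 by have [/subsetP/(_ z zh)] := edgesP hE.
  rewrite /contract_map; case: ifP => // zf.
  have : z \in e.
    by apply: (subsetP V12); rewrite inE zV andbT; have [/subsetP/(_ z zf)] := edgesP fE.
  case/set2P=> ez; rewrite ez in zf *.
    by have := contract_map_x x y mu.1; rewrite /contract_map zf.
  by have := contract_map_y xy fe f2; rewrite /contract_map zf.
rewrite setDUl; congr (_ :|: _); apply/setDidPl; rewrite disjoint_sym disjoints1.
by have := sum_disjoint V12 in1 in2 s1 eE1 => /disjointFr->.
Qed.

Lemma eop_plus mu E : mu \in M -> eop x y mu (e |: E) = e |: eop x y mu E.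
Proof.
move=> /opE[fE f2 fe]; rewrite /eop; case: ifP => _.
  rewrite econtractU (econtract_id (E := [set e])) //.
    by apply/simpleP=> h /set1P->; rewrite cards2 xy.
  by move=> h z /set1P-> /set2P[]->; rewrite ?contract_map_x // contract_map_y.
rewrite setDUl; congr (_ :|: _); apply/setDidPl; rewrite disjoint_sym disjoints1.
by rewrite in_set1.
Qed.

Let S mu := gE (F mu :|: E2).
Let S1 := gE (E1 :|: E2).
Let Sp mu := gE (e |: (F mu :|: E2)).
Let Sp1 := gE (e |: (E1 :|: E2)).
Let gm mu := gE (F mu).
Let pm mu := gE (e |: F mu).
Let am mu := altE x y (e |: F mu).
Let em mu := altE x y (F mu).
Let km mu := conn (F mu) x y.
Let g1 := gE E1.
Let p1 := gE (e |: E1).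
Let a1 := altE x y (e |: E1).
Let e1 := altE x y E1.
Let g2 := gE E2.
Let p2 := gE (e |: E2).
Let a2 := altE x y (e |: E2).

Lemma minor_tight_plus : e \in edges G ->
  minor_tight x y G1 G <-> forall mu, mu \in M -> (Sp mu < Sp1)%N.
Proof.
have [_ _ _ _ eG] := sumG; move=> ee.
have {}eG : edges G = e |: (E1 :|: E2).
  case: eG => // eG; move: ee; rewrite eG in_setU (negPf eE1) (negPf eE2) //.
have h mu : mu \in M -> genus (apply_op x y mu G) = Sp mu.
  by move=> muM; rewrite (genus_gE xy) edges_apply_op eG eop_plus // eop_sum.
rewrite /minor_tight (genus_gE xy) eG -/Sp1; split=> [ti mu muM|ti f fE].
  rewrite -h //; have [fE _ _] := opE muM; have [t1 t2] := ti _ fE.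
  by case: (mu) t1 t2 => f [].
by split; [have := ti (del_op f)|have := ti (con_op f)]; rewrite opM -?h ?opM //; apply.
Qed.

Lemma minor_tight_tight : e \notin edges G ->
  minor_tight x y G1 G <-> tight M S1 S.
Proof.
have [_ _ _ _ eG] := sumG; move=> ee.
have {}eG : edges G = E1 :|: E2 by case: eG => // eG; rewrite eG setU11 in ee.
have h mu : mu \in M -> genus (apply_op x y mu G) = S mu.
  by move=> muM; rewrite (genus_gE xy) edges_apply_op eG eop_sum.
rewrite /minor_tight (genus_gE xy) eG -/S1; split=> [ti mu muM|ti f fE].
  rewrite -h //; have [fE _ _] := opE muM; have [t1 t2] := ti _ fE.
  by case: (mu) t1 t2 => f [].
by split; [have := ti (del_op f)|have := ti (con_op f)]; rewrite opM -?h ?opM //; apply.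
Qed.

Lemma num_spec_sum E : sum_spec x y E2 E ->
  num_spec g2 p2 a2 (gE E) (gE (e |: E)) (gE (E :|: E2))
    (altE x y (e |: E)) (altE x y E) (conn E x y).
Proof.
case=> h1 h2 h3 h4 h5; split=> //; last first.
  move=> /h3->; congr minn; move: h2; rewrite -/p2 -/a2.
  by set p := gE (_ :|: _); set p' := gE (_ |: _); clear; lia.
split=> //; move: h2; rewrite -/p2 -/a2.
by set p := gE (_ :|: _); set p' := gE (_ |: _); clear; lia.
Qed.

Let f1 : num_spec g2 p2 a2 g1 p1 S1 a1 e1 true.
Proof. by have := num_spec_sum (sum_specP xy V12 in2 s2 eE2 k2 in1 s1); rewrite k1. Qed.

Let fm mu : mu \in M ->
  num_spec g2 p2 a2 (gm mu) (pm mu) (S mu) (am mu) (em mu) (km mu).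
Proof.
move=> muM; apply: num_spec_sum.
by apply: (sum_specP xy V12 in2 s2 eE2 k2); [apply: eop_inside|apply: eop_simple].
Qed.

Let f2 : (g2 <= p2 <= g2.+1)%N. Proof. exact: genus_plus. Qed.

Let con_M mu : mu \in M -> con_op mu.1 \in M. Proof. by rewrite !opM. Qed.

Let con_conn f : con_op f \in M -> km (con_op f).
Proof.
move=> /opE[fE f2' fe]; have := conn_econtract x y f k1.
by rewrite contract_map_x contract_map_y.
Qed.

Let fb mu : mu \in M -> ~~ km mu -> let nu := con_op mu.1 in
  [/\ mu = del_op mu.1, gm mu = g1,
      [/\ nu \in M, km nu, gm nu = g1 & pm nu = p1] &
      forall mu', mu' \in M -> mu'.1 != mu.1 -> em mu' = false].
Proof.
case: mu => f [] muM /= nk.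
  by case/negP: nk; apply: con_conn.
have [fE _ _] := opE muM; have [b1 b2 b3] := bridge_genera s1 eE1 fE k1 nk.
have cM := con_M muM; split=> //; first by split=> //; apply: con_conn.
case=> h op hM hf; have [hE _ he] := opE hM.
exact: (bridge_alt xy s1 fE k1 nk).
Qed.

Lemma Co_gP : Co (@g T) x y G1 <-> forall mu, mu \in M -> (gm mu < g1)%N.
Proof.
rewrite CoP //; split=> h mu muM; have := h mu muM; have [xm ym] := apply_op_terminals muM.
  by rewrite !gE_g // edges_apply_op -/(gm mu) -/g1; clear; lia.
by rewrite !gE_g // edges_apply_op -/(gm mu) -/g1; clear; lia.
Qed.

Lemma Co_g_plusP : Co (@g_plus T) x y G1 <-> forall mu, mu \in M -> (pm mu < p1)%N.
Proof.
rewrite CoP //; split=> h mu muM; have := h mu muM; have [xm ym] := apply_op_terminals muM.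
  by rewrite !gE_g_plus // edges_apply_op -/(pm mu) -/p1; clear; lia.
by rewrite !gE_g_plus // edges_apply_op -/(pm mu) -/p1; clear; lia.
Qed.

Lemma Co_g_aP : Co (@g_a T) x y G1 <->
  forall mu, mu \in M -> (gm mu + e1 < g1 + em mu)%N.
Proof.
rewrite CoP //; split=> h mu muM; have := h mu muM; have [xm ym] := apply_op_terminals muM.
  by rewrite !g_aE // edges_apply_op -/(gm mu) -/g1 -/e1 -/(em mu); clear; lia.
by rewrite !g_aE // edges_apply_op -/(gm mu) -/g1 -/e1 -/(em mu); clear; lia.
Qed.

Lemma Co_g_a_plusP : Co (@g_a_plus T) x y G1 <->
  forall mu, mu \in M -> (pm mu + a1 < p1 + am mu)%N.
Proof.
rewrite CoP //; split=> h mu muM; have := h mu muM; have [xm ym] := apply_op_terminals muM.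
  by rewrite !g_a_plusE // edges_apply_op -/(pm mu) -/p1 -/a1 -/(am mu); clear; lia.
by rewrite !g_a_plusE // edges_apply_op -/(pm mu) -/p1 -/a1 -/(am mu); clear; lia.
Qed.

(** Hoppers exclude the first class, so in the union with it only the condition on the operations
    remains. *)
Lemma hopper1P : Co (@g_a_plus T) x y G1 || hopper1 x y G1 <->
  forall mu, mu \in M -> (pm mu + a1 < p1 + am mu)%N || (gm mu + 2 <= g1)%N.
Proof.
have D := Delta2P x y G1 (@g_a_plus T) (@g T).
have C := Co_g_a_plusP; rewrite /hopper1 in_o1 /=.
have h mu : mu \in M -> (g_a_plus x y (apply_op x y mu G1) <= g_a_plus x y G1 - 1)
   || (g x y (apply_op x y mu G1) <= g x y G1 - 2) =
   (pm mu + a1 < p1 + am mu)%N || (gm mu + 2 <= g1)%N.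
  move=> muM; have [xm ym] := apply_op_terminals muM.
  rewrite !g_a_plusE // !gE_g // edges_apply_op -/(pm mu) -/(gm mu) -/p1 -/g1 -/a1 -/(am mu).
  by clear; congr orb; apply/idP/idP; lia.
split=> [/orP[/C hc|/andP[/D hd _]] mu muM|hh].
- by rewrite hc.
- by rewrite -h ?hd.
case: (boolP (Co _ x y G1)) => //= _; rewrite andbT; apply/D => mu muM.
by rewrite h ?hh.
Qed.

Lemma hopper0P : Co (@g T) x y G1 || hopper0 x y G1 <->
  forall mu, mu \in M -> (gm mu < g1)%N || (pm mu + a1 + 2 <= p1 + am mu)%N.
Proof.
have D := Delta2P x y G1 (@g T) (@g_a_plus T).
have C := Co_gP; rewrite /hopper0 in_o1 /=.
have h mu : mu \in M -> (g x y (apply_op x y mu G1) <= g x y G1 - 1)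
   || (g_a_plus x y (apply_op x y mu G1) <= g_a_plus x y G1 - 2) =
   (gm mu < g1)%N || (pm mu + a1 + 2 <= p1 + am mu)%N.
  move=> muM; have [xm ym] := apply_op_terminals muM.
  rewrite !g_a_plusE // !gE_g // edges_apply_op -/(pm mu) -/(gm mu) -/p1 -/g1 -/a1 -/(am mu).
  by clear; congr orb; apply/idP/idP; lia.
split=> [/orP[/C hc|/andP[/D hd _]] mu muM|hh].
- by rewrite hc.
- by rewrite -h ?hd.
case: (boolP (Co _ x y G1)) => //= _; rewrite andbT; apply/D => mu muM.
by rewrite h ?hh.
Qed.

Lemma cut_edgeP b : b \in E1 -> ~~ conn (E1 :\ b) x y -> cut_edge b G1.
Proof.
move=> bE nk; rewrite /cut_edge bE /=.
have := card_components G1; have := card_components (delete b G1).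
rewrite edges_delete (_ : verts (delete b G1) = verts G1) //.
have /cards2P[u [v [_ eb]]] := simpleP _ s1 b bE.
have nuv : ~~ conn (E1 :\ b) u v.
  apply: contra nk => uv; have := k1.
  rewrite -{1}(setD1K bE) {1}eb conn_add => /or3P[//|/andP[a c]|/andP[a c]].
    exact: conn_trans (conn_trans a uv) c.
  by rewrite conn_sym in uv; apply: conn_trans (conn_trans a uv) c.
have := ncomp_add (E1 :\ b) u v; rewrite -eb setD1K // nuv /=.
set c1 := #|components G1|; set c2 := #|components _|; set n := nverts T.
set m1 := ncomp E1; set m2 := ncomp _; set w := #|verts G1|.
by clear; lia.
Qed.

Lemma classDP : classD x y G1 <-> exists b, bridge_spec M g1 p1 gm am km b.
Proof.
have opb b mu : (mu \in [set del_op b; con_op b]) = (mu.1 == b).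
  rewrite in_set2; apply/orP/eqP => [[]/eqP->//|<-].
  by case: mu => f []; [right|left].
have epsE b : b \in E1 -> eps_plus x y (contract x y b G1) = (am (con_op b) : nat)%:Z.
  move=> bE; have bM : con_op b \in M by rewrite opM.
  have [xm ym] := apply_op_terminals bM.
  have := altE_eps_plus xy xm ym; rewrite edges_apply_op -/(am (con_op b)) => <-.
  by rewrite /apply_op.
have thE : (theta x y G1 == 0) = (p1 == g1).
  by rewrite (theta_gE xy x1 y1) subr_eq0 eqz_nat.
have dG mu : mu \in M -> (mu \in Delta 1 (@g T) x y G1) = (gm mu < g1)%N.
  move=> muM; rewrite DeltaP // !(gE_g _ xy) edges_apply_op -/(gm mu) -/g1.
  by clear; lia.
split=> [/existsP[b /and4P[/and4P[_ /andP[bE _] _ nk] th hD ep]]|[b [pg dM cM nk [ac hD]]]].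
- exists b; split; rewrite ?opM //; first by apply/eqP; rewrite -thE.
  + by move: nk; rewrite /km /eop /= -edges_delete.
  split; first by move: ep; rewrite epsE //; case: (am _).
  move=> mu muM nb; rewrite -dG //; apply: (subsetP hD).
  by rewrite in_setD opb nb.
have bE : b \in E1 by move: dM; rewrite opM.
apply/existsP; exists b; rewrite thE pg eqxx epsE // ac /=; apply/and3P; split=> //.
  rewrite /dumbbell in_o1 cut_edgeP //=; apply/andP; split; first exact: k1.
  by move: nk; rewrite /km /eop /= -edges_delete.
by apply/subsetP=> mu; rewrite in_setD opb => /andP[nb muM]; rewrite dG // hD.
Qed.

Lemma minor_tight_iff :
  minor_tight x y G1 G <->
  [/\ e \in edges G ->
        if eps_plus x y G2 == 0 then Co (@g_plus T) x y G1
        else Co (@g_a_plus T) x y G1,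
      e \notin edges G -> eta x y G1 G2 = -1 ->
        Co (@g_a_plus T) x y G1,
      e \notin edges G -> eta x y G1 G2 = 0 ->
        if eps_plus x y G2 == 0 then Co (@g_plus T) x y G1
        else Co (@g_a_plus T) x y G1 || hopper1 x y G1,
      e \notin edges G -> eta x y G1 G2 = 1 ->
        if eps_plus x y G2 == 0
        then Co (@g T) x y G1 || Co (@g_plus T) x y G1
        else [|| Co (@g T) x y G1, Co (@g_a T) x y G1,
                 Co (@g_a_plus T) x y G1 | classD x y G1]
    & e \notin edges G -> eta x y G1 G2 = 2 ->
        if eps_plus x y G2 == 0 then Co (@g T) x y G1
        else Co (@g T) x y G1 || hopper0 x y G1].
Proof.
rewrite /eta !theta_gE // !altE_eps_plus // -/p1 -/p2 -/g1 -/g2 -/a1 -/a2.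
case: (boolP (e \in edges G)) => ee.
  rewrite (minor_tight_plus ee).
  have fp mu : mu \in M -> (Sp mu + (am mu && a2) = pm mu + p2)%N.
    move=> muM.
    by have [_ -> _ _ _] := sum_specP xy V12 in2 s2 eE2 k2 (eop_inside muM) (eop_simple muM).
  have f0 : (Sp1 + (a1 && a2) = p1 + p2)%N.
    by have [_ -> _ _ _] := sum_specP xy V12 in2 s2 eE2 k2 in1 s1.
  move: fp f0; case: a2 => fp f0 /=.
    have C := Co_g_a_plusP; split=> [h|[/(_ isT)/C h _ _ _ _] mu muM].
      split=> // _; apply/C => mu muM; have := h mu muM; have := fp mu muM.
      by move: f0; rewrite !andbT; clear; lia.
    by have := h mu muM; have := fp mu muM; move: f0; rewrite !andbT; clear; lia.
  have C := Co_g_plusP; split=> [h|[/(_ isT)/C h _ _ _ _] mu muM].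
    split=> // _; apply/C => mu muM; have := h mu muM; have := fp mu muM.
    by move: f0; rewrite !andbF; clear; lia.
  by have := h mu muM; have := fp mu muM; move: f0; rewrite !andbF; clear; lia.
rewrite (minor_tight_tight ee) /=.
set eta0 := _ - _.
(* Each value of eta becomes an equation between natural numbers, the form expected by the numerical
   lemmas. *)
have N1 : eta0 = -1 <-> (p1 + p2 + 1 = g1 + g2 + (a1 && a2))%N.
  by rewrite /eta0; case: a1; case: a2; clear; split; lia.
have N2 : eta0 = 0 <-> (p1 + p2 = g1 + g2 + (a1 && a2))%N.
  by rewrite /eta0; case: a1; case: a2; clear; split; lia.
have N3 : eta0 = 1 <-> (p1 + p2 = (g1 + g2).+1 + (a1 && a2))%N.
  by rewrite /eta0; case: a1; case: a2; clear; split; lia.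
have N4 : eta0 = 2 <-> (p1 + p2 = (g1 + g2).+2 + (a1 && a2))%N.
  by rewrite /eta0; case: a1; case: a2; clear; split; lia.
have N : [\/ eta0 = -1, eta0 = 0, eta0 = 1 | eta0 = 2].
  have [/N1|[/N2|[/N3|/N4]]] : (p1 + p2 + 1 = g1 + g2 + (a1 && a2) \/
      (p1 + p2 = g1 + g2 + (a1 && a2) \/ (p1 + p2 = (g1 + g2).+1 + (a1 && a2) \/
       p1 + p2 = (g1 + g2).+2 + (a1 && a2))))%N.
  - have [[+ _] _ _ _] := f1; move: f2.
    by case: a1; case: a2 => /=; clear; lia.
  - exact: Or41.
  - exact: Or42.
  - exact: Or43.
  exact: Or44.
have e0 (b : bool) : ((b : nat)%:Z == 0) = ~~ b by case: b.
rewrite e0.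
have Q1 : eta0 = -1 -> tight M S1 S <-> Co (@g_a_plus T) x y G1.
  move=> /N1 eta; rewrite Co_g_a_plusP.
  by split=> h mu muM; have := h mu muM; rewrite (tight_eta_m1 f1 f2 fm fb muM eta).
have Q2 : eta0 = 0 -> tight M S1 S <-> (if ~~ a2 then Co (@g_plus T) x y G1
        else Co (@g_a_plus T) x y G1 || hopper1 x y G1).
  move=> /N2 eta; case: (boolP a2) => a20 /=.
    rewrite hopper1P.
    by split=> h mu muM; have := h mu muM; rewrite (tight_eta0_1 f1 f2 fm fb muM eta a20).
  rewrite Co_g_plusP; have {}a20 := negbTE a20.
  by split=> h mu muM; have := h mu muM; rewrite (tight_eta0_0 f1 f2 fm fb muM eta a20).
have Q3 : eta0 = 1 -> tight M S1 S <->
    (if ~~ a2 then Co (@g T) x y G1 || Co (@g_plus T) x y G1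
     else [|| Co (@g T) x y G1, Co (@g_a T) x y G1,
              Co (@g_a_plus T) x y G1 | classD x y G1]).
  have [C1 C2 C3 C4] := And4 Co_gP Co_g_aP Co_g_a_plusP classDP; have C5 := Co_g_plusP.
  move=> /N3 eta; case: (boolP a2) => a20 /=.
    rewrite (tight_eta1_1 f1 f2 fm fb eta a20).
    split=> [[/C1->|/C2->|/C3->|/C4->]|/or4P[/C1|/C2|/C3|/C4] h]; rewrite ?orbT //.
    - exact: Or41.
    - exact: Or42.
    - exact: Or43.
    exact: Or44.
  rewrite (tight_eta1_0 f1 f2 fm fb eta (negbTE a20)).
  by split=> [[/C1->|/C5->]|/orP[/C1|/C5]]; rewrite ?orbT; [| |left|right].
have Q4 : eta0 = 2 -> tight M S1 S <-> (if ~~ a2 then Co (@g T) x y G1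
     else Co (@g T) x y G1 || hopper0 x y G1).
  move=> /N4 eta; case: (boolP a2) => a20 /=.
    by rewrite hopper0P; apply: (tight_eta2_1 f1 f2 fm fb eta a20).
  by rewrite Co_gP; apply: (tight_eta2_0 f1 f2 fm fb eta (negbTE a20)).
split=> [ti|[_ h1 h2 h3 h4]].
  by split=> // _ h; [apply/Q1|apply/Q2|apply/Q3|apply/Q4].
by case: N => h; [apply/Q1 => //; apply: h1|apply/Q2 => //; apply: h2|
  apply/Q3 => //; apply: h3|apply/Q4 => //; apply: h4].
Qed.
End Main.

Theorem theorem28 (T : finType) (x y : T) (G G1 G2 : graph T)
    (conn1 : connected_graph G1) (conn2 : connected_graph G2)
    (sumG : xy_sum x y G G1 G2) :
  minor_tight x y G1 G <->
  [/\ [set x; y] \in edges G ->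
        if eps_plus x y G2 == 0 then Co (@g_plus T) x y G1
        else Co (@g_a_plus T) x y G1,
      [set x; y] \notin edges G -> eta x y G1 G2 = -1 ->
        Co (@g_a_plus T) x y G1,
      [set x; y] \notin edges G -> eta x y G1 G2 = 0 ->
        if eps_plus x y G2 == 0 then Co (@g_plus T) x y G1
        else Co (@g_a_plus T) x y G1 || hopper1 x y G1,
      [set x; y] \notin edges G -> eta x y G1 G2 = 1 ->
        if eps_plus x y G2 == 0
        then Co (@g T) x y G1 || Co (@g_plus T) x y G1
        else [|| Co (@g T) x y G1, Co (@g_a T) x y G1,
                 Co (@g_a_plus T) x y G1 | classD x y G1]
    & [set x; y] \notin edges G -> eta x y G1 G2 = 2 ->
        if eps_plus x y G2 == 0 then Co (@g T) x y G1
        else Co (@g T) x y G1 || hopper0 x y G1].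
Proof. exact: minor_tight_iff. Qed.
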